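(* Fix $h\ge0$, $D\in\mathbb R$. There exists $\beta'>0$ such that for every $\beta\in(0,\beta')$: if $(g_T,g_S)$ is a centered Gaussian vector with covariance matrix $\begin{pmatrix}A_0^2&C_0^2\\C_0^2&B_0^2\end{pmatrix}$, then for all nonnegative integers $h,h'$, $$\nu(T^hS^{h'})=\mathbb E[g_T^hg_S^{h'}]+O(N^{-(h+h'+1)/2}),$$ with implied constant independent of $N$.
   Context: Fix an integer $\mathcal S\ge1$ and $N\ge2$; $\Sigma_N=\{0,\pm1,\dots,\pm\mathcal S\}^N$. For $\beta>0$, $h\ge0$, $D\in\mathbb R$ and i.i.d. standard Gaussians $(g_{i,j})_{i<j}$, $H_N(\sigma)=\frac{\beta}{\sqrt N}\sum_{i<j}g_{i,j}\sigma_i\sigma_j+D\sum_i\sigma_i^2+h\sum_i\sigma_i$, Gibbs measure $G(\sigma)\propto e^{H_N(\sigma)}$ on $\Sigma_N$; $\langle\cdot\rangle$ is the Gibbs average, $\nu(f)=\mathbb E\langle f\rangle$. $p,q$: for $\eta\sim N(0,1)$, $\langle\phi\rangle_\eta=\sum_s\phi(s)w_\eta(s)/\sum_sw_\eta(s)$, $w_\eta(s)=\exp(\beta\sqrt q\eta s+hs+(D+\frac{\beta^2}{2}(p-q))s^2)$, $s\in\{0,\pm1,\dots,\pm\mathcal S\}$; $(p,q)$ solves $q=\mathbb E\langle s\rangle_\eta^2$, $p=\mathbb E\langle s^2\rangle_\eta$ (unique at high temperature). $T=\frac1N\sum_i\langle\sigma_i\rangle^2-q$, $S=\frac1N\sum_i\langle\sigma_i^2\rangle-p$.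 Constants: $m_j=\langle s^j\rangle_\eta$, expectations over $\eta$: $A=\mathbb E[(m_2-m_1^2)^2]$, $\mathcal D=\mathbb E[m_4-m_2^2]$, $F=\mathbb E[m_2^2-m_1^2m_2]$, $G=\mathbb E[m_1^2(m_2-m_1^2)]$, $\mathcal E=\mathbb E[m_1(m_3-m_1m_2)]$, $I_3=\mathbb E[m_1^4]-q^2$, $I_5=\mathbb E[m_1^2m_2]-pq$, $K_4=\mathbb E[m_2^2]-p^2$; $M_1=1-\beta^2(F-3G)$, $M_2=1-\frac{\beta^2}{2}\mathcal D$, $M_3=1-\beta^2(F-G)$, $M=M_1M_2+\beta^4\mathcal E^2$; $A_2^2=\frac{A}{N(1-\beta^2A)}$, $A_1^2=\frac{GM_2+\frac{\beta^2}{2}\mathcal E^2}{NMM_3}$, $B_1^2=\frac{\mathcal DM_1-2\beta^2\mathcal E^2}{NM}$, $C_1^2=\frac{\mathcal E}{NM}$; $A_0^2=\frac{\beta^2}{M}(\beta^2\mathcal EK_4+M_2I_5)C_1^2+\frac{2\beta^2}{M}(\beta^2\mathcal E(\mathcal E-I_5)+M_2(2G-I_3))A_1^2+\frac{\beta^2}{M}(\beta^2\mathcal EI_5+M_2I_3)A_2^2+\frac{1}{MN}(\beta^2\mathcal EI_5+M_2I_3)$, $B_0^2=\frac{\beta^2}{2M}(M_1K_4-\beta^2\mathcal EI_5)B_1^2+\frac{\beta^2}{M}(M_1(\mathcal E-I_5)-\beta^2\mathcal E(2G-I_3))C_1^2+\frac{1}{MN}(M_1K_4-\beta^2\mathcal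 EI_5)$, $C_0^2=\frac{\beta^2}{2M}(M_2I_5+\beta^2\mathcal EK_4)B_1^2+\frac{\beta^2}{M}(M_2(2G-I_3)+\beta^2\mathcal E(\mathcal E-I_5))C_1^2+\frac{1}{MN}(M_2I_5+\beta^2\mathcal EK_4)$. *)

(* Defs.v *)
From HB Require Import structures.
From mathcomp Require Import all_boot all_order all_algebra.
From mathcomp Require Import all_classical all_reals all_analysis.
Set Implicit Arguments. Unset Strict Implicit. Unset Printing Implicit Defensive.
Import Order.TTheory GRing.Theory Num.Theory.
Import numFieldNormedType.Exports.
Local Open Scope classical_set_scope.
Local Open Scope ring_scope.

Section Defs.
Variable R : realType.

(** Expectation of F(g_0,...,g_{n-1}) for i.i.d. standard Gaussians g_k,
    as an iterated Lebesgue integral against the standard normal density.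
    Coordinates k >= n are set to 0 (they are never used below). *)
Fixpoint gaussE_aux (n : nat) (F : (nat -> R) -> R) (g : nat -> R) : R :=
  match n with
  | 0 => F g
  | n'.+1 => \int[@lebesgue_measure R]_(x in [set: R])
               (normal_pdf 0 1 x * gaussE_aux n' F
                  (fun k => if k == n' then x else g k))
  end.
Definition gaussE (n : nat) (F : (nat -> R) -> R) : R :=
  gaussE_aux n F (fun _ => 0).

Definition etaE (f : R -> R) : R := gaussE 1 (fun g => f (g 0%N)).

Definition spin (Sc : nat) (k : 'I_(2 * Sc + 1)) : R := k%:R - Sc%:R.

Definition config (Sc N : nat) := {ffun 'I_N -> 'I_(2 * Sc + 1)}.

Definition gij (N : nat) (g : nat -> R) (i j : 'I_N) : R := g (i * N + j)%N.

Definition hamiltonian (Sc N : nat) (beta h D : R) (g : nat -> R)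
    (sigma : config Sc N) : R :=
  beta / Num.sqrt N%:R *
    (\sum_(i < N) \sum_(j < N | (i < j)%N)
        gij g i j * spin (sigma i) * spin (sigma j))
  + D * \sum_(i < N) spin (sigma i) ^+ 2
  + h * \sum_(i < N) spin (sigma i).

Definition gibbs (Sc N : nat) (beta h D : R) (g : nat -> R)
    (f : config Sc N -> R) : R :=
  (\sum_(sigma : config Sc N) f sigma * expR (hamiltonian beta h D g sigma)) /
  (\sum_(sigma : config Sc N) expR (hamiltonian beta h D g sigma)).

Definition site_w (Sc : nat) (beta h D p q eta : R) (k : 'I_(2 * Sc + 1)) : R :=
  expR (beta * Num.sqrt q * eta * spin k + h * spin k
        + (D + beta ^+ 2 / 2 * (p - q)) * spin k ^+ 2).
Definition site_avg (Sc : nat) (beta h D p q eta : R)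
    (phi : R -> R) : R :=
  (\sum_(k < 2 * Sc + 1) phi (spin k) * site_w beta h D p q eta k) /
  (\sum_(k < 2 * Sc + 1) site_w beta h D p q eta k).

Definition mom (Sc : nat) (beta h D p q : R) (j : nat) (eta : R) : R :=
  site_avg Sc beta h D p q eta (fun s => s ^+ j).

Definition fixed_point (Sc : nat) (beta h D p q : R) : Prop :=
  0 <= q /\
  q = etaE (fun eta => (mom Sc beta h D p q 1 eta) ^+ 2) /\
  p = etaE (fun eta => mom Sc beta h D p q 2 eta).

Definition Tstat (Sc N : nat) (beta h D q : R) (g : nat -> R) : R :=
  N%:R^-1 * (\sum_(i < N)
     (gibbs beta h D g (fun sigma : config Sc N => spin (sigma i))) ^+ 2) - q.
Definition Sstat (Sc N : nat) (beta h D p : R) (g : nat -> R) : R :=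
  N%:R^-1 * (\sum_(i < N)
     gibbs beta h D g (fun sigma : config Sc N => spin (sigma i) ^+ 2)) - p.

(** nu(T^k S^k') = E <T^k S^k'> ; T, S depend only on the disorder. *)
Definition nuTS (Sc N : nat) (beta h D p q : R) (k k' : nat) : R :=
  gaussE (N * N) (fun g => (Tstat Sc N beta h D q g) ^+ k *
                           (Sstat Sc N beta h D p g) ^+ k').

Section Consts.
Variables (Sc : nat) (beta h D p q : R) (N : nat).
Let m (j : nat) (eta : R) := mom Sc beta h D p q j eta.
Definition cA := etaE (fun e => (m 2 e - m 1 e ^+ 2) ^+ 2).
Definition cD := etaE (fun e => m 4 e - m 2 e ^+ 2).
Definition cF := etaE (fun e => m 2 e ^+ 2 - m 1 e ^+ 2 * m 2 e).
Definition cG := etaE (fun e => m 1 e ^+ 2 * (m 2 e - m 1 e ^+ 2)).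
Definition cE := etaE (fun e => m 1 e * (m 3 e - m 1 e * m 2 e)).
Definition cI3 := etaE (fun e => m 1 e ^+ 4) - q ^+ 2.
Definition cI5 := etaE (fun e => m 1 e ^+ 2 * m 2 e) - p * q.
Definition cK4 := etaE (fun e => m 2 e ^+ 2) - p ^+ 2.
Definition cM1 := 1 - beta ^+ 2 * (cF - 3 * cG).
Definition cM2 := 1 - beta ^+ 2 / 2 * cD.
Definition cM3 := 1 - beta ^+ 2 * (cF - cG).
Definition cM := cM1 * cM2 + beta ^+ 4 * cE ^+ 2.
Definition NR := (N%:R : R).
Definition cA2sq := cA / (NR * (1 - beta ^+ 2 * cA)).
Definition cA1sq := (cG * cM2 + beta ^+ 2 / 2 * cE ^+ 2) / (NR * cM * cM3).
Definition cB1sq := (cD * cM1 - 2 * beta ^+ 2 * cE ^+ 2) / (NR * cM).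
Definition cC1sq := cE / (NR * cM).
Definition cA0sq :=
  beta ^+ 2 / cM * (beta ^+ 2 * cE * cK4 + cM2 * cI5) * cC1sq
  + 2 * beta ^+ 2 / cM * (beta ^+ 2 * cE * (cE - cI5) + cM2 * (2 * cG - cI3)) * cA1sq
  + beta ^+ 2 / cM * (beta ^+ 2 * cE * cI5 + cM2 * cI3) * cA2sq
  + (cM * NR)^-1 * (beta ^+ 2 * cE * cI5 + cM2 * cI3).
Definition cB0sq :=
  beta ^+ 2 / (2 * cM) * (cM1 * cK4 - beta ^+ 2 * cE * cI5) * cB1sq
  + beta ^+ 2 / cM * (cM1 * (cE - cI5) - beta ^+ 2 * cE * (2 * cG - cI3)) * cC1sq
  + (cM * NR)^-1 * (cM1 * cK4 - beta ^+ 2 * cE * cI5).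
Definition cC0sq :=
  beta ^+ 2 / (2 * cM) * (cM2 * cI5 + beta ^+ 2 * cE * cK4) * cB1sq
  + beta ^+ 2 / cM * (cM2 * (2 * cG - cI3) + beta ^+ 2 * cE * (cE - cI5)) * cC1sq
  + (cM * NR)^-1 * (cM2 * cI5 + beta ^+ 2 * cE * cK4).
End Consts.

(** E[g_T^k g_S^k'] for the centered Gaussian vector
    (g_T, g_S) = (a X + b Y, c X + d Y), X, Y i.i.d. N(0,1). *)
Definition gauss2_moment (a b c d : R) (k k' : nat) : R :=
  gaussE 2 (fun g => (a * g 0%N + b * g 1%N) ^+ k * (c * g 0%N + d * g 1%N) ^+ k').

End Defs.

(* Submission.v *)
(** The last site is isolated by an interpolation: at angle t its couplings are multiplied by
    sin t, while an independent one-site Gaussian field is switched on with factor cos t. At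
    t = pi / 2 this is the original system; at t = 0 the last spin decouples and its replicas have
    moments E[m_i m_j ...]. By Gaussian integration by parts the derivative in t of a replica
    average involves only the overlap deviations U_uv = R_uv - q (or - p if u = v).

    At small beta, Gronwall's inequality and the symmetry between sites give
    E<|U_uv|^(2m)> = O(N^-m) for all m. Expanding to second order at t = 0 then gives, for a product
    W of r deviations, with weights a_u, b_v and c_uv = E<(eps_a eps_b - Q_ab) eps_u eps_v> at t = 0,
      nu(U_ab W) = beta^2/2 sum_uv a_u b_v c_uv nu(U_uv W) + (1/N) sum_(e in W) c_e nu(W / e)
                   + O(N^(-(r+2)/2)).
    If W runs over k pairs and k' single replicas, all distinct, then nu(W) = nu(T^k S^k').
    Letting a, b run over replicas of W and fresh ones, these equations collapse to 2x2 linear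
    systems of determinant M, whose solution is
      nu(T^(k+1) S^k') = k A_0^2 nu(T^(k-1) S^k') + k' C_0^2 nu(T^k S^(k'-1)) + O(N^(-(k+k'+2)/2)),
    and similarly nu(S^(k'+1)) with B_0^2. Gaussian moments satisfy this recursion exactly. *)

Require Import Defs.
From HB Require Import structures.
From mathcomp Require Import all_boot all_order all_algebra.
From mathcomp Require Import fingroup perm.
From mathcomp Require Import all_classical all_reals all_analysis.
From mathcomp Require Import measurable_realfun.
From mathcomp Require Import ring lra zify.
Set Implicit Arguments. Unset Strict Implicit. Unset Printing Implicit Defensive.
Import Order.TTheory GRing.Theory Num.Theory.
Import numFieldNormedType.Exports.
Local Open Scope classical_set_scope.
Local Open Scope ring_scope.

(** * Gaussian integrals *)

Section StandardGaussian.
Variable R : realType.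
Implicit Types (f g : R -> R) (x y : R).

Notation mu := (@lebesgue_measure R).
Notation phi := (@normal_pdf R 0 1).

(** Expectations are iterated Lebesgue integrals, so every algebraic step with them carries
    measurability and integrability conditions. One class discharges them all: functions that are
    Lipschitz with a polynomially growing constant. It is stable under sums, products and partial
    integration, and it contains the Gibbs averages. Derivatives under the expectation enter through
    quadratic remainder bounds, which can be integrated directly in place of a dominated convergence
    argument.

    Two versions of the overlap deviation coexist. The full [U] is invariant under exchange of
    sites, while factorization at the decoupled end requires [Um], which omits the last site. Their
    difference [eps eps / N] is the origin of the [1/N] sum in the expansion.

    The threshold for beta must serve moments of all orders at once, so the constant absorbed in the
    moment bound must not grow with the order. The threshold obtained depends on the spin bound
    only. *)

Definition gint f : R := \int[mu]_(x in [set: R]) (phi x * f x).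

Definition polybound f := exists C d, forall x, `|f x| <= C * (1 + `|x|) ^+ d.

Definition gintegrable f := mu.-integrable setT (EFin \o (fun x => phi x * f x)).

(** Raise [1 + y <= expR y] at [y = x ^+ 2 / (4 * e)] to the power [e]; the choice [e = d + 1] keeps
    the division legitimate when [d = 0]. *)
Lemma pow_le_exp_sq d : exists2 K : R, 0 < K &
  forall x, (1 + `|x|) ^+ d <= K * expR (x ^+ 2 / 4).
Proof.
pose e := d.+1; pose c : R := 2 + 4 * e%:R.
have c0 : 0 < c by rewrite ltr_pwDl// mulr_ge0.
have e0 : (0 : R) < e%:R by rewrite ltr0n.
exists (c ^+ e); first exact: exprn_gt0.
move=> x; apply: (@le_trans _ _ ((1 + `|x|) ^+ e)).
  by rewrite exprS ler_peMl ?lerDl// exprn_ge0// addr_ge0.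
have -> : expR (x ^+ 2 / 4) = expR (x ^+ 2 / (4 * e%:R)) ^+ e.
  rewrite -expRM_natl; congr expR; rewrite -mulr_natl; field.
  by rewrite gt_eqF.
rewrite -exprMn; apply: lerXn2r; rewrite ?nnegrE ?addr_ge0 ?mulr_ge0 ?expR_ge0 ?(ltW c0)//.
apply: (@le_trans _ _ (c * (1 + x ^+ 2 / (4 * e%:R)))); last first.
  by rewrite ler_pM2l// expR_ge1Dx.
have xx : `|x| <= 1 + x ^+ 2.
  by rewrite -real_normK ?num_real//; move: (normr_ge0 x) => ?; nra.
rewrite /c mulrDr mulr1.
have -> : (2 + 4 * e%:R) * (x ^+ 2 / (4 * e%:R)) = x ^+ 2 + 2 * x ^+ 2 / (4 * e%:R).
  by field; rewrite gt_eqF.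
have : 0 <= 2 * x ^+ 2 / (4 * e%:R) by apply: divr_ge0; apply: mulr_ge0; rewrite ?sqr_ge0 ?(ltW e0).
have : (0 : R) <= 4 * e%:R by apply: mulr_ge0; rewrite ?(ltW e0).
lra.
Qed.

Lemma gaussian_pdfE x : phi x = normal_peak 1 * expR (- (x ^+ 2 / 2)).
Proof.
rewrite normal_pdfE ?oner_neq0//; congr (_ * _).
by rewrite /normal_fun subr0 expr1n -[1 *+ 2]/(2%:R) mulNr.
Qed.

(** The factor [expR (x ^+ 2 / 4)] turns the density of variance 1 into a multiple of the density of
    variance 2, an integrable majorant. *)
Lemma pow_mul_pdf_le d : exists2 K : R, 0 < K &
  forall x, (1 + `|x|) ^+ d * phi x <= K * normal_pdf 0 (Num.sqrt 2) x.
Proof.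
have [K K0 HK] := pow_le_exp_sq d.
have s2 : Num.sqrt 2 != 0 :> R by rewrite gt_eqF// sqrtr_gt0.
have p2 := @normal_peak_gt0 R _ s2.
have p1 := @normal_peak_gt0 R 1 (oner_neq0 _).
exists (K * normal_peak 1 / normal_peak (Num.sqrt 2)).
  by rewrite divr_gt0 ?mulr_gt0.
move=> x; rewrite gaussian_pdfE normal_pdfE// /normal_fun subr0 sqr_sqrtr//.
have -> : - x ^+ 2 / (2 *+ 2) = x ^+ 2 / 4 + - (x ^+ 2 / 2) by rewrite -mulr_natr; field.
rewrite expRD; set E1 := expR (x ^+ 2 / 4); set E2 := expR (- _).
have -> : K * normal_peak 1 / normal_peak (Num.sqrt 2) * (normal_peak (Num.sqrt 2) * (E1 * E2))
  = normal_peak 1 * (K * E1 * E2) by field; rewrite gt_eqF.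
by rewrite mulrCA ler_pM2l// ler_pM2r ?expR_gt0.
Qed.

Lemma pdf_ge0 x : 0 <= phi x. Proof. exact: normal_pdf_ge0. Qed.

Lemma gintegrable_meas f : measurable_fun setT f -> polybound f -> gintegrable f.
Proof.
move=> mf [C [d Cd]]; have [K K0 HK] := pow_mul_pdf_le d.
have C0 : 0 <= C by have := Cd 0; rewrite normr0 addr0 expr1n mulr1; apply: le_trans.
have int2 : mu.-integrable setT (EFin \o (fun x => (C * K) * normal_pdf 0 (Num.sqrt 2) x)).
  have /(integrableZl measurableT (C * K)) := @integrable_normal_pdf R 0 (Num.sqrt 2).
  by apply: eq_integrable => // x _ /=; rewrite EFinM.
apply: le_integrable int2 => //.
  apply/measurable_EFinP; apply: measurable_funM => //.
  exact: measurable_normal_pdf.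
move=> x _ /=; rewrite lee_fin normrM (ger0_norm (pdf_ge0 x)).
rewrite [leRHS]ger0_norm ?mulr_ge0 ?(ltW K0) ?normal_pdf_ge0//.
apply: (le_trans (ler_wpM2l (pdf_ge0 x) (Cd x))).
by rewrite mulrCA -mulrA ler_wpM2l// mulrC.
Qed.

Lemma gintD f g : gintegrable f -> gintegrable g ->
  gint (fun x => f x + g x) = gint f + gint g.
Proof.
move=> If Ig; rewrite /gint -RintegralD//; apply: eq_Rintegral => x _.
by rewrite mulrDr.
Qed.

Lemma gintZ c f : gintegrable f -> gint (fun x => c * f x) = c * gint f.
Proof.
move=> If; rewrite /gint -RintegralZl//; apply: eq_Rintegral => x _.
by rewrite mulrCA.
Qed.

Lemma gint1 : gint (fun=> 1) = 1.
Proof.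
rewrite /gint /Rintegral.
under eq_integral do rewrite mulr1.
by rewrite integral_normal_pdf.
Qed.

Lemma gint_le f g : gintegrable f -> gintegrable g ->
  (forall x, f x <= g x) -> gint f <= gint g.
Proof.
by move=> If Ig fg; apply: le_Rintegral => // x _; rewrite ler_wpM2l ?pdf_ge0.
Qed.

Lemma eq_gint f g : f =1 g -> gint f = gint g.
Proof. by move=> fg; congr gint; apply/funext. Qed.

End StandardGaussian.

(** The difference quotient is within [C |e|] of [l]. A remainder bound of this kind survives
    integration, so this criterion yields derivatives of expectations. *)
Lemma is_derive_quad (R : realType) (f : R -> R) (x l C : R) :
  (forall e, `|e| <= 1 -> `|f (x + e) - f x - e * l| <= C * e ^+ 2) ->
  is_derive x 1 f l.
Proof.
move=> H; apply/is_derive1_caratheodory.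
exists (fun z => if z == x then l else (f z - f x) / (z - x)).
split; last by rewrite eqxx.
  move=> z; case: eqP => [->|/eqP zx]; first by rewrite !subrr mulr0.
  by rewrite divfK// subr_eq0.
have C0 : 0 <= C.
  by have := H 1; rewrite normr1 expr1n mulr1 => /(_ (lexx _)); apply: le_trans.
apply/cvgrPdist_le => e e0; near=> z; rewrite eqxx.
case: eqP => [_|/eqP zx]; first by rewrite subrr normr0 ltW.
have zx0 : z - x != 0 by rewrite subr_eq0.
have -> : l - (f z - f x) / (z - x) = - ((f (x + (z - x)) - f x - (z - x) * l) / (z - x)).
  by rewrite (addrC x) subrK; field.
rewrite normrN normrM normfV ler_pdivrMr ?normr_gt0//.
apply: (le_trans (H _ _)).
  by rewrite distrC; near: z; apply: cvgr_dist_le => //; exact: cvg_id.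
rewrite -real_normK ?num_real// expr2 mulrA ler_wpM2r//.
apply: (@le_trans _ _ (C * (e / (C + 1)))).
  rewrite ler_wpM2l// distrC; near: z.
  by apply: cvgr_dist_le; [exact: cvg_id|rewrite divr_gt0// ltr_wpDl].
by rewrite mulrCA ler_piMr ?(ltW e0)// ler_pdivrMr ?mul1r ?lerDl// ltr_wpDl.
Unshelve. all: by end_near. Qed.

(** * One-dimensional Gaussian integration by parts *)

Section Stein.
Variable R : realType.
Implicit Types (f g : R -> R) (x y : R).
Notation phi := (@normal_pdf R 0 1).

Lemma is_derive_gaussian_pdf x : is_derive x 1 phi (- x * phi x).
Proof.
have -> : phi = fun y => normal_peak 1 * expR (- (y ^+ 2 / 2)).
  by apply/funext => y; exact: gaussian_pdfE.
have -> : (fun y => normal_peak 1 * expR (- (y ^+ 2 / 2))) =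
   (normal_peak 1) *: (expR \o (fun y : R => - (y ^+ 2 / 2))).
  by apply/funext.
have H : is_derive x 1 (fun y : R => - (y ^+ 2 / 2)) (- x).
  have -> : (fun y : R => - (y ^+ 2 / 2)) = (- 2^-1) *: (@GRing.exp R ^~ 2%N).
    by apply/funext => y; rewrite !fctE /GRing.scale /= mulNr mulrC.
  apply: is_derive_eq; rewrite /GRing.scale/=.
  by field.
apply: is_derive_eq; rewrite /GRing.scale/=.
by ring.
Qed.

Lemma gint_eq0_limit (a K : R) : 0 <= K -> (forall n : nat, `|a| <= K / n.+1%:R) -> a = 0.
Proof.
move=> K0 H; apply/eqP; rewrite -normr_eq0; apply/eqP/le_anti.
rewrite normr_ge0 andbT; apply/ler_addgt0Pr => e e0; rewrite add0r.
have [n Hn] : exists n : nat, K / e < n.+1%:R.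
  by eexists; exact: truncnS_gt.
apply: (le_trans (H n)).
by rewrite ler_pdivrMr ?ltr0n// mulrC -ler_pdivrMr// ltW.
Qed.

(** With [H = x f - f1] one has [(- phi f)' = phi H]. On [[-a, a]] the fundamental theorem leaves
    boundary terms of order [1/a], because [(1 + |x|) phi |f|] is bounded; outside, [|x| / a >= 1]
    trades one more power of [|x|] for a factor [1/a]. Hence the integral of [phi H] is [O(1/a)] for
    every [a]. *)
Lemma gint_stein f f1 : continuous f1 -> polybound f -> polybound f1 ->
  (forall x, is_derive x 1 f (f1 x)) ->
  gint (fun x => x * f x) = gint f1.
Proof.
move=> cf1 [Cf [df Bf]] [C1 [d1 B1]] Df.
have cf : continuous f.
  by move=> x; apply/differentiable_continuous/derivable1_diffP; apply: ex_derive.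
pose H x := x * f x - f1 x.
have cH : continuous H.
  by move=> x; apply: cvgB; [apply: cvgM; [exact: cvg_id|exact: cf]|exact: cf1].
have mono (a b : nat) x : (a <= b)%N -> (1 + `|x|) ^+ a <= (1 + `|x|) ^+ b.
  by move=> ab; apply: ler_weXn2l => //; rewrite lerDl.
have Cf0 : 0 <= Cf by have := Bf 0; rewrite normr0 addr0 expr1n mulr1; apply: le_trans.
have C10 : 0 <= C1 by have := B1 0; rewrite normr0 addr0 expr1n mulr1; apply: le_trans.
have pxf : polybound (fun x => x * f x).
  exists Cf, df.+1 => x; rewrite normrM exprS mulrCA ler_pM// lerDr//.
have pH : exists2 C, 0 <= C & exists d, forall x, `|H x| <= C * (1 + `|x|) ^+ d.
  exists (Cf + C1); first exact: addr_ge0.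
  exists (df.+1 + d1)%N => x; rewrite /H mulrDl.
  apply: (le_trans (ler_normB _ _)); apply: lerD.
    rewrite normrM; apply: (@le_trans _ _ (Cf * (1 + `|x|) ^+ df.+1)).
      by rewrite exprS mulrCA ler_pM// lerDr.
    by rewrite ler_wpM2l// mono// leq_addr.
  by apply: (le_trans (B1 x)); rewrite ler_wpM2l// mono// leq_addl.
case: pH => C C0 [d BH].
have IH : gintegrable H.
  by apply: gintegrable_meas; [exact: continuous_measurable_fun|exists C, d].
have mxf : measurable_fun setT (fun x => x * f x).
  by apply: measurable_funM => //; exact: continuous_measurable_fun.
have Ixf : gintegrable (fun x => x * f x) by exact: gintegrable_meas.
have If1 : gintegrable f1.
  by apply: gintegrable_meas; [exact: continuous_measurable_fun|exists C1, d1].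
apply/eqP; rewrite -subr_eq0; apply/eqP.
have -> : gint (fun x => x * f x) - gint f1 = gint H.
  rewrite -[in LHS]mulN1r -gintZ// -gintD//.
    by apply: eq_gint => x; rewrite mulN1r.
  have := @integrableZl _ _ _ (@lebesgue_measure R) _ measurableT (-1) _ If1.
  by apply: eq_integrable => // x _; rewrite /= -EFinM mulrCA.
have [Kf Kf0 HKf] := @pow_mul_pdf_le R df.+1.
pose Kp := Cf * (Kf * normal_peak (Num.sqrt 2)).
have Kp0 : 0 <= Kp by rewrite !mulr_ge0// ?normal_peak_ge0// ltW.
have Hphi x : (1 + `|x|) * (phi x * `|f x|) <= Kp.
  apply: (@le_trans _ _ (Cf * ((1 + `|x|) ^+ df.+1 * phi x))).
    have -> : Cf * ((1 + `|x|) ^+ df.+1 * phi x) =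
        (1 + `|x|) * (phi x * (Cf * (1 + `|x|) ^+ df)) by rewrite exprS; ring.
    by rewrite !ler_wpM2l ?addr_ge0 ?pdf_ge0.
  rewrite ler_wpM2l//; apply: (le_trans (HKf x)); rewrite ler_wpM2l ?(ltW Kf0)//.
  by apply: normal_pdf_ub; rewrite gt_eqF// sqrtr_gt0.
pose W := gint (fun x => C * (1 + `|x|) ^+ d.+1).
have mpow e : measurable_fun [set: R] (fun x : R => C * (1 + `|x|) ^+ e).
  apply: measurable_funM => //; apply: measurable_funX; apply: measurable_funD => //.
have Ipow e : gintegrable (fun x => C * (1 + `|x|) ^+ e).
  apply: gintegrable_meas => //; exists C, e => x.
  by rewrite ger0_norm// mulr_ge0// exprn_ge0// addr_ge0.
apply: (@gint_eq0_limit _ (W + 2 * Kp)).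
  apply: addr_ge0; last exact: mulr_ge0.
  rewrite /W /gint; apply: Rintegral_ge0 => x _.
  by rewrite !mulr_ge0 ?pdf_ge0// exprn_ge0// addr_ge0.
move=> n; set a : R := n.+1%:R.
have a0 : 0 < a by rewrite ltr0n.
pose A : set R := [set` `[- a, a]].
have mA : measurable A by exact: measurable_itv.
have Irestr B : measurable B -> gintegrable (H \_ B).
  move=> mB; apply: gintegrable_meas; last first.
    exists C, d => x; rewrite patchE; case: ifP => // _.
    by rewrite normr0 mulr_ge0// exprn_ge0// addr_ge0.
  apply: (measurable_restrictT _ mB).1.
  by apply: measurable_funTS; exact: continuous_measurable_fun.
have split_H : gint H = gint (H \_ A) + gint (H \_ (~` A)).
  rewrite -gintD; [|exact: Irestr|by apply: Irestr; exact: measurableC].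
  apply: eq_gint => x; rewrite !patchE in_setC.
  by case: (x \in A); rewrite /= ?addr0 ?add0r.
have out : `|gint (H \_ (~` A))| <= W / a.
  have Iout := Irestr _ (measurableC mA).
  apply: (le_trans (le_normr_Rintegral _ Iout)) => //.
  rewrite mulrC /W -gintZ//; apply: le_Rintegral => //.
  - by have := integrable_norm Iout; apply: eq_integrable.
  - have := @integrableZl _ _ _ (@lebesgue_measure R) _ measurableT a^-1 _ (Ipow d.+1).
    by apply: eq_integrable => // x _; rewrite /= -EFinM mulrCA.
  move=> x _; rewrite normrM ger0_norm ?pdf_ge0// ler_wpM2l ?pdf_ge0//.
  rewrite patchE; case: ifPn => [|_]; last first.
    by rewrite normr0 !mulr_ge0 ?invr_ge0 ?(ltW a0)// exprn_ge0// addr_ge0.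
  rewrite in_setC => xA.
  have ax : a <= `|x|.
    rewrite leNgt; apply/negP => xa; move/negP: xA; apply; rewrite inE /A/= in_itv/=.
    by rewrite -ler_norml ltW.
  rewrite mulrC ler_pdivlMr//; apply: (le_trans (ler_wpM2r (ltW a0) (BH x))).
  rewrite -mulrA ler_wpM2l// exprSr ler_wpM2l ?exprn_ge0 ?addr_ge0//.
  by apply: (le_trans ax); rewrite lerDr.
have inn : `|gint (H \_ A)| <= 2 * Kp / a.
  have -> : gint (H \_ A) = - (phi a * f a) + phi (- a) * f (- a).
    rewrite /gint.
    have -> : \int[lebesgue_measure]_(x in [set: R]) (phi x * (H \_ A) x) =
      \int[lebesgue_measure]_(x in A) (phi x * H x).
      rewrite [RHS]Rintegral_mkcond; apply: eq_Rintegral => x _.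
      by rewrite !patchE; case: ifP => // _; rewrite mulr0.
    pose P x := - (phi x * f x).
    have DP x : is_derive x 1 P (phi x * H x).
      have Dphi := is_derive_gaussian_pdf x; have Dfx := Df x.
      have -> : P = - (phi * f) by apply/funext.
      apply: is_derive_eq; rewrite /GRing.scale/= /H; ring.
    have cP : continuous P.
      by move=> x; apply/differentiable_continuous/derivable1_diffP; apply: ex_derive.
    have cpH : continuous (fun x => phi x * H x).
      move=> x; apply: cvgM; last exact: cH.
      exact: continuous_normal_pdf (oner_neq0 _) _.
    rewrite /Rintegral (@continuous_FTC2 _ _ P).
    - by rewrite /= /P opprK.
    - by rewrite gtrN.
    - exact: continuous_subspaceT.
    - split.
      + by move=> x _; apply: ex_derive.
      + by apply: cvg_at_right_filter; exact: cP.
      + by apply: cvg_at_left_filter; exact: cP.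
    - by move=> x _; rewrite derive1E; apply: derive_val.
  apply: (le_trans (ler_normD _ _)); rewrite normrN !normrM !(ger0_norm (pdf_ge0 _)).
  have bnd x : `|x| = a -> phi x * `|f x| <= Kp / a.
    move=> xa; rewrite ler_pdivlMr// mulrC; apply: le_trans (Hphi x).
    by rewrite ler_wpM2r ?mulr_ge0 ?pdf_ge0// xa lerDr.
  rewrite mulrDl mul1r mulrDl; apply: lerD; apply: bnd; rewrite ?normrN gtr0_norm//.
by rewrite split_H (le_trans (ler_normD _ _))// mulrDl addrC lerD.
Qed.
End Stein.

(** * Polynomially Lipschitz functions and exchange of integrals *)

Section OneVariable.
Variable R : realType.
Implicit Types (f : R -> R) (x y : R).

(** The Lipschitz form, rather than mere polynomial growth, also gives continuity, hence
    measurability, and passes through integration in a further variable. *)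
Definition polylip1 f := exists2 C, 0 <= C & exists d,
  forall x y, `|f x - f y| <= C * (1 + `|x| + `|y|) ^+ d * `|x - y|.

Lemma polylip1_bound f : polylip1 f -> polybound f.
Proof.
move=> [C C0 [d H]]; exists (`|f 0| + C), d.+1 => x.
have x1 : 1 <= 1 + `|x| by rewrite lerDl.
rewrite mulrDl; apply: (@le_trans _ _ (`|f 0| + `|f x - f 0|)).
  by rewrite (le_trans _ (ler_normD _ _))// addrC subrK.
apply: lerD; first by rewrite ler_peMr// exprn_ege1.
apply: (le_trans (H x 0)); rewrite normr0 addr0 subr0 exprSr mulrA.
by rewrite ler_wpM2l ?lerDr// mulr_ge0// exprn_ge0// addr_ge0.
Qed.

Lemma polylip1_continuous f : polylip1 f -> continuous f.
Proof.
move=> [C C0 [d H]] x; apply/cvgrPdist_le => e e0.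
pose K := C * (1 + `|x| + (`|x| + 1)) ^+ d.
have K0 : 0 <= K by rewrite mulr_ge0// exprn_ge0// !addr_ge0.
near=> y; apply: (le_trans (H x y)).
have xy1 : `|x - y| <= 1.
  by near: y; apply: cvgr_dist_le => //; exact: cvg_id.
apply: (@le_trans _ _ (K * (e / (K + 1)))); last first.
  by rewrite mulrCA ler_piMr ?(ltW e0)// ler_pdivrMr ?mul1r ?lerDl// ltr_wpDl.
apply: ler_pM => //; first by rewrite mulr_ge0// exprn_ge0// !addr_ge0.
  rewrite /K ler_wpM2l//; apply: lerXn2r; rewrite ?nnegrE ?addr_ge0//.
  rewrite lerD2l -(subrK x y) addrC (le_trans (ler_normD _ _))//.
  by rewrite lerD2l distrC.
near: y; apply: cvgr_dist_le; first exact: cvg_id.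
by rewrite divr_gt0// ltr_wpDl.
Unshelve. all: by end_near. Qed.

Lemma polylip1_gintegrable f : polylip1 f -> gintegrable f.
Proof.
move=> pf; apply: gintegrable_meas; last exact: polylip1_bound.
by apply: continuous_measurable_fun; exact: polylip1_continuous.
Qed.

Lemma polylip1D f g : polylip1 f -> polylip1 g -> polylip1 (fun x => f x + g x).
Proof.
move=> [C C0 [d H]] [C' C0' [d' H']]; exists (C + C'); first exact: addr_ge0.
exists (d + d')%N => x y.
have b1 : 1 <= 1 + `|x| + `|y| by rewrite -addrA lerDl addr_ge0.
have -> : f x + g x - (f y + g y) = (f x - f y) + (g x - g y) by ring.
apply: (le_trans (ler_normD _ _)); rewrite !mulrDl; apply: lerD.
  apply: (le_trans (H x y)); rewrite ler_wpM2r// ler_wpM2l// ler_weXn2l//.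
  by rewrite leq_addr.
apply: (le_trans (H' x y)); rewrite ler_wpM2r// ler_wpM2l// ler_weXn2l//.
by rewrite leq_addl.
Qed.

Lemma polylip1Z c f : polylip1 f -> polylip1 (fun x => c * f x).
Proof.
move=> [C C0 [d H]]; exists (`|c| * C); first by rewrite mulr_ge0.
exists d => x y; rewrite -mulrBr normrM -!mulrA ler_wpM2l//.
by have := H x y; rewrite -mulrA.
Qed.

Definition polylip2 (F : R -> R -> R) := exists2 C, 0 <= C & exists d,
  forall x y x' y', `|F x y - F x' y'| <=
    C * (1 + `|x| + `|y| + `|x'| + `|y'|) ^+ d * (`|x - x'| + `|y - y'|).

Lemma polylip2_l F x : polylip2 F -> polylip1 (F x).
Proof.
move=> [C C0 [d H]]; exists (C * (1 + `|x| + `|x|) ^+ d).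
  by rewrite mulr_ge0// exprn_ge0// !addr_ge0.
exists d => y y'; apply: (le_trans (H x y x y')).
rewrite subrr normr0 add0r ler_wpM2r// -mulrA ler_wpM2l// -exprMn.
apply: lerXn2r; rewrite ?nnegrE ?mulr_ge0 ?addr_ge0//.
by move: (normr_ge0 x) (normr_ge0 y) (normr_ge0 y'); nra.
Qed.

Lemma measurable_floor_fst (n : nat) (k : int) :
  measurable [set z : R * R | Num.floor (n.+1%:R * z.1) = k].
Proof.
rewrite [X in measurable X](_ : _ =
  fst @^-1` `[k%:~R / n.+1%:R, (k + 1)%:~R / n.+1%:R[%classic).
  rewrite -[X in measurable X]setTI; apply: measurable_fst => //.
apply/seteqP; split => -[x y] /=; rewrite in_itv/= ler_pdivrMr ?ltr0n// ltr_pdivlMr ?ltr0n//.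
  by move=> <-; rewrite mulrC floor_le/= mulrC floorD1_gt.
by move=> xk; apply: floor_def; rewrite mulrC.
Qed.

(** Rounding the first argument down to a multiple of [1 / (n + 1)] gives a function that is
    measurable on each of countably many strips; the local Lipschitz bound makes these functions
    converge pointwise to [F]. *)
Lemma measurable_polylip2 F : polylip2 F ->
  measurable_fun setT (fun z : R * R => F z.1 z.2).
Proof.
move=> pF; have [C C0 [d H]] := pF.
pose fl (n : nat) (x : R) : R := (Num.floor (n.+1%:R * x))%:~R / n.+1%:R.
apply: (@measurable_fun_cvg _ _ _ _ (fun n z => F (fl n z.1) z.2)).
  move=> n.
  (* [pickle] numbers the strips by naturals to obtain a countable union; numbers that code no
     integer give the empty set. *)
  pose E (i : nat) := [set z : R * R | pickle (Num.floor (n.+1%:R * z.1)) = i].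
  have mE i : measurable (E i).
    case Ei : (unpickle i : option int) => [k|].
      rewrite (_ : E i = [set z : R * R | Num.floor (n.+1%:R * z.1) = k] `&` E i); last first.
        apply/seteqP; split => z /=; last by case.
        move=> zi; split => //; move: Ei; rewrite -zi pickleK.
        by case.
      have [ki|ki] := eqVneq (pickle k) i.
        rewrite (_ : _ `&` _ = [set z : R * R | Num.floor (n.+1%:R * z.1) = k]).
          exact: measurable_floor_fst.
        by apply/seteqP; split => z /=; [case|move=> zk; split => //; rewrite /E/= zk].
      rewrite (_ : _ `&` _ = set0) //.
      by apply/seteqP; split => z //= [zk]; rewrite /E/= zk => /eqP; rewrite (negbTE ki).
    rewrite (_ : E i = set0)//; apply/seteqP; split => z //= zi.
    by move: Ei; rewrite -zi pickleK.
  have -> : [set: R * R] = \bigcup_i E i.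
    by apply/seteqP; split => // z _; exists (pickle (Num.floor (n.+1%:R * z.1))).
  apply/measurable_fun_bigcup => // i.
  pose k : int := odflt 0 (unpickle i).
  apply: (@eq_measurable_fun _ _ _ _ _ (F (k%:~R / n.+1%:R) \o snd)).
    by move=> z; rewrite inE /E /= => zi; rewrite /k -zi pickleK.
  apply: measurable_funTS; apply: measurableT_comp => //.
  by apply: continuous_measurable_fun; apply/polylip1_continuous/polylip2_l.
move=> z _; have flx n : `|z.1 - fl n z.1| <= n.+1%:R^-1.
  have n0 : (0 : R) < n.+1%:R by rewrite ltr0n.
  rewrite /fl.
  have -> : z.1 - (Num.floor (n.+1%:R * z.1))%:~R / n.+1%:R =
    (n.+1%:R * z.1 - (Num.floor (n.+1%:R * z.1))%:~R) / n.+1%:R.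
    by field; rewrite gt_eqF.
  rewrite normrM (ger0_norm (x := _^-1)) ?invr_ge0 ?(ltW n0)//.
  rewrite -[leRHS]mul1r ler_wpM2r ?invr_ge0 ?(ltW n0)//.
  rewrite ger0_norm ?subr_ge0 ?floor_le//.
  by rewrite lerBlDl ltW// -intrD1 floorD1_gt.
apply/cvgrPdist_le => e e0.
pose K := C * (1 + `|z.1| + `|z.2| + (`|z.1| + 1) + `|z.2|) ^+ d.
have K0 : 0 <= K by rewrite mulr_ge0// exprn_ge0// !addr_ge0.
have [N HN] : exists N : nat, K / e < N.+1%:R by eexists; exact: truncnS_gt.
exists N => // n /= Nn; apply: (le_trans (H _ _ _ _)).
rewrite subrr normr0 addr0; apply: (@le_trans _ _ (K / n.+1%:R)).
  apply: ler_pM => //; first by rewrite mulr_ge0// exprn_ge0// !addr_ge0.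
  rewrite ler_wpM2l//; apply: lerXn2r; rewrite ?nnegrE ?addr_ge0//.
  rewrite lerD2r lerD2l -(subrK z.1 (fl n z.1)) addrC (le_trans (ler_normD _ _))//.
  rewrite lerD2l distrC (le_trans (flx n))// invf_le1 ?ltr0n// ler1n//.
rewrite ler_pdivrMr ?ltr0n// mulrC -ler_pdivrMr//.
by rewrite (le_trans (ltW HN))// ler_nat.
Qed.

Lemma gintB f g : gintegrable f -> gintegrable g ->
  gint (fun x => f x - g x) = gint f - gint g.
Proof.
move=> If Ig; rewrite /gint -RintegralB//; apply: eq_Rintegral => x _.
by rewrite mulrBr.
Qed.

Lemma gintegrable_pow C d : gintegrable (fun x : R => C * (1 + `|x|) ^+ d).
Proof.
apply: gintegrable_meas; last first.
  by exists `|C|, d => x; rewrite normrM ler_wpM2l// ger0_norm ?exprn_ge0 ?addr_ge0.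
by apply: measurable_funM => //; apply: measurable_funX; apply: measurable_funD.
Qed.

Lemma gint_ge0 f : (forall x, 0 <= f x) -> 0 <= gint f.
Proof. by move=> f0; apply: Rintegral_ge0 => x _; rewrite mulr_ge0 ?pdf_ge0. Qed.

Lemma polylip1_norm f : polylip1 f -> polylip1 (fun x => `|f x|).
Proof.
move=> [C C0 [d H]]; exists C => //; exists d => x y.
by apply: le_trans (H x y); exact: ler_dist_dist.
Qed.

Lemma gint_norm_le f : polylip1 f -> `|gint f| <= gint (fun x => `|f x|).
Proof.
move=> pf; rewrite ler_norml; apply/andP; split.
  rewrite lerNl -mulN1r -gintZ; last exact: polylip1_gintegrable.
  apply: gint_le; [apply/polylip1_gintegrable/polylip1Z|apply/polylip1_gintegrable/polylip1_norm|] => //.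
  by move=> x; rewrite mulN1r -normrN ler_norm.
apply: gint_le; [exact: polylip1_gintegrable|apply/polylip1_gintegrable/polylip1_norm|] => //.
by move=> x; exact: ler_norm.
Qed.

Lemma polylip2_norm F : polylip2 F -> polylip2 (fun x y => `|F x y|).
Proof.
move=> [C C0 [d H]]; exists C => //; exists d => x y x' y'.
by apply: le_trans (H x y x' y'); exact: ler_dist_dist.
Qed.

(** Since [1 + |x| + 2|y| + |x'|] is at most [(1 + |x| + |x'|) * 2 (1 + |y|)], the weight splits and
    its [y] part is a finite Gaussian moment. *)
Lemma polylip2_gint F : polylip2 F -> polylip1 (fun x => gint (F x)).
Proof.
move=> pF; have [C C0 [d H]] := pF.
pose K := gint (fun y : R => 2 ^+ d * C * (1 + `|y|) ^+ d).
exists K.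
  by apply: gint_ge0 => y; rewrite !mulr_ge0// ?exprn_ge0// addr_ge0.
exists d => x x'.
have px := polylip2_l x pF; have px' := polylip2_l x' pF.
rewrite -gintB; [|exact: polylip1_gintegrable..].
have pd : polylip1 (fun y => F x y - F x' y).
  have -> : (fun y => F x y - F x' y) = fun y => F x y + (-1) * F x' y.
    by apply/funext => y; rewrite mulN1r.
  by apply: polylip1D => //; exact: polylip1Z.
apply: (le_trans (gint_norm_le pd)).
rewrite -mulrA mulrC /K -gintZ; last exact: gintegrable_pow.
apply: gint_le.
- exact/polylip1_gintegrable/polylip1_norm.
- rewrite (_ : (fun _ => _) = fun y => ((1 + `|x| + `|x'|) ^+ d * `|x - x'| * (2 ^+ d * C)) * (1 + `|y|) ^+ d).
    exact: gintegrable_pow.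
  by apply/funext => y; rewrite !mulrA.
move=> y; apply: (le_trans (H x y x' y)); rewrite subrr normr0 addr0.
have -> : (1 + `|x| + `|x'|) ^+ d * `|x - x'| * (2 ^+ d * C * (1 + `|y|) ^+ d) =
  C * ((1 + `|x| + `|x'|) * (2 * (1 + `|y|))) ^+ d * `|x - x'| by rewrite !exprMn; ring.
rewrite ler_wpM2r// ler_wpM2l//; apply: lerXn2r; rewrite ?nnegrE ?mulr_ge0 ?addr_ge0//.
by move: (normr_ge0 x) (normr_ge0 y) (normr_ge0 x'); nra.
Qed.

Lemma polylip2_swap F : polylip2 F -> polylip2 (fun x y => F y x).
Proof.
move=> [C C0 [d H]]; exists C => //; exists d => x y x' y'.
apply: (le_trans (H _ _ _ _)); rewrite [`|y - _| + _]addrC ler_wpM2r ?addr_ge0//.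
by rewrite ler_wpM2l//; apply: lerXn2r; rewrite ?nnegrE ?addr_ge0//; lra.
Qed.

Notation mu := (@lebesgue_measure R).
Notation phi := (@normal_pdf R 0 1).

Lemma EFin_gint f : gintegrable f ->
  (gint f)%:E = (\int[mu]_x (phi x * f x)%:E)%E.
Proof.
by move=> If; rewrite /gint /Rintegral fineK//; exact: integrable_fin_num.
Qed.

Lemma EFin_gint2 F x : polylip2 F ->
  (phi x * gint (F x))%:E = (\int[mu]_y (phi x * phi y * F x y)%:E)%E.
Proof.
move=> pF; have If := polylip1_gintegrable (polylip2_l x pF).
rewrite EFinM EFin_gint// -integralZl//; apply: eq_integral => y _.
by rewrite -EFinM mulrA.
Qed.

(** For absolute integrability, integrating [|F|] in [y] leaves again a polynomially Lipschitz
    function of [x], which has a finite Gaussian integral. *)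
Lemma gint_swap F : polylip2 F ->
  gint (fun x => gint (fun y => F x y)) = gint (fun y => gint (fun x => F x y)).
Proof.
move=> pF; have pF' := polylip2_swap pF.
pose f (z : R * R) := (phi z.1 * phi z.2 * F z.1 z.2)%:E.
have mf : measurable_fun setT f.
  apply/measurable_EFinP; apply: measurable_funM; last exact: measurable_polylip2.
  by apply: measurable_funM; apply: measurableT_comp => //; exact: measurable_normal_pdf.
have intf : (mu \x mu)%E.-integrable setT f.
  have [_ h] := @integrable12ltyP _ _ _ _ _ mu mu f mf; apply: h.
  have -> : (\int[mu]_x \int[mu]_y `|f (x, y)| =
             \int[mu]_x (phi x * gint (fun y => `|F x y|))%:E)%E.
    apply: eq_integral => x _; rewrite (EFin_gint2 x (polylip2_norm pF)).
    apply: eq_integral => y _.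
    by rewrite /f /= !normrM !(ger0_norm (pdf_ge0 _)).
  rewrite -EFin_gint ?ltry//.
  exact/polylip1_gintegrable/polylip2_gint/polylip2_norm.
have E := Fubini intf.
rewrite /gint /Rintegral; congr fine; transitivity (\int[mu]_x (\int[mu]_y f (x, y)))%E.
  by apply: eq_integral => x _; rewrite (EFin_gint2 x pF).
rewrite E; apply: eq_integral => y _; rewrite (EFin_gint2 y pF').
by apply: eq_integral => x _; rewrite /f /= (mulrC (phi y)).
Qed.

End OneVariable.

(** * Several Gaussian variables *)

Lemma lerX (R : numDomainType) (a b : R) d : 0 <= a -> a <= b -> a ^+ d <= b ^+ d.
Proof. by move=> a0 ab; apply: lerXn2r => //; rewrite nnegrE// (le_trans a0). Qed.

Section SeveralVariables.
Variables (R : realType) (M : nat).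
Implicit Types (g : nat -> R) (F : (nat -> R) -> R) (l : seq nat).

Definition upd (T : Type) (g : nat -> T) k x := fun j => if j == k then x else g j.

Definition wt g : R := 1 + \sum_(k < M) `|g k|.
Definition l1dist g g' : R := \sum_(k < M) `|g k - g' k|.

Lemma upd_same (T : Type) (g : nat -> T) k x : upd g k x k = x.
Proof. by rewrite /upd eqxx. Qed.

Lemma upd_upd (T : Type) (g : nat -> T) k x y : upd (upd g k x) k y = upd g k y.
Proof. by apply/funext => j; rewrite /upd; case: eqP. Qed.

Lemma updC (T : Type) (g : nat -> T) j k x y : j != k ->
  upd (upd g j x) k y = upd (upd g k y) j x.
Proof.
move=> jk; apply/funext => i; rewrite /upd; case: (eqVneq i k) => // ->.
by rewrite eq_sym (negbTE jk).
Qed.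

Lemma wt_ge1 g : 1 <= wt g.
Proof. by rewrite lerDl sumr_ge0. Qed.

Lemma wt_ge0 g : 0 <= wt g.
Proof. exact: le_trans (wt_ge1 g). Qed.

Lemma l1dist_ge0 g g' : 0 <= l1dist g g'.
Proof. by rewrite sumr_ge0. Qed.

Lemma sum_upd_le (a b : 'I_M -> R) k (x : R) : 0 <= x ->
  (forall i, 0 <= b i) -> (forall i, a i <= if i == k :> nat then x else b i) ->
  \sum_(i < M) a i <= \sum_(i < M) b i + x.
Proof.
move=> x0 b0 H; apply: (le_trans (ler_sum _ (fun i _ => H i))).
rewrite (bigID (fun i : 'I_M => i == k :> nat)) /= addrC; apply: lerD.
  rewrite [leRHS](bigID (fun i : 'I_M => i == k :> nat)) /= -[leLHS]add0r.
  apply: lerD; first exact: sumr_ge0.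
  by apply: ler_sum => i /negbTE ->.
have [kM|kM] := ltnP k M.
  rewrite (bigD1 (Ordinal kM)) //= eqxx big1 ?addr0// => i /andP[/eqP ik].
  by move=> /eqP []; apply: val_inj.
rewrite big1 ?x0// => i /eqP ik; by have := ltn_ord i; rewrite ik ltnNge kM.
Qed.

Lemma wt_upd g k x : wt (upd g k x) <= wt g + `|x|.
Proof.
rewrite /wt -addrA lerD2l; apply: (@sum_upd_le _ _ k) => // i.
by rewrite /upd; case: eqP.
Qed.

Lemma l1dist_upd g g' k x x' :
  l1dist (upd g k x) (upd g' k x') <= l1dist g g' + `|x - x'|.
Proof.
apply: (@sum_upd_le _ _ k) => // i; by rewrite /upd; case: eqP.
Qed.

Lemma l1dist_xx g : l1dist g g = 0.
Proof. by rewrite /l1dist big1// => i _; rewrite subrr normr0. Qed.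

(** Since [l1dist] sees only the first [M] coordinates, such an [F] depends on those alone. *)
Definition polylip F := exists2 C, 0 <= C & exists d, forall g g',
  `|F g - F g'| <= C * (wt g + wt g') ^+ d * l1dist g g'.

Lemma polylip_upd2 F g j k : polylip F ->
  polylip2 (fun x y => F (upd (upd g j x) k y)).
Proof.
move=> [C C0 [d H]]; exists (C * (2 * wt g) ^+ d).
  by rewrite mulr_ge0// exprn_ge0// mulr_ge0// wt_ge0.
exists d => x y x' y'; apply: (le_trans (H _ _)); apply: ler_pM.
- by rewrite mulr_ge0// exprn_ge0// addr_ge0// wt_ge0.
- exact: l1dist_ge0.
- rewrite -mulrA ler_wpM2l// -exprMn.
  apply: lerX; first by apply: addr_ge0; exact: wt_ge0.
  have := wt_upd g j x; have := wt_upd g j x'.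
  have := wt_upd (upd g j x) k y; have := wt_upd (upd g j x') k y'.
  have w1 := wt_ge1 g; move: (normr_ge0 x) (normr_ge0 y) (normr_ge0 x') (normr_ge0 y').
  move: `|x| `|y| `|x'| `|y'| => X Y X' Y' X0 Y0 X0' Y0' h1 h2 h3 h4.
  have : 0 <= (2 * wt g - 1) * (X + Y + X' + Y') by apply: mulr_ge0; lra.
  by nra.
- have := l1dist_upd (upd g j x) (upd g j x') k y y'.
  by have := l1dist_upd g g j x x'; rewrite l1dist_xx; lra.
Qed.

Lemma polylip_upd F g k : polylip F -> polylip1 (fun x => F (upd g k x)).
Proof.
move=> pF; have := polylip2_l 0 (polylip_upd2 g k k pF).
by congr polylip1; apply/funext => y; rewrite upd_upd.
Qed.

Lemma polylip_gint F k : polylip F -> polylip (fun g => gint (fun x => F (upd g k x))).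
Proof.
move=> pF; have [C C0 [d H]] := pF.
exists (gint (fun x : R => C * (1 + `|x|) ^+ d)).
  by apply: gint_ge0 => x; rewrite mulr_ge0// exprn_ge0// addr_ge0.
exists d => g g'.
have p1 := polylip_upd g k pF; have p2 := polylip_upd g' k pF.
rewrite -gintB; [|exact: polylip1_gintegrable..].
have pd : polylip1 (fun x => F (upd g k x) - F (upd g' k x)).
  have -> : (fun x => F (upd g k x) - F (upd g' k x)) =
            fun x => F (upd g k x) + (-1) * F (upd g' k x).
    by apply/funext => y; rewrite mulN1r.
  by apply: polylip1D => //; exact: polylip1Z.
apply: (le_trans (gint_norm_le pd)).
rewrite -mulrA mulrC -gintZ; last exact: gintegrable_pow.
apply: gint_le.
- exact/polylip1_gintegrable/polylip1_norm.
- rewrite (_ : (fun _ => _) =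
    fun x => ((wt g + wt g') ^+ d * l1dist g g' * C) * (1 + `|x|) ^+ d).
    exact: gintegrable_pow.
  by apply/funext => y; rewrite !mulrA.
move=> x; apply: (le_trans (H _ _)).
have -> : (wt g + wt g') ^+ d * l1dist g g' * (C * (1 + `|x|) ^+ d) =
  C * ((wt g + wt g') * (1 + `|x|)) ^+ d * l1dist g g' by rewrite !exprMn; ring.
apply: ler_pM.
- by rewrite mulr_ge0// exprn_ge0// addr_ge0// wt_ge0.
- exact: l1dist_ge0.
- rewrite ler_wpM2l//; apply: lerX; first by apply: addr_ge0; exact: wt_ge0.
  have := wt_upd g k x; have := wt_upd g' k x; have := wt_ge1 g; have := wt_ge1 g'.
  move: (normr_ge0 x); move: `|x| => X X0 h1 h2 h3 h4.
  have : 0 <= (wt g + wt g' - 2) * X by apply: mulr_ge0; lra.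
  by nra.
- by have := l1dist_upd g g' k x x; rewrite subrr normr0 addr0.
Qed.

(** Integration over an explicit list of coordinates, outermost first, so that the order can be
    permuted and the coordinates relabelled. *)
Fixpoint gaussL l F g : R :=
  if l is k :: l' then gint (fun x => gaussL l' F (upd g k x)) else F g.

Lemma polylip_gaussL l F : polylip F -> polylip (gaussL l F).
Proof. by elim: l => //= k l IH pF; apply/polylip_gint/IH. Qed.

Lemma polylip_gaussL_int l F g k : polylip F ->
  gintegrable (fun x => gaussL l F (upd g k x)).
Proof. by move=> pF; apply/polylip1_gintegrable/polylip_upd/polylip_gaussL. Qed.

Lemma eq_gaussL l F F' g : F =1 F' -> gaussL l F g = gaussL l F' g.
Proof. by move=> /funext ->. Qed.

Lemma gaussLD l F F' g : polylip F -> polylip F' ->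
  gaussL l (fun g => F g + F' g) g = gaussL l F g + gaussL l F' g.
Proof.
move=> pF pF'; elim: l g => //= k l IH g.
rewrite -gintD; [|exact: polylip_gaussL_int..].
by apply: eq_gint => x; rewrite IH.
Qed.

Lemma gaussLZ l c F g : polylip F ->
  gaussL l (fun g => c * F g) g = c * gaussL l F g.
Proof.
move=> pF; elim: l g => //= k l IH g.
rewrite -gintZ; last exact: polylip_gaussL_int pF.
by apply: eq_gint => x.
Qed.

Lemma gaussL_cst l c g : gaussL l (fun=> c) g = c.
Proof.
elim: l g => //= k l IH g.
rewrite (@eq_gint _ _ (fun=> c * 1)); last by move=> x; rewrite IH mulr1.
rewrite gintZ ?gint1 ?mulr1//.
by have := @gintegrable_pow R 1 0; congr gintegrable; apply/funext => x; rewrite expr0 mulr1.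
Qed.

Lemma gaussL_le l F F' g : polylip F -> polylip F' -> (forall g, F g <= F' g) ->
  gaussL l F g <= gaussL l F' g.
Proof.
move=> pF pF' H; elim: l g => //= k l IH g.
apply: gint_le => [||x]; last exact: IH.
  exact: polylip_gaussL_int pF.
exact: polylip_gaussL_int pF'.
Qed.

Lemma gaussL_indep l F g k :
  (forall g x, F (upd g k x) = F g) -> gaussL (k :: l) F g = gaussL l F g.
Proof.
move=> Fk; have H x l' g' : gaussL l' F (upd g' k x) = gaussL l' F g'.
  elim: l' g' => //= j l' IH g'; apply: eq_gint => y.
  have [->|jk] := eqVneq j k; first by rewrite upd_upd.
  by rewrite updC 1?eq_sym// IH.
by rewrite /=; under eq_gint do rewrite H; exact: (gaussL_cst [:: k] (gaussL l F g) g).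
Qed.

Lemma gaussL_swap j k l F g : j != k -> polylip F ->
  gaussL [:: j, k & l] F g = gaussL [:: k, j & l] F g.
Proof.
move=> jk pF; rewrite /= gint_swap; last by apply: polylip_upd2; exact: polylip_gaussL.
by apply: eq_gint => x; apply: eq_gint => y; rewrite updC.
Qed.

Lemma gaussL_move k l1 l2 F g : polylip F -> k \notin l1 ->
  gaussL (k :: l1 ++ l2) F g = gaussL (l1 ++ k :: l2) F g.
Proof.
move=> pF; elim: l1 g => // j l1 IH g; rewrite inE negb_or => /andP[kj kl].
rewrite (@gaussL_swap k j (l1 ++ l2))//=; apply: eq_gint => x.
by rewrite -(IH _ kl).
Qed.

Lemma gaussL_perm l l' F g : polylip F -> uniq l -> perm_eq l l' ->
  gaussL l F g = gaussL l' F g.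
Proof.
move=> pF; elim: l l' g => [|k l IH] l' g.
  by move=> _; rewrite perm_sym => /perm_nilP ->.
move=> /andP[kl ul] ll'.
have kl' : k \in l' by rewrite -(perm_mem ll') mem_head.
case/splitPr: kl' ll' => p1 p2 ll'.
have ul' : uniq (p1 ++ k :: p2) by rewrite -(perm_uniq ll') /= kl.
rewrite -gaussL_move//; last first.
  by move: ul'; rewrite cat_uniq /= negb_or => /and3P[_ /andP[]].
rewrite /=; apply: eq_gint => x; apply: IH => //.
by move: ll'; rewrite perm_sym perm_catC /= perm_cons perm_sym => /perm_trans; apply;
   rewrite perm_catC.
Qed.

(** Together with [gaussL_perm] this expresses the invariance of i.i.d. disorder under a relabelling
    of the couplings. *)
Lemma gaussL_relabel (pi : nat -> nat) l F g : involutive pi ->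
  gaussL l (fun g => F (g \o pi)) g = gaussL (map pi l) F (g \o pi).
Proof.
move=> piK; elim: l g => //= k l IH g; apply: eq_gint => x; rewrite IH.
congr (gaussL _ _ _); apply/funext => j; rewrite /upd /=.
by rewrite -(inj_eq (inv_inj piK)) piK.
Qed.

End SeveralVariables.

(** * Closure properties and integration by parts in several variables *)

Section PolylipClosure.
Variables (R : realType) (M : nat).
Implicit Types (g : nat -> R) (F : (nat -> R) -> R) (l : seq nat).
Notation wt := (@wt R M).
Notation l1dist := (@l1dist R M).
Notation polylip := (@polylip R M).

Lemma polylip_bound F : polylip F ->
  exists2 C, 0 <= C & exists d, forall g, `|F g| <= C * wt g ^+ d.
Proof.
move=> [C C0 [d H]]; exists (`|F (fun=> 0)| + C * 2 ^+ d).
  by rewrite addr_ge0// mulr_ge0// exprn_ge0.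
exists d.+1 => g; have w1 := wt_ge1 M g.
rewrite mulrDl; apply: (@le_trans _ _ (`|F (fun=> 0)| + `|F g - F (fun=> 0)|)).
  by rewrite (le_trans _ (ler_normD _ _))// addrC subrK.
apply: lerD; first by rewrite ler_peMr// exprn_ege1.
have w0 : wt (fun=> 0) = 1.
  by rewrite /Submission.wt big1 ?addr0// => i _; rewrite normr0.
have d0 : l1dist g (fun=> 0) <= wt g.
  rewrite /Submission.wt -[leLHS]add0r; apply: lerD => //.
  by apply: ler_sum => i _; rewrite subr0.
apply: (le_trans (H g _)); rewrite w0 exprSr [leRHS]mulrA.
apply: ler_pM => //; last 1 first.
- rewrite -mulrA ler_wpM2l// -exprMn; apply: lerX; last by lra.
  by rewrite addr_ge0// wt_ge0.
- by rewrite mulr_ge0// exprn_ge0// addr_ge0// wt_ge0.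
- exact: l1dist_ge0.
Qed.

Lemma polylip_cst c : polylip (fun=> c).
Proof. by exists 0 => //; exists 0 => g g'; rewrite subrr normr0 !mul0r. Qed.

Lemma wtD_ge1 g g' : 1 <= wt g + wt g'.
Proof. by have := wt_ge1 M g; have := wt_ge1 M g'; lra. Qed.

Lemma polylipD F F' : polylip F -> polylip F' -> polylip (fun g => F g + F' g).
Proof.
move=> [C C0 [d H]] [C' C0' [d' H']]; exists (C + C'); first exact: addr_ge0.
exists (d + d')%N => g g'; have w1 := wtD_ge1 g g'.
have -> : F g + F' g - (F g' + F' g') = (F g - F g') + (F' g - F' g') by ring.
apply: (le_trans (ler_normD _ _)); rewrite !mulrDl; apply: lerD.
  apply: (le_trans (H _ _)); rewrite ler_wpM2r ?l1dist_ge0// ler_wpM2l//.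
  by rewrite ler_weXn2l// leq_addr.
apply: (le_trans (H' _ _)); rewrite ler_wpM2r ?l1dist_ge0// ler_wpM2l//.
by rewrite ler_weXn2l// leq_addl.
Qed.

Lemma polylipM F F' : polylip F -> polylip F' -> polylip (fun g => F g * F' g).
Proof.
move=> pF pF'; have [B B0 [e HB]] := polylip_bound pF.
have [B' B0' [e' HB']] := polylip_bound pF'.
move: pF pF' => [C C0 [d H]] [C' C0' [d' H']].
exists (B * C' + C * B'); first by rewrite addr_ge0 ?mulr_ge0.
exists (e + d' + (d + e'))%N => g g'; have w1 := wtD_ge1 g g'.
have -> : F g * F' g - F g' * F' g' = F g * (F' g - F' g') + (F g - F g') * F' g' by ring.
apply: (le_trans (ler_normD _ _)); rewrite !normrM !mulrDl.
have bd k G A : 0 <= A -> (forall g, `|G g| <= A * wt g ^+ k) -> forall h, (h = g) \/ (h = g') ->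
    `|G h| <= A * (wt g + wt g') ^+ k.
  move=> A0 HG h hh; apply: (le_trans (HG h)); rewrite ler_wpM2l//.
  apply: lerX; first exact: wt_ge0.
  by case: hh => ->; rewrite ?lerDl ?lerDr wt_ge0.
apply: lerD.
  apply: (@le_trans _ _ ((B * (wt g + wt g') ^+ e) * (C' * (wt g + wt g') ^+ d' * l1dist g g'))).
    by apply: ler_pM => //; apply: bd => //; left.
  have -> : B * (wt g + wt g') ^+ e * (C' * (wt g + wt g') ^+ d' * l1dist g g') =
    B * C' * (wt g + wt g') ^+ (e + d') * l1dist g g' by rewrite exprD; ring.
  rewrite ler_wpM2r ?l1dist_ge0// ler_wpM2l ?mulr_ge0//.
  by rewrite ler_weXn2l// leq_addr.
apply: (@le_trans _ _ ((C * (wt g + wt g') ^+ d * l1dist g g') * (B' * (wt g + wt g') ^+ e'))).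
  by apply: ler_pM => //; apply: bd => //; right.
have -> : C * (wt g + wt g') ^+ d * l1dist g g' * (B' * (wt g + wt g') ^+ e') =
  C * B' * (wt g + wt g') ^+ (d + e') * l1dist g g' by rewrite exprD; ring.
rewrite ler_wpM2r ?l1dist_ge0// ler_wpM2l ?mulr_ge0//.
by rewrite ler_weXn2l// leq_addl.
Qed.

Lemma polylipZ c F : polylip F -> polylip (fun g => c * F g).
Proof. exact: polylipM (polylip_cst c). Qed.

Lemma polylipB F F' : polylip F -> polylip F' -> polylip (fun g => F g - F' g).
Proof.
move=> pF pF'; have -> : (fun g => F g - F' g) = (fun g => F g + (-1) * F' g).
  by apply/funext => g; rewrite mulN1r.
by apply: polylipD => //; exact: polylipZ.
Qed.

Lemma polylipX F n : polylip F -> polylip (fun g => F g ^+ n).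
Proof.
move=> pF; elim: n => [|n IH].
  by under eq_fun do rewrite expr0; exact: polylip_cst.
by under eq_fun do rewrite exprS; exact: polylipM.
Qed.

Lemma polylip_sum (I : Type) (r : seq I) (P : pred I) (F : I -> (nat -> R) -> R) :
  (forall i, polylip (F i)) -> polylip (fun g => \sum_(i <- r | P i) F i g).
Proof.
move=> pF; elim: r => [|i r IH].
  by under eq_fun do rewrite big_nil; exact: polylip_cst.
under eq_fun do rewrite big_cons; case: (P i) => //; exact: polylipD.
Qed.

Lemma polylip_prod (I : Type) (r : seq I) (P : pred I) (F : I -> (nat -> R) -> R) :
  (forall i, polylip (F i)) -> polylip (fun g => \prod_(i <- r | P i) F i g).
Proof.
move=> pF; elim: r => [|i r IH].
  by under eq_fun do rewrite big_nil; exact: polylip_cst.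
under eq_fun do rewrite big_cons; case: (P i) => //; exact: polylipM.
Qed.

Lemma polylip_norm F : polylip F -> polylip (fun g => `|F g|).
Proof.
move=> [C C0 [d H]]; exists C => //; exists d => g g'.
by apply: le_trans (H g g'); exact: ler_dist_dist.
Qed.

Lemma polylip_lip F C : 0 <= C -> (forall g g', `|F g - F g'| <= C * l1dist g g') ->
  polylip F.
Proof.
by move=> C0 H; exists C => //; exists 0 => g g'; rewrite expr0 mulr1.
Qed.

Lemma polylip_coord k : (k < M)%N -> polylip (fun g => g k).
Proof.
move=> kM; apply: (@polylip_lip _ 1) => // g g'; rewrite mul1r.
by rewrite /Submission.l1dist (bigD1 (Ordinal kM))//= lerDl sumr_ge0.
Qed.

Lemma polylip_wt : polylip wt.
Proof.
apply: (@polylip_lip _ 1) => // g g'; rewrite mul1r /Submission.wt opprD addrACA subrr add0r.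
rewrite -sumrB; apply: (le_trans (ler_norm_sum _ _ _)).
by apply: ler_sum => i _; exact: ler_dist_dist.
Qed.

Lemma gaussL_norm_le l F g : polylip F -> `|gaussL l F g| <= gaussL l (fun g => `|F g|) g.
Proof.
move=> pF; have pN := polylip_norm pF; rewrite ler_norml; apply/andP; split.
  rewrite lerNl -mulN1r -(gaussLZ _ _ _ pF); apply: (@gaussL_le R M); [exact: polylipZ|exact: pN|].
  by move=> h; rewrite mulN1r -normrN ler_norm.
by apply: (@gaussL_le R M) => // h; exact: ler_norm.
Qed.

Lemma gaussLB l F F' g : polylip F -> polylip F' ->
  gaussL l (fun g => F g - F' g) g = gaussL l F g - gaussL l F' g.
Proof.
move=> pF pF'; rewrite -[in RHS]mulN1r -(gaussLZ _ _ _ pF') -(@gaussLD R M)//; last exact: polylipZ.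
by apply: eq_gaussL => h; rewrite mulN1r.
Qed.

Lemma gaussL_sum (I : Type) (r : seq I) (P : pred I) (F : I -> (nat -> R) -> R) l g :
  (forall i, polylip (F i)) ->
  gaussL l (fun g => \sum_(i <- r | P i) F i g) g = \sum_(i <- r | P i) gaussL l (F i) g.
Proof.
move=> pF; elim: r => [|i r IH].
  by rewrite big_nil -[RHS](gaussL_cst l 0 g); apply: eq_gaussL => h; rewrite big_nil.
rewrite big_cons; case Pi: (P i).
  rewrite -IH -(@gaussLD R M)//; last exact: polylip_sum.
  by apply: eq_gaussL => h; rewrite big_cons Pi.
by rewrite -IH; apply: eq_gaussL => h; rewrite big_cons Pi.
Qed.

(* F1 stands for the derivative of F in coordinate k; the quadratic remainder is all that
   integration by parts needs. *)
Definition polydiff k F F1 := [/\ polylip F, polylip F1 &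
  exists2 C, 0 <= C & exists d, forall g e, `|e| <= 1 ->
    `|F (upd g k (g k + e)) - F g - e * F1 g| <= C * wt g ^+ d * e ^+ 2].

Lemma gaussL_coord l k F g : polylip F -> (k < M)%N -> k \notin l ->
  gaussL l (fun g => g k * F g) g = g k * gaussL l F g.
Proof.
move=> pF kM; elim: l g => //= j l IH g; rewrite inE negb_or => /andP[kj kl].
rewrite -gintZ; last exact: polylip_gaussL_int pF.
by apply: eq_gint => x; rewrite IH// /upd (negbTE kj).
Qed.

Lemma gaussL_shift l k e F g : k \notin l ->
  gaussL l (fun g => F (upd g k (g k + e))) g = gaussL l F (upd g k (g k + e)).
Proof.
elim: l g => //= j l IH g; rewrite inE negb_or => /andP[kj kl].
by apply: eq_gint => x; rewrite IH// updC 1?eq_sym// {3}/upd (negbTE kj).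
Qed.

Lemma polylip_shift k e F : polylip F -> polylip (fun g => F (upd g k (g k + e))).
Proof.
move=> [C C0 [d H]].
have wtS g : wt (upd g k (g k + e)) <= wt g * (2 + `|e|).
  have [kM|kM] := ltnP k M; last first.
    have -> : wt (upd g k (g k + e)) = wt g.
      congr (_ + _); apply: eq_bigr => i _; rewrite /upd; case: eqP => // ik.
      by have := ltn_ord i; rewrite ik ltnNge kM.
    by rewrite ler_peMr ?wt_ge0//; have := normr_ge0 e; lra.
  have := wt_upd M g k (g k + e); have gk : `|g k| <= wt g.
    by rewrite /Submission.wt (bigD1 (Ordinal kM))//= addrCA lerDl addr_ge0// sumr_ge0.
  have := ler_normD (g k) e.
  have : `|e| <= wt g * `|e| by rewrite ler_peMl ?wt_ge1.
  by rewrite mulrDr; lra.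
exists (C * (2 + `|e|) ^+ d); first by rewrite mulr_ge0// exprn_ge0// addr_ge0.
exists d => g g'; apply: (le_trans (H _ _)); apply: ler_pM.
- by rewrite mulr_ge0// exprn_ge0// addr_ge0 ?wt_ge0.
- exact: l1dist_ge0.
- rewrite -mulrA ler_wpM2l// -exprMn; apply: lerX.
    by rewrite addr_ge0 ?wt_ge0.
  by rewrite mulrC mulrDl; apply: lerD; exact: wtS.
- apply: ler_sum => i _; rewrite /upd; case: eqP => // ->.
  by rewrite opprD addrACA subrr addr0.
Qed.

(** The coordinates in front of [k] are peeled off. Once [k] is outermost, the one-variable formula
    applies to [F] integrated over the remaining coordinates, whose derivative comes from
    integrating the quadratic remainder. *)
Theorem gaussL_stein l k F F1 g : (k < M)%N -> k \in l -> uniq l -> polydiff k F F1 ->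
  gaussL l (fun g => g k * F g) g = gaussL l F1 g.
Proof.
move=> kM kl ul dF; elim: l kl ul g => //= j l IH; rewrite inE => /orP[/eqP <-|kl].
  move=> /andP[kl ul] g; have [pF pF1 [C C0 [d Hd]]] := dF.
  have fE x : gaussL l (fun g => g k * F g) (upd g k x) = x * gaussL l F (upd g k x).
    by rewrite gaussL_coord// upd_same.
  rewrite (eq_gint fE).
  have p1 := polylip_upd g k (polylip_gaussL l pF).
  have p2 := polylip_upd g k (polylip_gaussL l pF1).
  apply: gint_stein.
  - exact: polylip1_continuous p2.
  - exact: polylip1_bound p1.
  - exact: polylip1_bound p2.
  move=> x; apply: (@is_derive_quad _ _ _ _ (gaussL l (fun g => C * wt g ^+ d) (upd g k x))).
  move=> e e1.
  have -> : gaussL l F (upd g k (x + e)) =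
            gaussL l (fun g => F (upd g k (g k + e))) (upd g k x).
    by rewrite gaussL_shift// upd_same upd_upd.
  have ps := polylip_shift k e pF.
  rewrite -(gaussLZ l e _ pF1) -gaussLB// -gaussLB//; last 2 first.
  - exact: polylipB.
  - exact: polylipZ.
  have pw : polylip (fun g => C * wt g ^+ d) by apply/polylipZ/polylipX/polylip_wt.
  rewrite mulrC -(gaussLZ _ _ _ pw).
  apply: (le_trans (gaussL_norm_le _ _ _)).
    by apply: polylipB; [exact: polylipB|exact: polylipZ].
  apply: (@gaussL_le R M); last by move=> h; rewrite [leRHS]mulrC; exact: Hd.
    by apply: polylip_norm; apply: polylipB; [exact: polylipB|exact: polylipZ].
  exact: polylipZ.
by move=> /andP[jl ul] g; apply: eq_gint => x; exact: IH.
Qed.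

End PolylipClosure.

Section PolydiffClosure.
Variables (R : realType) (M : nat).
Implicit Types (g : nat -> R) (F : (nat -> R) -> R) (l : seq nat).
Notation wt := (@wt R M).
Notation polylip := (@polylip R M).
Notation polydiff := (@polydiff R M).

Lemma polydiff_cst k c : polydiff k (fun=> c) (fun=> 0).
Proof.
split; [exact: polylip_cst..|exists 0 => //; exists 0%N => g e _].
by rewrite mulr0 subr0 subrr normr0 !mul0r.
Qed.

Lemma polydiff_coord k j : (j < M)%N -> polydiff k (fun g => g j) (fun=> (j == k)%:R).
Proof.
move=> jM; split; [exact: polylip_coord|exact: polylip_cst|exists 0 => //; exists 0%N => g e _].
rewrite /upd [X in `|X|](_ : _ = 0) ?normr0 ?mul0r//.
by case: eqP => [->|_] /=; ring.
Qed.

Lemma polydiffD k F F1 G G1 : polydiff k F F1 -> polydiff k G G1 ->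
  polydiff k (fun g => F g + G g) (fun g => F1 g + G1 g).
Proof.
move=> [pF pF1 [C C0 [d H]]] [pG pG1 [C' C0' [d' H']]].
split; [exact: polylipD..|exists (C + C'); first exact: addr_ge0].
exists (d + d')%N => g e e1; have w1 := wt_ge1 M g.
set F' := F (upd _ _ _); set G' := G (upd _ _ _).
have -> : F' + G' - (F g + G g) - e * (F1 g + G1 g) =
  (F' - F g - e * F1 g) + (G' - G g - e * G1 g) by ring.
apply: (le_trans (ler_normD _ _)); rewrite !mulrDl; apply: lerD.
  apply: (le_trans (H _ _ e1)); rewrite ler_wpM2r ?sqr_ge0// ler_wpM2l//.
  by rewrite ler_weXn2l// leq_addr.
apply: (le_trans (H' _ _ e1)); rewrite ler_wpM2r ?sqr_ge0// ler_wpM2l//.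
by rewrite ler_weXn2l// leq_addl.
Qed.

Lemma le_sum6 (a b c d e f A : R) : A = a + b + c + d + e + f ->
  0 <= a -> 0 <= b -> 0 <= c -> 0 <= d -> 0 <= e -> 0 <= f ->
  [/\ a <= A, b <= A & c <= A] /\ [/\ d <= A, e <= A & f <= A].
Proof. by move=> -> *; split; split; lra. Qed.

Lemma polydiffM k F F1 G G1 : polydiff k F F1 -> polydiff k G G1 ->
  polydiff k (fun g => F g * G g) (fun g => F1 g * G g + F g * G1 g).
Proof.
move=> [pF pF1 [C C0 [d H]]] [pG pG1 [C' C0' [d' H']]].
split; [exact: polylipM|by apply: polylipD; exact: polylipM|].
have [B1 b1 [e1 HB1]] := polylip_bound pF.
have [B2 b2 [e2 HB2]] := polylip_bound pF1.
have [B3 b3 [e3 HB3]] := polylip_bound pG.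
have [B4 b4 [e4 HB4]] := polylip_bound pG1.
have [A A0 [[AC AC' A1] [A2 A3 A4]]] : exists2 A, 0 <= A &
  [/\ C <= A, C' <= A & B1 <= A] /\ [/\ B2 <= A, B3 <= A & B4 <= A].
  exists (C + C' + B1 + B2 + B3 + B4); first by rewrite !addr_ge0.
  exact: le_sum6.
have [m [mC mC' m1] [m2 m3 m4]] : exists2 m,
  [/\ d <= m, d' <= m & e1 <= m]%N & [/\ e2 <= m, e3 <= m & e4 <= m]%N.
  by exists (d + d' + e1 + e2 + e3 + e4)%N; split; clear; lia.
exists (6 * A ^+ 2); first by rewrite mulr_ge0// sqr_ge0.
exists (m * 2)%N => g e le1; have w1 := wt_ge1 M g.
(* One weight dominates both functions, both derivatives and, up to [e ^+ 2], both remainders. *)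
pose w := A * wt g ^+ m.
have wm (X : R) n : 0 <= X -> X <= A -> (n <= m)%N -> X * wt g ^+ n <= w.
  move=> X0 XA nm; apply: ler_pM => //; first by rewrite exprn_ge0// wt_ge0.
  by rewrite ler_weXn2l.
have e2le : e ^+ 2 <= `|e|.
  by rewrite -real_normK ?num_real// expr2 ler_piMl.
have hF : `|F g| <= w by apply: (le_trans (HB1 g)); apply: wm.
have hF1 : `|F1 g| <= w by apply: (le_trans (HB2 g)); apply: wm.
have hG : `|G g| <= w by apply: (le_trans (HB3 g)); apply: wm.
have hG1 : `|G1 g| <= w by apply: (le_trans (HB4 g)); apply: wm.
set F' := F (upd _ _ _); set G' := G (upd _ _ _).
have hr : `|F' - F g - e * F1 g| <= w * e ^+ 2.
  by apply: (le_trans (H _ _ le1)); rewrite ler_wpM2r ?sqr_ge0// wm.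
have hs : `|G' - G g - e * G1 g| <= w * e ^+ 2.
  by apply: (le_trans (H' _ _ le1)); rewrite ler_wpM2r ?sqr_ge0// wm.
have w0 : 0 <= w by rewrite mulr_ge0// exprn_ge0// wt_ge0.
have hGe : `|G' - G g| <= w * (2 * `|e|).
  rewrite -(subrK (e * G1 g) (G' - G g)); apply: (le_trans (ler_normD _ _)).
  have -> : w * (2 * `|e|) = w * `|e| + w * `|e| by ring.
  apply: lerD.
    by apply: (le_trans hs); rewrite ler_wpM2l.
  by rewrite normrM mulrC ler_wpM2r.
have hG' : `|G'| <= 3 * w.
  rewrite -(subrK (G g) G'); apply: (le_trans (ler_normD _ _)).
  have h2 : w * (2 * `|e|) <= w * 2 by rewrite ler_wpM2l// ler_piMr.
  have -> : 3 * w = w * 2 + w by ring.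
  exact: lerD (le_trans hGe h2) hG.
have -> : F' * G' - F g * G g - e * (F1 g * G g + F g * G1 g) =
  (F' - F g - e * F1 g) * G' + (e * F1 g * (G' - G g) + F g * (G' - G g - e * G1 g)) by ring.
have -> : 6 * A ^+ 2 * wt g ^+ (m * 2) * e ^+ 2 =
  w * e ^+ 2 * (3 * w) + (`|e| * w * (w * (2 * `|e|)) + w * (w * e ^+ 2)).
  rewrite -[e ^+ 2]real_normK ?num_real// /w exprM; ring.
apply: (le_trans (ler_normD _ _)); apply: lerD.
  by rewrite normrM ler_pM.
apply: (le_trans (ler_normD _ _)); apply: lerD; last by rewrite normrM ler_pM.
by rewrite !normrM ler_pM// ?mulr_ge0// ler_wpM2l.
Qed.

Lemma polydiffX k F F1 n : polydiff k F F1 ->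
  polydiff k (fun g => F g ^+ n) (fun g => n%:R * F g ^+ n.-1 * F1 g).
Proof.
move=> dF; elim: n => [|n IH].
  have := polydiff_cst k 1; congr (polydiff k _ _); apply/funext => g.
  by rewrite mulr0n; ring.
have := polydiffM dF IH; congr (polydiff k _ _); apply/funext => g.
  by rewrite exprS.
case: n {IH} => [|n] /=; first by ring.
rewrite -[in RHS]natr1 exprS; ring.
Qed.

End PolydiffClosure.

(** * The expectation [gaussE] and the moments of a planar Gaussian vector *)

Section GaussE.
Variable R : realType.
Implicit Types (g : nat -> R) (F : (nat -> R) -> R).

(** Decreasing order, as [gaussE] integrates the coordinate of largest index outermost. *)
Definition coords (n : nat) := rev (iota 0 n).

Lemma coordsS n : coords n.+1 = n :: coords n.
Proof. by rewrite /coords -addn1 iotaD rev_cat. Qed.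

Lemma mem_coords n k : (k \in coords n) = (k < n)%N.
Proof. by rewrite mem_rev mem_iota add0n. Qed.

Lemma coords_uniq n : uniq (coords n).
Proof. by rewrite rev_uniq iota_uniq. Qed.

Lemma gaussE_gaussL n F : gaussE n F = gaussL (coords n) F (fun=> 0).
Proof.
rewrite /gaussE; elim: n (fun=> 0 : R) => // n IH g.
by rewrite coordsS /=; apply: eq_gint => x; exact: IH.
Qed.

Lemma etaE_gint (f : R -> R) : etaE f = gint f.
Proof. by []. Qed.

Lemma gaussES n F : (forall g x, F (upd g n x) = F g) -> gaussE n.+1 F = gaussE n F.
Proof. by move=> H; rewrite !gaussE_gaussL coordsS gaussL_indep. Qed.

Lemma gauss2_moment00 (a b c d : R) : gauss2_moment a b c d 0 0 = 1.
Proof.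
rewrite /gauss2_moment gaussE_gaussL -[RHS](gaussL_cst (coords 2) 1 (fun=> 0)).
by apply: eq_gaussL => g; rewrite !expr0 mulr1.
Qed.

(** Integration by parts in each coordinate: [a * u + b * v] and [c * u + d * v] are the covariances
    of the linear form [(u, v)] with the two components. Taking for [(u, v)] one of the rows
    [(a, b)], [(c, d)] gives the moment recursion. *)
Lemma gauss2_stein (a b c d u v : R) k k' :
  gaussE 2 (fun g => (u * g 0%N + v * g 1%N) *
    ((a * g 0%N + b * g 1%N) ^+ k * (c * g 0%N + d * g 1%N) ^+ k')) =
  k%:R * (a * u + b * v) * gauss2_moment a b c d k.-1 k' +
  k'%:R * (c * u + d * v) * gauss2_moment a b c d k k'.-1.
Proof.
pose T g := a * g 0%N + b * g 1%N; pose S g := c * g 0%N + d * g 1%N.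
have plin (x y : R) : polylip 2 (fun g => x * g 0%N + y * g 1%N).
  by apply: polylipD; apply: polylipZ; exact: polylip_coord.
have dlin i (x y : R) : polydiff 2 i (fun g => x * g 0%N + y * g 1%N)
    (fun=> x * (0%N == i)%:R + y * (1%N == i)%:R).
  have := polydiffD (polydiffM (polydiff_cst 2 i x) (@polydiff_coord R 2 i 0 isT))
                    (polydiffM (polydiff_cst 2 i y) (@polydiff_coord R 2 i 1 isT)).
  by congr (polydiff 2 i _ _); apply/funext => g; rewrite !mul0r !add0r.
have pTS n n' : polylip 2 (fun g => T g ^+ n * S g ^+ n').
  by apply: polylipM; apply: polylipX; exact: plin.
have dTS i := polydiffM (polydiffX k (dlin i a b)) (polydiffX k' (dlin i c d)).
have st i : (i < 2)%N -> gaussE 2 (fun g => g i * (T g ^+ k * S g ^+ k')) =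
   k%:R * (a * (0%N == i)%:R + b * (1%N == i)%:R) * gauss2_moment a b c d k.-1 k' +
   k'%:R * (c * (0%N == i)%:R + d * (1%N == i)%:R) * gauss2_moment a b c d k k'.-1.
  move=> i2; rewrite gaussE_gaussL.
  have ii : i \in coords 2 by rewrite mem_coords.
  rewrite (gaussL_stein _ i2 ii (coords_uniq 2) (dTS i)).
  rewrite /gauss2_moment !gaussE_gaussL -!(@gaussLZ R 2)// -(@gaussLD R 2).
  - by apply: eq_gaussL => g; rewrite /T /S; ring.
  - by apply: polylipZ; exact: pTS.
  - by apply: polylipZ; exact: pTS.
have pst i : (i < 2)%N -> polylip 2 (fun g => g i * (T g ^+ k * S g ^+ k')).
  by move=> i2; apply: polylipM; [exact: polylip_coord|exact: pTS].
transitivity (u * gaussE 2 (fun g => g 0%N * (T g ^+ k * S g ^+ k')) +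
              v * gaussE 2 (fun g => g 1%N * (T g ^+ k * S g ^+ k'))).
  rewrite !gaussE_gaussL -(gaussLZ _ u _ (pst 0%N isT)) -(gaussLZ _ v _ (pst 1%N isT)) -(@gaussLD R 2).
  - by apply: eq_gaussL => g; rewrite /T /S; ring.
  - by apply: polylipZ; exact: pst.
  - by apply: polylipZ; exact: pst.
by rewrite !st//=; ring.
Qed.

Lemma gauss2_momentSl (a b c d : R) k k' : gauss2_moment a b c d k.+1 k' =
  k%:R * (a ^+ 2 + b ^+ 2) * gauss2_moment a b c d k.-1 k' +
  k'%:R * (a * c + b * d) * gauss2_moment a b c d k k'.-1.
Proof.
have := gauss2_stein a b c d a b k k'; rewrite -!expr2 (mulrC c) (mulrC d) => <-.
rewrite /gauss2_moment !gaussE_gaussL; apply: eq_gaussL => g.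
by rewrite exprS mulrA.
Qed.

Lemma gauss2_momentSr (a b c d : R) k' : gauss2_moment a b c d 0 k'.+1 =
  k'%:R * (c ^+ 2 + d ^+ 2) * gauss2_moment a b c d 0 k'.-1.
Proof.
have := gauss2_stein a b c d c d 0 k'; rewrite -!expr2 mulr0n !mul0r add0r => <-.
rewrite /gauss2_moment !gaussE_gaussL; apply: eq_gaussL => g.
by rewrite exprS expr0 !mul1r.
Qed.

End GaussE.

(** * Gibbs averages and replicas *)

Section GibbsAverage.
Variables (R : realType) (T : finType) (s0 : T).
Implicit Types (H f d : T -> R).

Definition avg H f : R := (\sum_s f s * expR (H s)) / (\sum_s expR (H s)).

Lemma partition_gt0 H : 0 < \sum_s expR (H s).
Proof.
rewrite (bigD1 s0)//= ltr_pwDl ?expR_gt0// sumr_ge0// => s _; exact: expR_ge0.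
Qed.

Lemma avgD H f g : avg H (fun s => f s + g s) = avg H f + avg H g.
Proof.
rewrite /avg -mulrDl -big_split/=; congr (_ / _).
by apply: eq_bigr => s _; rewrite mulrDl.
Qed.

Lemma avgZ H c f : avg H (fun s => c * f s) = c * avg H f.
Proof.
rewrite /avg mulrA mulr_sumr; congr (_ / _).
by apply: eq_bigr => s _; rewrite mulrA.
Qed.

Lemma avgB H f g : avg H (fun s => f s - g s) = avg H f - avg H g.
Proof.
rewrite /avg -mulrBl -sumrB; congr (_ / _).
by apply: eq_bigr => s _; rewrite mulrBl.
Qed.

Lemma eq_avg H f g : f =1 g -> avg H f = avg H g.
Proof. by move=> /funext ->. Qed.

Lemma avg_cst H c : avg H (fun=> c) = c.
Proof. by rewrite /avg -mulr_sumr mulfK// gt_eqF// partition_gt0. Qed.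

Lemma avg_sum H (I : Type) (r : seq I) (P : pred I) (f : I -> T -> R) :
  avg H (fun s => \sum_(i <- r | P i) f i s) = \sum_(i <- r | P i) avg H (f i).
Proof.
elim: r => [|i r IH].
  by rewrite big_nil -[RHS](avg_cst H); apply: eq_avg => s; rewrite big_nil.
rewrite big_cons; case Pi: (P i); rewrite -IH -?avgD;
  by apply: eq_avg => s; rewrite big_cons Pi.
Qed.

Lemma avg_le H f g : (forall s, f s <= g s) -> avg H f <= avg H g.
Proof.
move=> fg; rewrite ler_pM2r ?invr_gt0 ?partition_gt0//.
by apply: ler_sum => s _; rewrite ler_wpM2r ?expR_ge0.
Qed.

Lemma avg_norm_le H f : `|avg H f| <= avg H (fun s => `|f s|).
Proof.
rewrite ler_norml -[- avg _ _]mulN1r -avgZ; apply/andP; split; apply: avg_le => s.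
  by rewrite mulN1r lerNnormlW.
exact: ler_norm.
Qed.

Lemma avg_bound H f B : (forall s, `|f s| <= B) -> `|avg H f| <= B.
Proof.
by move=> fB; rewrite (le_trans (avg_norm_le _ _))// -[leRHS](avg_cst H); exact: avg_le.
Qed.

Definition cov H f d := avg H (fun s => f s * d s) - avg H f * avg H d.

Lemma cov_bound H f d B D : (forall s, `|f s| <= B) -> (forall s, `|d s| <= D) ->
  `|cov H f d| <= 2 * (B * D).
Proof.
move=> fB dD; have -> : 2 * (B * D) = B * D + B * D by ring.
apply: (le_trans (ler_normB _ _)); apply: lerD.
  by apply: avg_bound => s; rewrite normrM ler_pM.
by rewrite normrM ler_pM// avg_bound.
Qed.

Lemma covB H f d e : cov H f (fun s => d s - e s) = cov H f d - cov H f e.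
Proof.
rewrite /cov avgB -[X in X - _](_ : avg H (fun s => f s * d s) - avg H (fun s => f s * e s) = _).
  ring.
by rewrite -avgB; apply: eq_avg => s; rewrite mulrBr.
Qed.

Lemma covZ H f d c : cov H f (fun s => c * d s) = c * cov H f d.
Proof.
rewrite /cov avgZ -[X in X - _](_ : c * avg H (fun s => f s * d s) = _).
  ring.
by rewrite -avgZ; apply: eq_avg => s; rewrite mulrCA.
Qed.

Lemma avg_tilt H f d :
  avg (fun s => H s + d s) f = avg H (fun s => f s * expR (d s)) / avg H (fun s => expR (d s)).
Proof.
have Z0 := partition_gt0 H.
have E (g : T -> R) : \sum_s g s * expR (H s + d s) = \sum_s (g s * expR (d s)) * expR (H s).
  by apply: eq_bigr => s _; rewrite expRD -mulrA (mulrC (expR (d s))).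
have E1 : \sum_s expR (H s + d s) = \sum_s expR (d s) * expR (H s).
  by apply: eq_bigr => s _; rewrite expRD mulrC.
rewrite /avg E E1 -mulf_div divff ?mulr1 ?invr_eq0 ?gt_eqF//.
Qed.

(** For the upper half, squaring [(1 - x / 2) expR (x / 2) <= 1] reduces the claim to an inequality
    between polynomials on [[-1, 1]]. *)
Lemma expR_taylor2 (x : R) : `|x| <= 1 -> `|expR x - 1 - x| <= 3 * x ^+ 2.
Proof.
rewrite ler_norml => /andP[x1 x2].
have h0 : 0 <= expR x - 1 - x by have := expR_ge1Dx x; lra.
rewrite ger0_norm//.
have h2 : (1 - x / 2) ^+ 2 * expR x <= 1.
  have e2 : expR x = expR (x / 2) ^+ 2 by rewrite -expRM_natl mulrC divfK.
  have em : (1 - x / 2) * expR (x / 2) <= 1.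
    rewrite -ler_pdivlMr ?expR_gt0// div1r -expRN.
    by have := expR_ge1Dx (- (x / 2)).
  rewrite e2 -exprMn exprn_ile1// mulr_ge0 ?expR_ge0//; lra.
have p : 0 < (1 - x / 2) ^+ 2 by rewrite exprn_gt0//; lra.
suff : (1 - x / 2) ^+ 2 * expR x <= (1 - x / 2) ^+ 2 * (1 + x + 3 * x ^+ 2).
  by rewrite ler_pM2l//; lra.
apply: (le_trans h2).
have -> : (1 - x / 2) ^+ 2 * (1 + x + 3 * x ^+ 2) =
  1 + x ^+ 2 * (9 / 4 - 11 / 4 * x + 3 / 4 * x ^+ 2) by field.
by rewrite lerDl mulr_ge0 ?sqr_ge0//; nra.
Qed.

(** For [D > 1/2] the crude bound [2 B + 2 B D] of the three terms is enough. For [D <= 1/2] the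
    tilted average is a quotient with denominator at least [1/2], and the exponentials in it are
    expanded to first order. *)
Lemma avg_taylor H f d B D : 0 <= D ->
  (forall s, `|f s| <= B) -> (forall s, `|d s| <= D) ->
  `|avg (fun s => H s + d s) f - avg H f - cov H f d| <= 28 * (B * D ^+ 2).
Proof.
move=> D0 fB dD; have B0 : 0 <= B by exact: le_trans (fB s0).
have cfd := cov_bound H fB dD.
have [D2|D2] := lerP D (1/2); last first.
  have := avg_bound H fB; have := avg_bound (fun s => H s + d s) fB.
  move: cfd; set c := cov _ _ _; set a := avg _ _; set b := avg _ _ => hc hb ha.
  apply: (@le_trans _ _ (`|a| + `|b| + `|c|)).
    by rewrite (le_trans (ler_normB _ _))// lerD2r ler_normB.
  apply: (@le_trans _ _ (2 * B + 2 * (B * D))); first by lra.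
  have -> : 28 * (B * D ^+ 2) = B * (28 * D ^+ 2) by ring.
  have -> : 2 * B + 2 * (B * D) = B * (2 + 2 * D) by ring.
  by rewrite ler_wpM2l//; nra.
rewrite avg_tilt; set e := avg H (fun s => expR (d s)).
pose r s := expR (d s) - 1 - d s.
have hr s : `|r s| <= 3 * D ^+ 2.
  apply: (@le_trans _ _ (3 * (d s) ^+ 2)).
    by apply: expR_taylor2; rewrite (le_trans (dD s))//; lra.
  by rewrite ler_wpM2l// -[d s ^+ 2]real_normK ?num_real// lerX.
have e12 : 1/2 <= e.
  rewrite -[leLHS](avg_cst H); apply: avg_le => s.
  have := expR_ge1Dx (d s); have := dD s; rewrite ler_norml => /andP[]; lra.
have e0 : 0 < e by lra.
have ee : e = 1 + avg H d + avg H r.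
  by rewrite -{1}(avg_cst H 1) -!avgD; apply: eq_avg => s; rewrite /r; ring.
have ef : avg H (fun s => f s * expR (d s)) =
    avg H f + avg H (fun s => f s * d s) + avg H (fun s => f s * r s).
  by rewrite -!avgD; apply: eq_avg => s; rewrite /r; ring.
set c := cov H f d.
have -> : avg H (fun s => f s * expR (d s)) / e - avg H f - c =
  (avg H (fun s => f s * r s) - avg H f * avg H r - c * (avg H d + avg H r)) / e.
  have e_neq0 : e != 0 by rewrite gt_eqF.
  apply: (mulIf e_neq0); rewrite [RHS]divfK ?gt_eqF// mulrBl [(_ - _) * e]mulrBl divfK ?gt_eqF//.
  by rewrite ef ee /c /cov; ring.
rewrite normrM normfV (gtr0_norm e0) ler_pdivrMr//.
apply: (@le_trans _ _ (14 * (B * D ^+ 2))); last first.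
  have -> : 28 * (B * D ^+ 2) * e = 14 * (B * D ^+ 2) * (2 * e) by ring.
  by rewrite ler_peMr ?mulr_ge0// ?sqr_ge0//; lra.
have b1 : `|avg H (fun s => f s * r s)| <= B * (3 * D ^+ 2).
  by apply: avg_bound => s; rewrite normrM ler_pM.
have b2 : `|avg H f * avg H r| <= B * (3 * D ^+ 2).
  by rewrite normrM ler_pM// avg_bound.
have b3 : `|c * (avg H d + avg H r)| <= 2 * (B * D) * (D + 3 * D ^+ 2).
  rewrite normrM ler_pM//; apply: (le_trans (ler_normD _ _)).
  by apply: lerD; exact: avg_bound.
apply: (le_trans (ler_normB _ _)); apply: (le_trans (lerD (ler_normB _ _) (lexx _))).
apply: (le_trans (lerD (lerD b1 b2) b3)).
have -> : 14 * (B * D ^+ 2) = B * D ^+ 2 * 14 by ring.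
have -> : B * (3 * D ^+ 2) + B * (3 * D ^+ 2) + 2 * (B * D) * (D + 3 * D ^+ 2) =
  B * D ^+ 2 * (8 + 6 * D) by ring.
by rewrite ler_wpM2l ?mulr_ge0 ?sqr_ge0//; lra.
Qed.

Lemma avg_lipschitz H f d B D : 0 <= D ->
  (forall s, `|f s| <= B) -> (forall s, `|d s| <= D) ->
  `|avg (fun s => H s + d s) f - avg H f| <= 30 * (B * D).
Proof.
move=> D0 fB dD; have B0 : 0 <= B by exact: le_trans (fB s0).
have BD : 0 <= B * D by rewrite mulr_ge0.
have [D1|D1] := lerP D 1.
  rewrite -(subrK (cov H f d) (avg _ _ - _)); apply: (le_trans (ler_normD _ _)).
  apply: (le_trans (lerD (avg_taylor H D0 fB dD) (cov_bound H fB dD))).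
  have : B * D ^+ 2 <= B * D by rewrite expr2 mulrA ler_piMr.
  lra.
apply: (le_trans (ler_normB _ _)).
have := avg_bound H fB; have := avg_bound (fun s => H s + d s) fB.
have : B <= B * D by rewrite ler_peMr// ltW.
lra.
Qed.

End GibbsAverage.

(** After clearing both partition functions the claim is an identity between sums over pairs, and
    [swap] permutes the pairs without changing the total energy. Fresh replicas and the decoupled
    last spin are both handled this way. *)
Lemma avg_swap (R : realType) (T X : finType) (s0 : T) (x0 : X) (HT : T -> R) (HX : X -> R)
    (P F : T -> R) (phi : X -> R) (swap : T * X -> T * X) :
  injective swap ->
  (forall z, HT (swap z).1 + HX (swap z).2 = HT z.1 + HX z.2) ->
  (forall z, P (swap z).1 = F z.1 * phi z.2) ->
  avg HT P = avg HT F * avg HX phi.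
Proof.
move=> inj hH hP.
have ZT := partition_gt0 s0 HT; have ZX := partition_gt0 x0 HX.
suff E : (\sum_s P s * expR (HT s)) * (\sum_x expR (HX x)) =
         (\sum_s F s * expR (HT s)) * (\sum_x phi x * expR (HX x)).
  by rewrite /avg mulf_div -E -mulf_div divff ?mulr1// gt_eqF.
rewrite !big_distrlr /= !pair_big /= (reindex_inj inj) /=.
by apply: eq_bigr => z _; rewrite hP -mulrA -expRD hH expRD mulrACA.
Qed.

(** * Independent replicas at fixed disorder *)

Section Replicas.
Variables (R : realType) (O : finType) (o0 : O) (n0 : nat).
Notation T := {ffun 'I_n0 -> O}.
Implicit Types (H : O -> R) (f : T -> R) (s : T) (u l : 'I_n0) (n : nat).

Definition rav H f := avg (fun s : T => \sum_l H (s l)) f.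

Definition rep0 : T := [ffun=> o0].

(** Replicas are indexed by one fixed ['I_n0]. This predicate records how many are in use, so that
    fresh ones remain for later derivatives. *)
Definition first_dep n f := forall s s', (forall l, (l < n)%N -> s l = s' l) -> f s = f s'.

Definition setrep s u (o : O) : T := [ffun l => if l == u then o else s l].

Lemma setrep_same s u o : setrep s u o u = o.
Proof. by rewrite ffunE eqxx. Qed.

Lemma setrep_neq s u o l : l != u -> setrep s u o l = s l.
Proof. by rewrite ffunE => /negbTE ->. Qed.

Lemma setrep_id s u : setrep s u (s u) = s.
Proof. by apply/ffunP => l; rewrite ffunE; case: eqP => // ->. Qed.

Lemma setrep_setrep s u o o' : setrep (setrep s u o) u o' = setrep s u o'.
Proof. by apply/ffunP => l; rewrite !ffunE; case: eqP. Qed.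

Lemma rav_fresh H f u (phi : O -> R) : (forall s o, f (setrep s u o) = f s) ->
  rav H (fun s => f s * phi (s u)) = rav H f * avg H phi.
Proof.
move=> fu.
pose swap (z : T * O) := (setrep z.1 u z.2, z.1 u).
have swapK : involutive swap.
  by move=> [s o]; rewrite /swap /= setrep_setrep setrep_id setrep_same.
apply: (@avg_swap _ _ _ rep0 o0 _ _ _ _ _ swap) => [|[s o]|[s o]] /=.
- exact: inv_inj.
- rewrite (bigD1 u)//= [in RHS](bigD1 u)//= setrep_same.
  have -> : \sum_(l | l != u) H (setrep s u o l) = \sum_(l | l != u) H (s l).
    by apply: eq_bigr => l lu; rewrite setrep_neq.
  by ring.
- by rewrite fu setrep_same.
Qed.

Lemma rav_one H u (phi : O -> R) : rav H (fun s => phi (s u)) = avg H phi.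
Proof.
have := @rav_fresh H (fun=> 1) u phi (fun _ _ => erefl); rewrite /rav (avg_cst rep0) mul1r => <-.
by apply: eq_avg => s; rewrite mul1r.
Qed.

Definition permrep (p : {perm 'I_n0}) s : T := [ffun l => s (p l)].

Lemma rav_perm H f (p : {perm 'I_n0}) : rav H (fun s => f (permrep p s)) = rav H f.
Proof.
have inj : injective (permrep p).
  move=> s s' /ffunP ss'; apply/ffunP => l; have := ss' ((p^-1)%g l).
  by rewrite !ffunE permKV.
have hS s : \sum_l H (permrep p s l) = \sum_l H (s l).
  rewrite [in RHS](reindex_inj (@perm_inj _ p)) /=.
  by apply: eq_bigr => l _; rewrite ffunE.
rewrite /rav /avg; congr (_ / _).
  by rewrite [in RHS](reindex_inj inj) /=; apply: eq_bigr => s _; rewrite hS.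
Qed.

(* Differentiating an average of n replicas brings in replica n as a fresh copy:
   replicas 0, ..., n-1 get weight 1 and replica n gets -n. *)
Definition rwt n u : R := if (u < n)%N then 1 else if u == n :> nat then - n%:R else 0.

Lemma sum_rwt n (c : R) : (n < n0)%N -> \sum_u rwt n u * c = 0.
Proof.
move=> nn0; rewrite -mulr_suml.
rewrite (bigID (fun u : 'I_n0 => (u < n)%N)) /=.
have -> : \sum_(u < n0 | (u < n)%N) rwt n u = n%:R.
  rewrite (eq_bigr (fun=> 1)); last by move=> u un; rewrite /rwt un.
  by rewrite -(big_ord_widen n0 (fun=> 1)) ?sumr_const ?card_ord// ltnW.
rewrite (bigD1 (Ordinal nn0)) /=; last by rewrite ltnn.
rewrite big1 => [|u /andP[un /eqP uo]]; last first.
  rewrite /rwt (negbTE un); case: eqP => // e; case: uo; exact: val_inj.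
by rewrite /rwt /= ltnn eqxx addr0 subrr mul0r.
Qed.

Lemma first_dep_setrep n f s u o : first_dep n f -> (n <= u)%N -> f (setrep s u o) = f s.
Proof.
move=> df nu; apply: df => l ln; rewrite setrep_neq//; apply: contraTneq ln => ->.
by rewrite -leqNgt.
Qed.

(** Replicas from [n] on are independent of [f], so their covariances vanish. Each of the first [n]
    gives [<f d> - <f> <d>], and the [n] products [<f> <d>] are realised by the fresh replica
    [n]. *)
Lemma cov_replicas H f n (d : O -> R) : first_dep n f -> (n < n0)%N ->
  cov (fun s : T => \sum_l H (s l)) f (fun s => \sum_l d (s l)) =
  rav H (fun s => f s * \sum_u rwt n u * d (s u)).
Proof.
move=> df nn0; rewrite /cov.
have -> : avg (fun s : T => \sum_l H (s l)) (fun s => f s * \sum_l d (s l)) =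
  \sum_l rav H (fun s => f s * d (s l)).
  by rewrite -(avg_sum rep0); apply: eq_avg => s; rewrite mulr_sumr.
have -> : avg (fun s : T => \sum_l H (s l)) (fun s => \sum_l d (s l)) = \sum_(l < n0) avg H d.
  by rewrite (avg_sum rep0); apply: eq_bigr => l _; exact: rav_one.
have -> : rav H (fun s => f s * \sum_u rwt n u * d (s u)) =
  \sum_u rwt n u * rav H (fun s => f s * d (s u)).
  transitivity (\sum_u rav H (fun s => rwt n u * (f s * d (s u)))).
    rewrite -(avg_sum rep0); apply: eq_avg => s; rewrite mulr_sumr.
    by apply: eq_bigr => u _; rewrite mulrCA.
  by apply: eq_bigr => u _; rewrite /rav avgZ.
have fr u : (n <= u)%N -> rav H (fun s => f s * d (s u)) = rav H f * avg H d.
  by move=> nu; apply: rav_fresh => s o; exact: first_dep_setrep df nu.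
rewrite mulr_sumr -sumrB; apply/eqP; rewrite -subr_eq0; apply/eqP.
rewrite -sumrB -[RHS](sum_rwt (- (rav H f * avg H d)) nn0); apply: eq_bigr => u _.
rewrite -/(rav H f) /rwt; case: ltnP => un; first by ring.
by rewrite fr//; case: eqP => _; ring.
Qed.

End Replicas.

(** * Energies affine in Gaussian disorder: integration by parts and dependence on a parameter *)

Section GaussianModel.
Variables (R : realType) (O : finType) (o0 : O) (n0 M : nat).
Notation T := {ffun 'I_n0 -> O}.
Implicit Types (f : T -> R) (s : T) (u l : 'I_n0) (n : nat) (g : nat -> R).

Definition linH (b0 : O -> R) (b : nat -> O -> R) g (o : O) : R :=
  b0 o + \sum_(k < M) g k * b k o.

Variable K : R.
Hypothesis K0 : 0 <= K.

Lemma fun_bound f : exists2 B, 0 <= B & forall s, `|f s| <= B.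
Proof.
exists (\sum_s `|f s|); first exact: sumr_ge0.
by move=> s; rewrite (bigD1 s)//= lerDl sumr_ge0.
Qed.

Section FixedCoefficients.
Variables (b0 : O -> R) (b : nat -> O -> R).
Hypothesis bK : forall k o, `|b k o| <= K.
Notation nuG f := (fun g => rav (linH b0 b g) f).

Lemma polylip_rav f : polylip M (nuG f).
Proof.
have [B B0 fB] := fun_bound f.
apply: (@polylip_lip _ _ _ (30 * (B * (n0%:R * K)))); first by rewrite !mulr_ge0.
move=> g g'.
pose d s := \sum_l (linH b0 b g (s l) - linH b0 b g' (s l)).
have dD s : `|d s| <= n0%:R * K * l1dist M g g'.
  rewrite /d; apply: (le_trans (ler_norm_sum _ _ _)).
  have -> : n0%:R * K * l1dist M g g' = \sum_(l < n0) K * l1dist M g g'.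
    by rewrite sumr_const card_ord mulr_natl mulrnAl.
  apply: ler_sum => l _; rewrite /linH opprD addrACA subrr add0r -sumrB mulr_sumr.
  apply: (le_trans (ler_norm_sum _ _ _)); apply: ler_sum => k _.
  by rewrite -mulrBl normrM mulrC ler_wpM2r.
have D0 : 0 <= n0%:R * K * l1dist M g g' by rewrite !mulr_ge0// l1dist_ge0.
have := avg_lipschitz (rep0 o0 n0) (fun s : T => \sum_l linH b0 b g' (s l)) D0 fB dD.
have -> : (fun s : T => \sum_l linH b0 b g' (s l) + d s) = fun s : T => \sum_l linH b0 b g (s l).
  by apply/funext => s; rewrite /d sumrB addrC subrK.
by rewrite /rav !mulrA.
Qed.

Lemma linH_upd g k e o : (k < M)%N ->
  linH b0 b (upd g k (g k + e)) o = linH b0 b g o + e * b k o.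
Proof.
move=> kM; rewrite /linH -addrA; congr (_ + _).
rewrite (bigD1 (Ordinal kM))//= [in RHS](bigD1 (Ordinal kM))//= upd_same.
rewrite (eq_bigr (fun i : 'I_M => g i * b i o)); first by ring.
move=> i ik; rewrite /upd; case: eqP => // e'; case/eqP: ik; exact: val_inj.
Qed.

Lemma polydiff_rav f n k : first_dep n f -> (n < n0)%N -> (k < M)%N ->
  polydiff M k (nuG f) (nuG (fun s => f s * \sum_u rwt R n u * b k (s u))).
Proof.
move=> df nn0 kM; split; [exact: polylip_rav..|].
have [B B0 fB] := fun_bound f.
exists (28 * (B * (n0%:R * K) ^+ 2)); first by rewrite !mulr_ge0// sqr_ge0.
exists 0%N => g e _; rewrite expr0 mulr1.
rewrite -cov_replicas// -covZ.
have dD s : `|e * \sum_l b k (s l)| <= n0%:R * K * `|e|.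
  rewrite normrM mulrC ler_wpM2r//; apply: (le_trans (ler_norm_sum _ _ _)).
  by rewrite mulr_natl -[X in _ *+ X]card_ord -sumr_const; apply: ler_sum => l _.
have D0 : 0 <= n0%:R * K * `|e| by rewrite !mulr_ge0.
have := avg_taylor (rep0 o0 n0) (fun s : T => \sum_l linH b0 b g (s l)) D0 fB dD.
rewrite exprMn real_normK ?num_real// !mulrA; apply: le_trans.
rewrite le_eqVlt; apply/orP; left; apply/eqP; congr (`|_ - _ - _|).
rewrite /rav; congr avg; apply/funext => s; rewrite mulr_sumr -big_split/=.
by apply: eq_bigr => l _; rewrite linH_upd.
Qed.

Lemma gaussE_rav_stein f n k : first_dep n f -> (n < n0)%N -> (k < M)%N ->
  gaussE M (fun g => g k * rav (linH b0 b g) f) =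
  gaussE M (nuG (fun s => f s * \sum_u rwt R n u * b k (s u))).
Proof.
move=> df nn0 kM; rewrite !gaussE_gaussL.
apply: gaussL_stein (polydiff_rav df nn0 kM) => //; last exact: coords_uniq.
by rewrite mem_coords.
Qed.

End FixedCoefficients.

Section Interpolation.
Variables (b0 b0' : R -> O -> R) (b b' : R -> nat -> O -> R).
Hypothesis bK : forall t k o, `|b t k o| <= K.
Hypothesis b'K : forall t k o, `|b' t k o| <= K.
Hypothesis b0'K : forall t o, `|b0' t o| <= K.
Hypothesis bT : forall t e k o, `|b (t + e) k o - b t k o - e * b' t k o| <= K * e ^+ 2.
Hypothesis b0T : forall t e o, `|b0 (t + e) o - b0 t o - e * b0' t o| <= K * e ^+ 2.

Definition nuI t f := gaussE M (fun g => rav (linH (b0 t) (b t) g) f).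

(** [rwt R n] comes from differentiating the energy in [t]. Integrating the factor [g k] by parts
    then differentiates a function of [n.+1] replicas, hence [rwt R n.+1]. *)
Definition interp_gen n t s : R :=
  \sum_(k < M) (\sum_u rwt R n u * b' t k (s u)) * (\sum_u rwt R n.+1 u * b t k (s u))
  + \sum_u rwt R n u * b0' t (s u).

Notation nuG t f := (fun g => rav (linH (b0 t) (b t) g) f).

Definition rav_deriv t n f g := rav (linH (b0 t) (b t) g)
  (fun s => f s * \sum_u rwt R n u * linH (b0' t) (b' t) g (s u)).

Lemma rav_derivE t n f g : rav_deriv t n f g =
  rav (linH (b0 t) (b t) g) (fun s => f s * \sum_u rwt R n u * b0' t (s u)) +
  \sum_(k < M) g k *
    rav (linH (b0 t) (b t) g) (fun s => f s * \sum_u rwt R n u * b' t k (s u)).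
Proof.
rewrite /rav_deriv /rav.
under [X in _ = _ + X]eq_bigr do rewrite -avgZ.
rewrite -(avg_sum (rep0 o0 n0)) -avgD; apply: eq_avg => s.
transitivity (f s * (\sum_u rwt R n u * b0' t (s u) +
  \sum_(k < M) g k * \sum_u rwt R n u * b' t k (s u))).
  congr (_ * _); under [X in _ = _ + X]eq_bigr do rewrite mulr_sumr.
  rewrite exchange_big -big_split/=; apply: eq_bigr => u _.
  rewrite /linH mulrDr mulr_sumr; congr (_ + _); apply: eq_bigr => k _; ring.
by rewrite mulrDr [X in _ + X = _]mulr_sumr; congr (_ + _); apply: eq_bigr => k _; ring.
Qed.

Lemma polylip_rav_deriv t n f : polylip M (rav_deriv t n f).
Proof.
rewrite (funext (rav_derivE t n f)).
apply: polylipD; first exact: (polylip_rav _ (bK t)).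
by apply: polylip_sum => k; apply: polylipM; [exact: polylip_coord|exact: (polylip_rav _ (bK t))].
Qed.

Lemma linH_diff t e g o : `|e| <= 1 ->
  `|linH (b0 (t + e)) (b (t + e)) g o - linH (b0 t) (b t) g o
    - e * linH (b0' t) (b' t) g o| <= K * e ^+ 2 * wt M g /\
  `|linH (b0 (t + e)) (b (t + e)) g o - linH (b0 t) (b t) g o| <= 2 * K * `|e| * wt M g.
Proof.
move=> e1.
have A : `|linH (b0 (t + e)) (b (t + e)) g o - linH (b0 t) (b t) g o
    - e * linH (b0' t) (b' t) g o| <= K * e ^+ 2 * wt M g.
  rewrite (_ : _ - _ - _ = (b0 (t + e) o - b0 t o - e * b0' t o) +
    \sum_(k < M) g k * (b (t + e) k o - b t k o - e * b' t k o)); last first.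
    rewrite (eq_bigr (fun k : 'I_M => g k * b (t + e) k o - g k * b t k o -
       e * (g k * b' t k o))); last by move=> k _; ring.
    by rewrite !sumrB -mulr_sumr /linH; ring.
  apply: (le_trans (ler_normD _ _)); rewrite /wt mulrDr mulr1; apply: lerD => //.
  rewrite mulr_sumr; apply: (le_trans (ler_norm_sum _ _ _)); apply: ler_sum => k _.
  by rewrite normrM mulrC ler_wpM2r.
have B : `|linH (b0' t) (b' t) g o| <= K * wt M g.
  apply: (le_trans (ler_normD _ _)); rewrite /wt mulrDr mulr1; apply: lerD => //.
  rewrite mulr_sumr; apply: (le_trans (ler_norm_sum _ _ _)); apply: ler_sum => k _.
  by rewrite normrM mulrC ler_wpM2r.
split => //; set x := linH (b0 (t + e)) _ _ _ - _ in A *.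
rewrite -(subrK (e * linH (b0' t) (b' t) g o) x); apply: (le_trans (ler_normD _ _)).
have -> : 2 * K * `|e| * wt M g = K * `|e| * wt M g + `|e| * (K * wt M g) by ring.
apply: lerD; last by rewrite normrM ler_wpM2l.
apply: (le_trans A); rewrite ler_wpM2r ?wt_ge0// ler_wpM2l//.
by rewrite -real_normK ?num_real// expr2 ler_piMl.
Qed.

(** At fixed disorder the remainder is that of [avg_taylor] plus a covariance with the second-order
    error of the energy. Both are at most a multiple of [wt ^+ 2 * e ^+ 2], which is then integrated
    over the disorder. *)
Lemma nuI_remainder f n : first_dep n f -> (n < n0)%N -> exists C, forall t e, `|e| <= 1 ->
  `|nuI (t + e) f - nuI t f - e * gaussE M (rav_deriv t n f)| <= C * e ^+ 2.
Proof.
move=> df nn0; have [B B0 fB] := fun_bound f.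
pose C1 := 28 * B * (n0%:R * (2 * K)) ^+ 2 + 2 * B * (n0%:R * K).
exists (gaussE M (fun g => C1 * wt M g ^+ 2)) => t e e1.
pose Ph t g := rav (linH (b0 t) (b t) g) f.
have pP t' : polylip M (Ph t') by exact: (polylip_rav _ (bK t')).
have pD := polylip_rav_deriv t n f.
have pw : polylip M (fun g => C1 * wt M g ^+ 2) by apply/polylipZ/polylipX/polylip_wt.
rewrite /nuI !gaussE_gaussL -(gaussLZ _ e _ pD) -(gaussLB _ _ (pP (t + e)) (pP t)).
rewrite -(@gaussLB R M)//; last 2 first.
- exact: polylipB.
- exact: polylipZ.
have pB : polylip M (fun g => Ph (t + e) g - Ph t g - e * rav_deriv t n f g).
  by apply: polylipB; [exact: polylipB|exact: polylipZ].
rewrite mulrC -(gaussLZ _ _ _ pw).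
apply: (le_trans (gaussL_norm_le _ _ pB)); apply: (@gaussL_le R M).
- exact: polylip_norm.
- exact: polylipZ.
move=> g.
pose d s := \sum_l (linH (b0 (t + e)) (b (t + e)) g (s l) - linH (b0 t) (b t) g (s l)).
pose d' s := \sum_l linH (b0' t) (b' t) g (s l).
have hd s : `|d s| <= n0%:R * (2 * K * `|e| * wt M g).
  rewrite /d; apply: (le_trans (ler_norm_sum _ _ _)).
  rewrite mulr_natl -[X in _ *+ X]card_ord -sumr_const; apply: ler_sum => l _.
  by have [] := linH_diff t g (s l) e1.
have hd' s : `|d s - e * d' s| <= n0%:R * (K * e ^+ 2 * wt M g).
  rewrite /d /d' mulr_sumr -sumrB; apply: (le_trans (ler_norm_sum _ _ _)).
  rewrite mulr_natl -[X in _ *+ X]card_ord -sumr_const; apply: ler_sum => l _.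
  by have [] := linH_diff t g (s l) e1.
pose HH s := \sum_l linH (b0 t) (b t) g (s l).
have Pe : Ph (t + e) g = avg (fun s => HH s + d s) f.
  rewrite /Ph /rav; congr avg; apply/funext => s; rewrite /HH /d -big_split/=.
  by apply: eq_bigr => l _; rewrite addrC subrK.
have De : e * rav_deriv t n f g = cov HH f d - cov HH f (fun s => d s - e * d' s).
  by rewrite covB opprB addrC subrK covZ /rav_deriv -cov_replicas.
have D0 : 0 <= n0%:R * (2 * K * `|e| * wt M g) by rewrite !mulr_ge0 ?wt_ge0.
have t1 := avg_taylor (rep0 o0 n0) HH D0 fB hd.
have t2 := cov_bound (rep0 o0 n0) HH fB hd'.
rewrite Pe De.
have -> : avg (fun s => HH s + d s) f - Ph t g - (cov HH f d - cov HH f (fun s => d s - e * d' s)) =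
  (avg (fun s => HH s + d s) f - avg HH f - cov HH f d) + cov HH f (fun s => d s - e * d' s).
  by rewrite /Ph /rav -/HH; ring.
apply: (le_trans (ler_normD _ _)); apply: (le_trans (lerD t1 t2)).
have w1 := wt_ge1 M g; have w0 := wt_ge0 M g.
rewrite (_ : 28 * _ = 28 * B * (n0%:R * (2 * K)) ^+ 2 * wt M g ^+ 2 * e ^+ 2); last first.
  by rewrite -[in RHS](real_normK (num_real e)); ring.
rewrite (_ : 2 * (B * _) = 2 * B * (n0%:R * K) * wt M g * e ^+ 2); last by ring.
rewrite -mulrDl [leLHS]mulrC ler_wpM2l ?sqr_ge0//.
rewrite /C1 [leRHS]mulrDl lerD2l.
by rewrite ler_wpM2l ?mulr_ge0// expr2 ler_peMr.
Qed.

Lemma is_derive_nuI f n (t : R) : first_dep n f -> (n.+1 < n0)%N ->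
  is_derive t (1 : R) (fun t : R => nuI t f) (nuI t (fun s => f s * interp_gen n t s)).
Proof.
move=> df nn0; have [C HC] := nuI_remainder df (ltnW nn0).
rewrite (_ : nuI t _ = gaussE M (rav_deriv t n f)).
  by apply: (is_derive_quad (C := C)) => e e1; exact: HC.
rewrite !gaussE_gaussL.
transitivity (gaussL (coords M) (fun g =>
   rav (linH (b0 t) (b t) g) (fun s => f s * \sum_u rwt R n u * b0' t (s u)) +
   \sum_(k < M) g k *
    rav (linH (b0 t) (b t) g) (fun s => f s * \sum_u rwt R n u * b' t k (s u))) (fun=> 0)); last first.
  by apply: eq_gaussL => g; rewrite rav_derivE.
have p1 (F : T -> R) : polylip M (nuG t F) by exact: (polylip_rav _ (bK t)).
have p2 (k : 'I_M) (F : T -> R) : polylip M (fun g => g k * rav (linH (b0 t) (b t) g) F).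
  by apply: polylipM; [exact: polylip_coord|].
rewrite (@gaussLD R M)//; last exact: polylip_sum.
rewrite (@gaussL_sum R M)//.
transitivity (gaussL (coords M) (nuG t (fun s => f s * \sum_u rwt R n u * b0' t (s u))) (fun=> 0) +
  \sum_(k < M) gaussL (coords M) (nuG t (fun s => (f s * \sum_u rwt R n u * b' t k (s u)) *
     \sum_u rwt R n.+1 u * b t k (s u))) (fun=> 0)).
  rewrite -(@gaussL_sum R M)// -(@gaussLD R M)//; last exact: polylip_sum.
  rewrite /nuI gaussE_gaussL; apply: eq_gaussL => g; rewrite /rav -(avg_sum (rep0 o0 n0)) -avgD; apply: eq_avg => s.
  rewrite /interp_gen mulrDr [LHS]addrC [X in _ + X = _]mulr_sumr; congr (_ + _).
  by apply: eq_bigr => k _; rewrite mulrA.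
congr (_ + _); apply: eq_bigr => k _; rewrite -!gaussE_gaussL.
rewrite (gaussE_rav_stein _ (bK t) (n := n.+1))// => s s' ss'.
rewrite (df s s'); last by move=> l ln; apply: ss'; exact: ltnW.
congr (_ * _); apply: eq_bigr => u _.
have [un|un] := ltnP u n.+1; first by rewrite ss'.
by rewrite /rwt ltnNge ltnW//= gtn_eqF// !mul0r.
Qed.

End Interpolation.
End GaussianModel.

(** * The cavity interpolation *)

Section SecondOrder.
Variable R : realType.

Lemma mvt_lipschitz (f f1 : R -> R) L : (forall x : R, is_derive x (1 : R) f (f1 x)) ->
  (forall x, `|f1 x| <= L) -> forall x y, `|f x - f y| <= L * `|x - y|.
Proof.
move=> df fL.
have main x y : x < y -> `|f y - f x| <= L * `|y - x|.
  move=> xy; have cf : {within `[x, y], continuous f}.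
    apply: continuous_subspaceT => z.
    by apply/differentiable_continuous/derivable1_diffP; apply: ex_derive.
  have [c _ ->] := MVT xy (fun z _ => df z) cf.
  by rewrite normrM ler_wpM2r.
move=> x y; case: (ltgtP x y) => [xy|xy|->].
- by rewrite distrC [`|x - y|]distrC main.
- exact: main.
- by rewrite !subrr normr0 mulr0.
Qed.

Lemma taylor1_bound (f f1 f2 : R -> R) L : (forall x : R, is_derive x (1 : R) f (f1 x)) ->
  (forall x : R, is_derive x (1 : R) f1 (f2 x)) -> (forall x, `|f2 x| <= L) ->
  forall t e, `|f (t + e) - f t - e * f1 t| <= L * e ^+ 2.
Proof.
move=> df df1 fL t e.
have L0 : 0 <= L by exact: le_trans (fL 0).
have lip := mvt_lipschitz df1 fL.
pose k x := f x - x * f1 t.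
have dk (x : R) : is_derive x (1 : R) k (f1 x - f1 t).
  have -> : k = f - (f1 t \*: id) by apply/funext => z; rewrite /k !fctE /GRing.scale /= mulrC.
  by apply: is_derive_eq; rewrite /GRing.scale/= mulr1.
have -> : f (t + e) - f t - e * f1 t = k (t + e) - k t by rewrite /k; ring.
have [e0|e0|e0] := ltgtP e 0.
- have cf : {within `[t + e, t], continuous k}.
    apply: continuous_subspaceT => z.
    by apply/differentiable_continuous/derivable1_diffP; apply: ex_derive.
  have te : t + e < t by lra.
  have [c] := MVT te (fun z _ => dk z) cf; rewrite in_itv/= => /andP[c1 c2] ktE.
  rewrite distrC ktE normrM.
  have -> : t - (t + e) = - e by ring.
  rewrite normrN -[e ^+ 2]real_normK ?num_real// expr2 mulrA ler_wpM2r//.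
  apply: (le_trans (lip _ _)); rewrite ler_wpM2l// (ltr0_norm e0) ler_norml; apply/andP; split; lra.
- have cf : {within `[t, t + e], continuous k}.
    apply: continuous_subspaceT => z.
    by apply/differentiable_continuous/derivable1_diffP; apply: ex_derive.
  have te : t < t + e by lra.
  have [c] := MVT te (fun z _ => dk z) cf; rewrite in_itv/= => /andP[c1 c2] ktE.
  rewrite ktE normrM.
  have -> : t + e - t = e by ring.
  rewrite -[e ^+ 2]real_normK ?num_real// expr2 mulrA ler_wpM2r//.
  apply: (le_trans (lip _ _)); rewrite ler_wpM2l// (gtr0_norm e0) ler_norml; apply/andP; split; lra.
- by rewrite e0 addr0 subrr normr0 mulr_ge0 ?sqr_ge0.
Qed.

Lemma norm_sin_le1 (x : R) : `|sin x| <= 1.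
Proof. by rewrite ler_norml sin_geN1 sin_le1. Qed.

Lemma norm_cos_le1 (x : R) : `|cos x| <= 1.
Proof. by rewrite ler_norml cos_geN1 cos_le1. Qed.

Lemma sin_taylor (t e : R) : `|sin (t + e) - sin t - e * cos t| <= e ^+ 2.
Proof.
rewrite -[leRHS]mul1r; apply: (@taylor1_bound _ _ (fun x => - sin x)) => x.
by rewrite normrN norm_sin_le1.
Qed.

Lemma cos_taylor (t e : R) : `|cos (t + e) - cos t + e * sin t| <= e ^+ 2.
Proof.
rewrite -[X in _ + X]opprK -mulrN -[leRHS]mul1r.
apply: (@taylor1_bound _ (fun x => - sin x) (fun x => - cos x)) => x; last first.
  by rewrite normrN norm_cos_le1.
Qed.

Lemma cos2_taylor (t e : R) :
  `|cos (t + e) ^+ 2 - cos t ^+ 2 - e * (- (2 * (sin t * cos t)))| <= 4 * e ^+ 2.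
Proof.
apply: (@taylor1_bound (fun x => cos x ^+ 2) (fun x => - (2 * (sin x * cos x)))
   (fun x => - (2 * (cos x * cos x - sin x * sin x)))) => x.
- have -> : (fun x : R => cos x ^+ 2) = cos ^+ 2 by apply/funext => y; rewrite expr2.
  apply: is_derive_eq; rewrite /GRing.scale/= expr1 -mulr_natl; ring.
- have -> : (fun x : R => - (2 * (sin x * cos x))) = (- 2) *: (sin * cos).
    by apply/funext => y; rewrite !fctE /GRing.scale /= mulNr.
  apply: is_derive_eq; rewrite /GRing.scale/=; ring.
rewrite normrN normrM ger0_norm//; have -> : 4 = 2 * 2 :> R by ring.
rewrite ler_wpM2l//; apply: (le_trans (ler_normB _ _)).
have -> : 2 = 1 * 1 + 1 * 1 :> R by ring.
by rewrite !normrM; apply: lerD; apply: ler_pM; rewrite ?norm_sin_le1 ?norm_cos_le1.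
Qed.

End SecondOrder.

(** * The interpolated Hamiltonian and its generator *)

Section Model.
Variables (R : realType) (Sc N' : nat) (beta h D p q : R) (n0 : nat).
Notation N := N'.+1.
Notation O := (config Sc N).
Notation T := {ffun 'I_n0 -> O}.
Notation sp := (@spin R Sc).
Implicit Types (o : O) (s : T) (u v l : 'I_n0) (f : T -> R) (g : nat -> R) (t : R).

Definition eps o : R := sp (o ord_max).

Lemma spin_dim_gt0 : (0 < 2 * Sc + 1)%N. Proof. by rewrite addn1. Qed.

Definition o0 : O := [ffun=> Ordinal spin_dim_gt0].

Lemma spin_bound k : `|sp k| <= Sc%:R.
Proof.
rewrite /spin ler_norml; apply/andP; split; first by rewrite -[leLHS]add0r lerD2r.
rewrite lerBlDr -natrD ler_nat; have := ltn_ord k; lia.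
Qed.

Definition site_idx (i j : 'I_N) := (i * N + j)%N.
Definition M := (N * N).+1.
Definition cpl : R := beta / Num.sqrt N%:R.

Lemma site_idx_lt i j : (site_idx i j < N * N)%N.
Proof. by rewrite /site_idx; have := ltn_ord i; have := ltn_ord j; nia. Qed.

Lemma site_idx_ltM i j : (site_idx i j < M)%N.
Proof. exact: ltnW (site_idx_lt i j). Qed.

Lemma site_idx_inj i j i' j' : site_idx i j = site_idx i' j' -> i = i' /\ j = j'.
Proof.
rewrite /site_idx => e; have lj := ltn_ord j; have lj' := ltn_ord j'.
have ei : i = i' :> nat.
  by have := congr1 (divn^~ N) e; rewrite !divnMDl// !divn_small// !addn0.
by split; apply: val_inj => //=; move: e; rewrite ei => /addnI.
Qed.

(* The coordinates i * N + j with i < j < N carry the disorder; coordinate N * N carries the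
   field that replaces the couplings of the last site. *)
Definition bulk k o : R :=
  \sum_(i < N) \sum_(j < N | (i < j)%N && (j != ord_max))
     (k == site_idx i j)%:R * (sp (o i) * sp (o j)).
Definition cavity k o : R :=
  \sum_(i < N | i != ord_max) (k == site_idx i ord_max)%:R * (sp (o i) * eps o).
Definition extra k o : R := (k == N * N)%:R * (beta * Num.sqrt q * eps o).

(* Angle pi / 2 is the original system and angle 0 decouples the last site; sin and cos make
   the generator Lgen below independent of t up to the factor sin (2 t). *)
Definition Hb t k o : R := cpl * bulk k o + cpl * sin t * cavity k o + cos t * extra k o.
Definition Hb' t k o : R := cpl * cos t * cavity k o - sin t * extra k o.
(** Multiplied by [cos t ^+ 2], this self-field turns [R_uu - q] into [R_uu - p] in the diagonal
    terms of the derivative; at [t = 0] it is the correction to [D] in [site_w]. *)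
Definition kap : R := beta ^+ 2 / 2 * (p - q).
Definition Hb0 t o : R := cos t ^+ 2 * (kap * eps o ^+ 2) +
  (D * \sum_(i < N) sp (o i) ^+ 2 + h * \sum_(i < N) sp (o i)).
Definition Hb0' t o : R := - (2 * (sin t * cos t)) * (kap * eps o ^+ 2).

Lemma sum_pick (F : nat -> R) (m : nat) (x : R) : (m < M)%N ->
  \sum_(k < M) F k * ((k == m :> nat)%:R * x) = F m * x.
Proof.
move=> mM; rewrite (bigD1 (Ordinal mM))//= eqxx mul1r big1 ?addr0// => i im.
rewrite (_ : (i == m :> nat) = false) ?mul0r ?mulr0//.
by apply: contraNF im => /eqP im; apply/eqP; exact: val_inj.
Qed.

Lemma sum_bulk (F : nat -> R) o : \sum_(k < M) F k * bulk k o =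
  \sum_(i < N) \sum_(j < N | (i < j)%N && (j != ord_max))
     F (site_idx i j) * (sp (o i) * sp (o j)).
Proof.
under eq_bigr do rewrite mulr_sumr; rewrite exchange_big; apply: eq_bigr => i _.
under eq_bigr do rewrite mulr_sumr; rewrite exchange_big; apply: eq_bigr => j _.
by rewrite sum_pick// site_idx_ltM.
Qed.

Lemma sum_cavity (F : nat -> R) o : \sum_(k < M) F k * cavity k o =
  \sum_(i < N | i != ord_max) F (site_idx i ord_max) * (sp (o i) * eps o).
Proof.
under eq_bigr do rewrite mulr_sumr; rewrite exchange_big; apply: eq_bigr => i _.
by rewrite sum_pick// site_idx_ltM.
Qed.

Lemma sum_extra (F : nat -> R) o : \sum_(k < M) F k * extra k o =
  F (N * N)%N * (beta * Num.sqrt q * eps o).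
Proof. by rewrite /extra sum_pick// /M. Qed.

Lemma sum_Hb (F : nat -> R) t o : \sum_(k < M) F k * Hb t k o =
  cpl * \sum_(i < N) \sum_(j < N | (i < j)%N && (j != ord_max))
     F (site_idx i j) * (sp (o i) * sp (o j)) +
  cpl * sin t * \sum_(i < N | i != ord_max) F (site_idx i ord_max) * (sp (o i) * eps o) +
  cos t * (F (N * N)%N * (beta * Num.sqrt q * eps o)).
Proof.
rewrite -sum_bulk -sum_cavity -sum_extra !mulr_sumr -!big_split/=.
by apply: eq_bigr => k _; rewrite /Hb; ring.
Qed.

Lemma Hb_cavity t i o : i != ord_max -> Hb t (site_idx i ord_max) o = cpl * sin t * (sp (o i) * eps o).
Proof.
move=> im; rewrite /Hb /bulk /cavity /extra big1 => [|a _]; last first.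
  rewrite big1// => b /andP[_ bm]; case: eqP => [e|_]; last by rewrite mul0r.
  by have [_ eb] := site_idx_inj e; rewrite -eb eqxx in bm.
rewrite (bigD1 i)//= eqxx mul1r big1 => [|a /andP[_ ai]]; last first.
  case: eqP => [e|_]; last by rewrite mul0r.
  by have [ea _] := site_idx_inj e; rewrite -ea eqxx in ai.
rewrite (_ : (site_idx i ord_max == (N * N)%N) = false); first by rewrite mulr0n; ring.
by apply/negbTE; rewrite neq_ltn site_idx_lt.
Qed.

Lemma Hb_extra t o : Hb t (N * N)%N o = cos t * (beta * Num.sqrt q * eps o).
Proof.
have ne i j : ((N * N)%N == site_idx i j) = false.
  by apply/negbTE; rewrite neq_ltn site_idx_lt orbT.
rewrite /Hb /bulk /cavity /extra big1 => [|a _]; last first.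
  by rewrite big1// => b _; rewrite ne mul0r.
rewrite big1 => [|a _]; last by rewrite ne mul0r.
by rewrite eqxx mulr1n; ring.
Qed.

(* Overlap without the last site, still normalised by N. *)
Definition Rm s u v : R := N%:R^-1 * \sum_(i < N | i != ord_max) sp (s u i) * sp (s v i).
Definition Rfull s u v : R := N%:R^-1 * \sum_(i < N) sp (s u i) * sp (s v i).
Definition Qv u v : R := if u == v then p else q.
Definition Um u v s : R := Rm s u v - Qv u v.
Definition U u v s : R := Rfull s u v - Qv u v.

Lemma U_Um u v s : U u v s = Um u v s + N%:R^-1 * (eps (s u) * eps (s v)).
Proof.
rewrite /U /Um /Rfull /Rm (bigD1 ord_max)//= mulrDr -/(eps _) -/(eps _).
by rewrite addrAC -addrA addrC -addrA addrC; ring.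
Qed.

Definition Lgen n s : R := beta ^+ 2 / 2 *
  \sum_u \sum_v rwt R n u * rwt R n.+1 v * (eps (s u) * eps (s v)) * Um u v s.

Lemma rwt_diag n u : rwt R n u * rwt R n.+1 u = rwt R n u.
Proof.
rewrite /rwt; case: (ltngtP u n) => un.
- by rewrite ltnW ?ltnS// mulr1.
- by rewrite mul0r.
- by rewrite un ltnS leqnn mulr1.
Qed.

(** The bulk is constant in [t]. The cavity couplings contribute [beta^2 eps eps' Rm] and the extra
    field [- beta^2 q eps eps'], both times [sin t * cos t]; the [kap] term replaces [q] by [p]
    where [u = v]. *)
Lemma interp_genE n t s : 0 <= q ->
  interp_gen M Hb0' Hb Hb' n t s = 2 * (sin t * cos t) * Lgen n s.
Proof.
move=> q0; rewrite /interp_gen.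
have N0 : N%:R != 0 :> R by rewrite pnatr_eq0.
have cpl2 : cpl ^+ 2 = beta ^+ 2 / N%:R by rewrite /cpl expr_div_n sqr_sqrtr.
have E o o' : \sum_(k < M) Hb' t k o * Hb t k o' = (sin t * cos t) * beta ^+ 2 *
    (eps o * eps o' * (N%:R^-1 * \sum_(i < N | i != ord_max) sp (o i) * sp (o' i) - q)).
  transitivity (\sum_(k < M) (cpl * cos t * (Hb t k o' * cavity k o) - sin t * (Hb t k o' * extra k o))).
    by apply: eq_bigr => k _; rewrite /Hb'; ring.
  rewrite sumrB -!mulr_sumr (sum_cavity (fun k => Hb t k o')) (sum_extra (fun k => Hb t k o')) Hb_extra.
  rewrite (eq_bigr (fun i : 'I_N => cpl * sin t * (eps o * eps o') * (sp (o i) * sp (o' i)))); last first.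
    by move=> i im; rewrite Hb_cavity//; ring.
  rewrite -mulr_sumr -[q in RHS](sqr_sqrtr q0).
  set S := \sum_(i < _ | _) _.
  have -> : cpl * cos t * (cpl * sin t * (eps o * eps o') * S) =
    cpl ^+ 2 * (sin t * cos t * (eps o * eps o') * S) by ring.
  by rewrite cpl2; move: (Num.sqrt q) N0 => r N0; field.
transitivity (\sum_u \sum_v rwt R n u * rwt R n.+1 v *
   (\sum_(k < M) Hb' t k (s u) * Hb t k (s v)) + \sum_u rwt R n u * Hb0' t (s u)).
  congr (_ + _); under eq_bigr do rewrite big_distrlr /=.
  rewrite exchange_big; apply: eq_bigr => u _.
  rewrite exchange_big; apply: eq_bigr => v _; rewrite mulr_sumr.
  by apply: eq_bigr => k _; ring.
rewrite /Lgen mulrA mulr_sumr.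
have dE : \sum_u rwt R n u * Hb0' t (s u) = \sum_u \sum_v
    rwt R n u * rwt R n.+1 v * (u == v)%:R * (- (2 * (sin t * cos t)) * (kap * (eps (s u) * eps (s v)))).
  apply: eq_bigr => u _; rewrite (bigD1 u)//= big1 ?addr0 => [|v vu]; last first.
    by rewrite eq_sym (negbTE vu) mulr0 mul0r.
  by rewrite eqxx mulr1 rwt_diag /Hb0' expr2.
rewrite dE -big_split/=; apply: eq_bigr => u _; rewrite mulr_sumr -big_split/=.
apply: eq_bigr => v _; rewrite E /Um /Rm /Qv /kap.
by case: eqP => _; rewrite ?mulr1n ?mulr0n; field.
Qed.

End Model.

Section ModelAverage.
Variables (R : realType) (Sc N' : nat) (beta h D p q : R) (n0 : nat).
Notation N := N'.+1.
Notation O := (config Sc N).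
Notation T := {ffun 'I_n0 -> O}.
Notation sp := (@spin R Sc).
Implicit Types (o : O) (s : T) (u v l : 'I_n0) (f : T -> R) (g : nat -> R) (t : R).
Notation eps := (@eps R Sc N').
Notation M := (M N').
Notation Hb := (@Hb R Sc N' beta q).
Notation Hb' := (@Hb' R Sc N' beta q).
Notation Hb0 := (@Hb0 R Sc N' beta h D p q).
Notation Hb0' := (@Hb0' R Sc N' beta p q).
Notation o0 := (o0 Sc N').
Notation s0 := (rep0 o0 n0).
Notation cpl := (cpl N' beta).
Notation kap := (kap beta p q).

Definition ham t g o : R := linH M (Hb0 t) (Hb t) g o.
Definition nu t f : R := gaussE M (fun g => rav (ham t g) f).

Lemma sum_fin_bound (A : finType) (F : A -> R) a : `|F a| <= \sum_a `|F a|.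
Proof. by rewrite (bigD1 a)//= lerDl sumr_ge0. Qed.

(** The bound may depend on [N]: it only justifies differentiation under the expectation at fixed
    [N]. *)
Lemma pieces_bound : exists2 W, 0 <= W & forall o,
  [/\ forall k, `|bulk R k o| <= W, forall k, `|cavity R k o| <= W,
      forall k, `|extra beta q k o| <= W, `|kap * eps o ^+ 2| <= W & True].
Proof.
pose W1 o := \sum_(i < N) \sum_(j < N) `|sp (o i) * sp (o j)|.
pose W2 o := \sum_(i < N) `|sp (o i) * eps o|.
pose W3 o := `|beta * Num.sqrt q * eps o|.
pose W4 o := `|kap * eps o ^+ 2|.
pose W o := W1 o + W2 o + W3 o + W4 o.
have p1 o : 0 <= W1 o by rewrite sumr_ge0// => i _; rewrite sumr_ge0.
have p2 o : 0 <= W2 o by rewrite sumr_ge0.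
have p3 o : 0 <= W3 o by rewrite normr_ge0.
have p4 o : 0 <= W4 o by rewrite normr_ge0.
have pW o : 0 <= W o by rewrite !addr_ge0.
exists (\sum_o W o); first by rewrite sumr_ge0.
move=> o; have Wo : W o <= \sum_o W o by rewrite (bigD1 o)//= lerDl sumr_ge0.
have b01 (b : bool) (x : R) : `|b%:R * x| <= `|x|.
  by case: b; rewrite ?mulr1n ?mulr0n ?mul1r ?mul0r ?normr0.
split=> [k|k|k||//].
- apply: le_trans Wo; apply: (@le_trans _ _ (W1 o)); last by rewrite /W -!addrA lerDl !addr_ge0.
  apply: (le_trans (ler_norm_sum _ _ _)); apply: ler_sum => i _.
  apply: (le_trans (ler_norm_sum _ _ _)); rewrite [leRHS](bigID (fun j : 'I_N => (i < j)%N && (j != ord_max)))/=.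
  by rewrite -[leLHS]addr0 lerD ?sumr_ge0//; apply: ler_sum => j _.
- apply: le_trans Wo; apply: (@le_trans _ _ (W2 o)).
    apply: (le_trans (ler_norm_sum _ _ _)); rewrite [leRHS](bigID (fun i : 'I_N => i != ord_max))/=.
    by rewrite -[leLHS]addr0 lerD ?sumr_ge0//; apply: ler_sum => j _.
  by rewrite /W [W1 o + _]addrC -!addrA lerDl !addr_ge0.
- apply: le_trans Wo; apply: (@le_trans _ _ (W3 o)); first exact: b01.
  by rewrite /W addrAC [leRHS]addrC lerDl !addr_ge0.
- by apply: le_trans Wo; rewrite /W [leRHS]addrC lerDl !addr_ge0.
Qed.

Lemma model_bounds : exists2 K : R, 0 <= K & [/\
  forall t k o, `|Hb t k o| <= K, forall t k o, `|Hb' t k o| <= K,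
  forall t o, `|Hb0' t o| <= K,
  forall t e k o, `|Hb (t + e) k o - Hb t k o - e * Hb' t k o| <= K * e ^+ 2 &
  forall t e o, `|Hb0 (t + e) o - Hb0 t o - e * Hb0' t o| <= K * e ^+ 2].
Proof.
have [W W0 HW] := pieces_bound.
have c0 := normr_ge0 cpl.
exists ((2 * `|cpl| + 4) * W); first by rewrite mulr_ge0// addr_ge0// mulr_ge0.
have m3 (x y z w : R) : `|x| <= 1 -> `|y| <= w -> `|x * y| <= w.
  by move=> hx hy; rewrite normrM -[w]mul1r ler_pM.
have eqK x : x * W + x * W + 4 * W = (2 * x + 4) * W by ring.
split=> [t k o|t k o|t o|t e k o|t e o]; have [b1 b2 b3 b4 _] := HW o; rewrite -eqK.
- rewrite /Submission.Hb; apply: (le_trans (ler_normD _ _)); apply: lerD.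
    apply: (le_trans (ler_normD _ _)); apply: lerD.
      by rewrite normrM ler_wpM2l.
    rewrite -mulrA normrM ler_wpM2l// m3 ?norm_sin_le1//.
  apply: (@le_trans _ _ W); first by rewrite m3 ?norm_cos_le1.
  by rewrite ler_peMl//; lra.
- rewrite /Submission.Hb'; apply: (le_trans (ler_normB _ _)); apply: lerD.
    rewrite -[leLHS]add0r; apply: lerD; first by rewrite mulr_ge0.
    by rewrite -mulrA normrM ler_wpM2l// m3 ?norm_cos_le1.
  apply: (@le_trans _ _ W); first by rewrite m3 ?norm_sin_le1.
  by rewrite ler_peMl//; lra.
- rewrite /Submission.Hb0' -[leLHS]add0r; apply: lerD; first by rewrite addr_ge0// mulr_ge0.
  rewrite normrM; apply: ler_pM => //; rewrite normrN !normrM ger0_norm//.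
  have : `|sin t| * `|cos t| <= 1 * 1 by rewrite ler_pM ?norm_sin_le1 ?norm_cos_le1.
  lra.
- rewrite (_ : _ - _ - _ = cpl * ((sin (t + e) - sin t - e * cos t) * cavity R k o) +
    (cos (t + e) - cos t + e * sin t) * extra beta q k o); last by rewrite /Submission.Hb /Submission.Hb'; ring.
  rewrite [leRHS]mulrDl; apply: (le_trans (ler_normD _ _)); apply: lerD.
    rewrite [leRHS]mulrDl -[leLHS]add0r; apply: lerD; first by apply: mulr_ge0; [exact: mulr_ge0|exact: sqr_ge0].
    rewrite normrM -[leRHS]mulrA ler_wpM2l// normrM mulrC ler_pM//; exact: sin_taylor.
  rewrite normrM; apply: (@le_trans _ _ (e ^+ 2 * W)).
    by apply: ler_pM => //; exact: cos_taylor.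
  by rewrite mulrC ler_wpM2r ?sqr_ge0// ler_peMl//; lra.
- rewrite (_ : _ - _ - _ = (cos (t + e) ^+ 2 - cos t ^+ 2 - e * (- (2 * (sin t * cos t)))) *
      (kap * eps o ^+ 2)); last by rewrite /Submission.Hb0 /Submission.Hb0'; ring.
  rewrite [leRHS]mulrDl -[leLHS]add0r; apply: lerD.
    by apply: mulr_ge0; [rewrite addr_ge0// mulr_ge0|exact: sqr_ge0].
  have -> : 4 * W * e ^+ 2 = 4 * e ^+ 2 * W by ring.
  rewrite normrM ler_pM//; exact: cos2_taylor.
Qed.

Lemma polylip_nu t f : polylip M (fun g => rav (ham t g) f).
Proof. by have [K K0 [bK _ _ _ _]] := model_bounds; exact: (@polylip_rav _ _ o0 n0 M K K0 (Hb0 t) (Hb t) (bK t) f). Qed.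

(** The factor [2 * (sin t * cos t)] is the derivative of [sin t ^+ 2]: in that variable the path
    runs over [[0, 1]] and its generator is [Lgen]. *)
Lemma is_derive_nu f n t : 0 <= q -> first_dep n f -> (n.+1 < n0)%N ->
  is_derive t (1 : R) (fun t : R => nu t f)
    (2 * (sin t * cos t) * nu t (fun s => f s * Lgen beta p q n s)).
Proof.
move=> q0 df nn0; have [K K0 [b1 b2 b3 b4 b5]] := model_bounds.
have H := is_derive_nuI o0 M K0 b1 b2 b3 b4 b5 t df nn0.
rewrite (_ : _ * nu t _ = nuI M Hb0 Hb t (fun s => f s * interp_gen M Hb0' Hb Hb' n t s)) //.
rewrite /nuI /nu !gaussE_gaussL -(gaussLZ _ _ _ (polylip_nu t _)).
apply: eq_gaussL => g; rewrite /rav -avgZ; apply: eq_avg => s.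
by rewrite interp_genE// mulrCA.
Qed.

Lemma eq_nu t f f' : f =1 f' -> nu t f = nu t f'.
Proof. by move=> /funext ->. Qed.

Lemma nuD t f f' : nu t (fun s => f s + f' s) = nu t f + nu t f'.
Proof.
rewrite /nu !gaussE_gaussL -(gaussLD _ _ (polylip_nu t _) (polylip_nu t _)).
by apply: eq_gaussL => g; rewrite /rav avgD.
Qed.

Lemma nuZ t c f : nu t (fun s => c * f s) = c * nu t f.
Proof.
rewrite /nu !gaussE_gaussL -(gaussLZ _ _ _ (polylip_nu t _)).
by apply: eq_gaussL => g; rewrite /rav avgZ.
Qed.

Lemma nuB t f f' : nu t (fun s => f s - f' s) = nu t f - nu t f'.
Proof.
by rewrite -[in RHS]mulN1r -nuZ -nuD; apply: eq_nu => s; rewrite mulN1r.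
Qed.

Lemma nu_cst t c : nu t (fun=> c) = c.
Proof.
rewrite /nu gaussE_gaussL -[RHS](gaussL_cst (coords M) c (fun=> 0)).
by apply: eq_gaussL => g; rewrite /rav (avg_cst s0).
Qed.

Lemma nu_sum t (I : Type) (r : seq I) (P : pred I) (F : I -> T -> R) :
  nu t (fun s => \sum_(i <- r | P i) F i s) = \sum_(i <- r | P i) nu t (F i).
Proof.
elim: r => [|i r IH].
  by rewrite big_nil -[RHS](nu_cst t); apply: eq_nu => s; rewrite big_nil.
rewrite big_cons; case Pi: (P i); rewrite -IH -?nuD;
  by apply: eq_nu => s; rewrite big_cons Pi.
Qed.

Lemma nu_le t f f' : (forall s, f s <= f' s) -> nu t f <= nu t f'.
Proof.
move=> ff'; rewrite /nu !gaussE_gaussL; apply: (@gaussL_le R M); [exact: polylip_nu..|].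
by move=> g; apply: (avg_le s0).
Qed.

Lemma nu_ge0 t f : (forall s, 0 <= f s) -> 0 <= nu t f.
Proof. by move=> f0; rewrite -(nu_cst t 0); apply: nu_le. Qed.

Lemma nu_norm_le t f : `|nu t f| <= nu t (fun s => `|f s|).
Proof.
rewrite ler_norml -[- nu _ _]mulN1r -nuZ; apply/andP; split; apply: nu_le => s.
  by rewrite mulN1r lerNnormlW.
exact: ler_norm.
Qed.

Lemma nu_perm t f (pi : {perm 'I_n0}) : nu t (fun s => f (permrep pi s)) = nu t f.
Proof.
by rewrite /nu; congr gaussE; apply/funext => g; exact: rav_perm.
Qed.

Lemma ham_pihalf g : ham (pi / 2) g = hamiltonian beta h D g.
Proof.
apply/funext => o; rewrite /ham /linH sum_Hb /Submission.Hb0 sin_pihalf cos_pihalf /hamiltonian.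
rewrite expr0n !mul0r add0r addr0 mulr1 [LHS]addrC -[RHS]addrA -mulrDr; congr (_ * _ + _).
rewrite [in RHS](eq_bigr (fun i : 'I_N => \sum_(j < N | (i < j)%N && (j != ord_max))
     g (site_idx i j) * (sp (o i) * sp (o j)) + (i != ord_max)%:R * (g (site_idx i ord_max) * (sp (o i) * eps o)))).
  rewrite big_split/=; congr (_ + _); rewrite big_mkcond; apply: eq_bigr => i _.
  by case: eqP => _; rewrite ?mul1r ?mul0r.
move=> i _; rewrite (bigID (fun j : 'I_N => j != ord_max))/=; congr (_ + _).
  by apply: eq_bigr => j _; rewrite mulrA.
have [->|im] := eqVneq i ord_max.
  rewrite mulr0n mul0r big1// => j /andP[]; rewrite negbK => ij /eqP jm.
  by rewrite jm ltnn in ij.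
rewrite mulr1n mul1r (big_pred1 ord_max) => [|j]; first by rewrite mulrA.
rewrite negbK /=; have [->|] := eqVneq j ord_max; last by rewrite andbF.
by rewrite andbT ltn_neqAle -ltnS ltn_ord andbT; exact: im.
Qed.

Lemma nu_pihalf f : nu (pi / 2) f = gaussE (N * N) (fun g => rav (hamiltonian beta h D g) f).
Proof.
rewrite /nu /Submission.M (_ : (fun g => _) = (fun g => rav (hamiltonian beta h D g) f)); last first.
  by apply/funext => g; rewrite ham_pihalf.
rewrite gaussES// => g x; congr rav; apply/funext => o; rewrite /hamiltonian.
congr (_ * _ + _ + _); apply: eq_bigr => i _; apply: eq_bigr => j _.
rewrite /gij /upd; case: eqP => // e; have := site_idx_lt i j.
by rewrite /site_idx e ltnn.
Qed.

End ModelAverage.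

(** * The decoupled endpoint *)

Section Decoupled.
Variables (R : realType) (Sc N' : nat) (beta h D p q : R) (n0 : nat).
Notation N := N'.+1.
Notation O := (config Sc N).
Notation T := {ffun 'I_n0 -> O}.
Notation sp := (@spin R Sc).
Implicit Types (o : O) (s : T) (u v l : 'I_n0) (f : T -> R) (g : nat -> R) (t : R).
Notation eps := (@eps R Sc N').
Notation o0 := (o0 Sc N').
Notation s0 := (rep0 o0 n0).
Notation ham := (@ham R Sc N' beta h D p q).
Notation nu := (@nu R Sc N' beta h D p q n0).
Notation kap := (kap beta p q).
Notation mom := (mom Sc beta h D p q).

Definition mixo o o' : O := [ffun i => if i == ord_max then o' i else o i].
Definition mixs s s' : T := [ffun l => mixo (s l) (s' l)].

Lemma eps_mixo o o' : eps (mixo o o') = eps o'.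
Proof. by rewrite /Submission.eps ffunE eqxx. Qed.

Lemma mixo_bulk o o' i : i != ord_max -> mixo o o' i = o i.
Proof. by rewrite ffunE => /negbTE ->. Qed.

Lemma mixs_mixs s s' : mixs (mixs s s') (mixs s' s) = s.
Proof.
apply/ffunP => l; rewrite !ffunE; apply/ffunP => i; rewrite !ffunE.
by case: eqP => // ->.
Qed.

Definition hamA g o : R := cpl N' beta * (\sum_(i < N) \sum_(j < N | (i < j)%N && (j != ord_max))
     g (site_idx i j) * (sp (o i) * sp (o j))) +
  \sum_(i < N | i != ord_max) (D * sp (o i) ^+ 2 + h * sp (o i)).

(** The exponent of [site_w] at field [z] and spin value [x]. *)
Definition hamB z (x : R) : R :=
  beta * Num.sqrt q * z * x + h * x + (D + kap) * x ^+ 2.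

Lemma ham0E g o : ham 0 g o = hamA g o + hamB (g (N * N)%N) (eps o).
Proof.
rewrite /Submission.ham /linH sum_Hb sin0 [cpl _ _ * 0]mulr0 mul0r cos0 /Hb0 cos0 /hamA /hamB.
rewrite !mulr_sumr -big_split/= (bigD1 ord_max)//= -/(eps o).
by rewrite big_split/=; ring.
Qed.

Lemma hamA_mixo g o o' : hamA g (mixo o o') = hamA g o.
Proof.
rewrite /hamA; congr (_ * _ + _).
  apply: eq_bigr => i _; apply: eq_bigr => j /andP[ij jm].
  rewrite !mixo_bulk//; apply: contraTneq ij => ->.
  by rewrite -leqNgt -ltnS.
by apply: eq_bigr => i im; rewrite mixo_bulk.
Qed.

Definition nolast f := forall s s', f (mixs s s') = f s.

(* Only the field on the last spins sees coordinate N * N of the disorder. *)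
Lemma rav_nolast_upd g x f : nolast f ->
  rav (ham 0 (upd g (N * N)%N x)) f = rav (ham 0 g) f.
Proof.
move=> nf; pose swap (z : T * T) := (mixs z.2 z.1, mixs z.1 z.2).
have swapK : involutive swap by case=> s s'; rewrite /swap /= !mixs_mixs.
have E : rav (ham 0 (upd g (N * N)%N x)) f =
   avg (fun s : T => \sum_l ham 0 (upd g (N * N)%N x) (s l)) (fun=> 1) * rav (ham 0 g) f.
  apply: (@avg_swap _ _ _ s0 s0 _ _ _ _ _ swap) => [|[s s']|[s s']] /=.
  - exact: inv_inj.
  - rewrite -!big_split/=; apply: eq_bigr => l _; rewrite !ffunE !ham0E !eps_mixo !hamA_mixo.
    have hA o : hamA (upd g (N * N)%N x) o = hamA g o.
      rewrite /hamA; congr (_ * _ + _); apply: eq_bigr => i _; apply: eq_bigr => j _.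
      by rewrite /upd; case: eqP => // e; have := site_idx_lt i j; rewrite e ltnn.
    by rewrite !hA; ring.
  - by rewrite nf mul1r.
by rewrite E (avg_cst s0) mul1r.
Qed.

Definition onlylast f := forall s s', f (mixs s s') = f s'.

(** Exchanging all last spins between two independent systems of replicas preserves the total energy
    at [t = 0]. *)
Lemma rav0_factor g f f' : onlylast f -> nolast f' ->
  rav (ham 0 g) (fun s => f s * f' s) = rav (ham 0 g) f * rav (ham 0 g) f'.
Proof.
move=> of1 nf'; pose swap (z : T * T) := (mixs z.2 z.1, mixs z.1 z.2).
have swapK : involutive swap by case=> s s'; rewrite /swap /= !mixs_mixs.
apply: (@avg_swap _ _ _ s0 s0 _ _ _ _ _ swap) => [|[s s']|[s s']] /=.
- exact: inv_inj.
- rewrite -!big_split/=; apply: eq_bigr => l _; rewrite !ffunE !ham0E !eps_mixo !hamA_mixo.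
  by ring.
- by rewrite of1 nf'.
Qed.

Lemma rav_prod (H : O -> R) (phi : 'I_n0 -> O -> R) :
  rav H (fun s => \prod_l phi l (s l)) = \prod_l avg H (phi l).
Proof.
rewrite /rav /avg prodf_div; congr (_ / _).
  rewrite bigA_distr_bigA /=; apply: eq_bigr => s _.
  by rewrite expR_sum -big_split.
rewrite bigA_distr_bigA /=; apply: eq_bigr => s _; exact: expR_sum.
Qed.

Lemma avg_eps_mom g j : avg (ham 0 g) (fun o => eps o ^+ j) = mom j (g (N * N)%N).
Proof.
pose B (k : 'I_(2 * Sc + 1)) := hamB (g (N * N)%N) (sp k).
pose swap (z : O * 'I_(2 * Sc + 1)) : O * 'I_(2 * Sc + 1) :=
  ([ffun i => if i == ord_max then z.2 else z.1 i], z.1 ord_max).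
have swapK : involutive swap.
  case=> o k; rewrite /swap /= !ffunE eqxx; congr pair.
  by apply/ffunP => i; rewrite !ffunE; case: eqP => // ->.
have E : avg (ham 0 g) (fun o => eps o ^+ j) =
  avg (ham 0 g) (fun=> 1) * avg B (fun k => sp k ^+ j).
  apply: (@avg_swap _ _ _ o0 (Ordinal (spin_dim_gt0 Sc)) _ _ _ _ _ swap) => [|z|z].
  - exact: inv_inj.
  - case: z => o k /=; rewrite !ham0E /B.
    set o' := [ffun i => _].
    have -> : o' = mixo o [ffun=> k] by apply/ffunP => i; rewrite !ffunE.
    by rewrite eps_mixo hamA_mixo /Submission.eps !ffunE; ring.
  - by case: z => o k /=; rewrite mul1r /Submission.eps ffunE eqxx.
rewrite E (avg_cst o0) mul1r /Defs.mom /site_avg /avg.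
have wE k : site_w beta h D p q (g (N * N)%N) k = expR (B k).
  by rewrite /site_w /B /hamB /Submission.kap.
by congr (_ / _); apply: eq_bigr => k _; rewrite wE.
Qed.

Definition mono (e : 'I_n0 -> nat) s : R := \prod_l eps (s l) ^+ e l.
Definition mono_eta (e : 'I_n0 -> nat) (z : R) : R := \prod_l mom (e l) z.

Lemma onlylast_mono e : onlylast (mono e).
Proof. by move=> s s'; apply: eq_bigr => l _; rewrite ffunE eps_mixo. Qed.

Lemma polylip_mom j : polylip 1 (fun g : nat -> R => mom j (g 0%N)).
Proof.
pose b (_ : nat) (k : 'I_(2 * Sc + 1)) : R := beta * Num.sqrt q * sp k.
pose b0 (k : 'I_(2 * Sc + 1)) : R := h * sp k + (D + kap) * sp k ^+ 2.
pose K : R := \sum_k `|beta * Num.sqrt q * sp k|.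
have K0 : 0 <= K by rewrite sumr_ge0.
have bK k x : `|b k x| <= K by exact: sum_fin_bound.
have := @polylip_rav R _ (Ordinal (spin_dim_gt0 Sc)) 1 1 K K0 b0 b bK (fun w => sp (w ord0) ^+ j).
congr polylip; apply/funext => g.
rewrite (rav_one (Ordinal (spin_dim_gt0 Sc)) _ ord0 (fun k => sp k ^+ j)).
rewrite /Defs.mom /site_avg /avg.
have wE k : expR (linH 1 b0 b g k) = site_w beta h D p q (g 0%N) k.
  by rewrite /linH big_ord1 /site_w /b0 /b; congr expR; rewrite /kap; ring.
by congr (_ / _); apply: eq_bigr => k _; rewrite wE.
Qed.

Lemma polylip1_mono_eta e : polylip1 (mono_eta e).
Proof.
have pp : polylip 1 (fun g : nat -> R => mono_eta e (g 0%N)) by apply: polylip_prod => l; exact: polylip_mom.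
have := polylip_upd (fun=> 0) 0%N pp; congr polylip1; apply/funext => x.
Qed.

(** At fixed disorder the last spins give [mono_eta] at the coordinate [N * N], which the average of
    [f] does not see. That coordinate is the outermost one and integrates to [etaE]. *)
Lemma nu0_factor e f : nolast f ->
  nu 0 (fun s => mono e s * f s) = etaE (mono_eta e) * nu 0 f.
Proof.
move=> nf; rewrite /Submission.nu !gaussE_gaussL /M coordsS /= etaE_gint.
have pf := polylip_nu beta h D p q 0 f.
have fE x : gaussL (coords (N * N)) (fun g => rav (ham 0 g) f) (upd (fun=> 0) (N * N)%N x) =
   gaussL (coords (N * N)) (fun g => rav (ham 0 g) f) (fun=> 0).
  elim: (coords _) (fun=> 0 : R) => [|k l IH] g /=; first exact: rav_nolast_upd.
  apply: eq_gint => y; have [->|kN] := eqVneq k (N * N)%N; first by rewrite upd_upd.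
  by rewrite updC 1?eq_sym// IH.
have -> : gint (fun x => gaussL (coords (N * N)) (fun g => rav (ham 0 g) f) (upd (fun=> 0) (N * N)%N x)) =
   gaussL (coords (N * N)) (fun g => rav (ham 0 g) f) (fun=> 0).
  by rewrite (eq_gint fE); exact: (gaussL_cst [:: 0%N] _ (fun=> 0)).
rewrite mulrC -gintZ; last exact/polylip1_gintegrable/polylip1_mono_eta.
apply: eq_gint => x; rewrite -(fE x) [RHS]mulrC.
have cE (r : seq nat) g : (N * N)%N \notin r ->
  gaussL r (fun g => rav (ham 0 g) (fun s => mono e s * f s)) g =
  mono_eta e (g (N * N)%N) * gaussL r (fun g => rav (ham 0 g) f) g.
  elim: r g => [|k r IH] g /=.
    move=> _; rewrite rav0_factor//; last exact: onlylast_mono.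
    rewrite (@rav_prod _ (fun l o => eps o ^+ e l)); congr (_ * _).
    by apply: eq_bigr => l _; exact: avg_eps_mom.
  rewrite inE negb_or => /andP[kN rN].
  rewrite -gintZ; last by exact: (polylip_gaussL_int _ _ _ pf).
  by apply: eq_gint => y; rewrite IH// /upd (negbTE kN).
rewrite cE ?upd_same//.
by rewrite mem_coords ltnn.
Qed.

End Decoupled.

(** * Exchangeability of the sites in the original system *)

Section SiteSymmetry.
Variables (R : realType) (Sc N' : nat) (beta h D p q : R) (n0 : nat).
Notation N := N'.+1.
Notation O := (config Sc N).
Notation T := {ffun 'I_n0 -> O}.
Notation sp := (@spin R Sc).
Implicit Types (o : O) (s : T) (f : T -> R) (g : nat -> R).
Variable i0 : 'I_N.

Notation tau := (tperm i0 (ord_max : 'I_N)).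

Definition swapo o : O := [ffun i => o (tau i)].
Definition swaps s : T := [ffun l => swapo (s l)].

Lemma swapoK : involutive swapo.
Proof. by move=> o; apply/ffunP => i; rewrite !ffunE tpermK. Qed.

Lemma swapsK : involutive swaps.
Proof. by move=> s; apply/ffunP => l; rewrite !ffunE swapoK. Qed.

(** The Hamiltonian reads a coupling only when its first index is the smaller one, and a
    transposition may reverse a pair. Interchanging the two indices in that case keeps the map
    compatible with the order and an involution. *)
Definition pair_idx (a b : 'I_N) : nat :=
  if (a < b)%N == (tau a < tau b)%N then site_idx (tau a) (tau b) else site_idx (tau b) (tau a).

Definition swap_idx (k : nat) : nat :=
  if (k < N * N)%N then pair_idx (inord (k %/ N)) (inord (k %% N)) else k.

Lemma swap_idx_site a b : swap_idx (site_idx a b) = pair_idx a b.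
Proof.
rewrite /swap_idx site_idx_lt /site_idx divnMDl// divn_small// addn0 modnMDl modn_small//.
by rewrite !inord_val.
Qed.

Lemma site_idx_surj k : (k < N * N)%N -> exists a b : 'I_N, k = site_idx a b.
Proof.
move=> kN; exists (inord (k %/ N)), (inord (k %% N)).
by rewrite /site_idx !inordK ?ltn_mod// ?ltn_divLR// -divn_eq.
Qed.

Lemma pair_idx_lt a b : (pair_idx a b < N * N)%N.
Proof. by rewrite /pair_idx; case: ifP => _; exact: site_idx_lt. Qed.

Lemma swap_idxK : involutive swap_idx.
Proof.
move=> k; have [kN|kN] := ltnP k (N * N); last first.
  have kF : (k < N * N)%N = false by rewrite ltnNge kN.
  by rewrite /swap_idx kF kF.
have [a [b ->]] := site_idx_surj kN; rewrite swap_idx_site.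
have tauE (x y : 'I_N) : (tau x < tau y)%N = (tau y < tau x)%N -> x = y.
  move=> e; apply: (@perm_inj _ tau); apply/val_inj => /=.
  by move: e; case: ltngtP.
rewrite /pair_idx; case: ifPn => e; rewrite swap_idx_site /pair_idx !tpermK.
  by rewrite eq_sym e.
have [ab|ab] := eqVneq a b; first by move: e; rewrite ab !ltnn.
have tab : tau a != tau b by rewrite (inj_eq (@perm_inj _ tau)).
suff -> : ((tau b < tau a) == (b < a))%N = false by [].
move: e ab tab; rewrite -!val_eqE /=.
by case: (ltngtP a b) => // _; case: (ltngtP (tau a) (tau b)).
Qed.

Lemma swap_idx_lt k : (k < N * N)%N -> (swap_idx k < N * N)%N.
Proof. by move=> kN; rewrite /swap_idx kN pair_idx_lt. Qed.

Lemma perm_swap_idx : perm_eq (coords (N * N)) (map swap_idx (coords (N * N))).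
Proof.
apply: uniq_perm; first exact: coords_uniq.
  by rewrite (map_inj_uniq (inv_inj swap_idxK)) coords_uniq.
move=> k; rewrite mem_coords; apply/idP/mapP => [kN|[j]].
  by exists (swap_idx k); rewrite ?swap_idxK// mem_coords swap_idx_lt.
by rewrite mem_coords => jN ->; exact: swap_idx_lt.
Qed.

Lemma sum_lt_sym (phi : 'I_N -> 'I_N -> R) : (forall a b, phi a b = phi b a) ->
  2 * (\sum_(a < N) \sum_(b < N | (a < b)%N) phi a b) =
  \sum_(a < N) \sum_(b < N | a != b) phi a b.
Proof.
move=> sym; rewrite mulr_natl mulr2n.
have E : \sum_(a < N) \sum_(b < N | (a < b)%N) phi a b =
         \sum_(a < N) \sum_(b < N | (b < a)%N) phi a b.
  under eq_bigr do rewrite big_mkcond; rewrite exchange_big /=; apply: eq_bigr => a _.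
  by rewrite -big_mkcond; apply: eq_bigr => b _.
rewrite {2}E -big_split/=; apply: eq_bigr => a _.
rewrite [RHS](bigID (fun b : 'I_N => (a < b)%N))/=; congr (_ + _); apply: eq_bigl => b.
  by rewrite -val_eqE /=; case: (ltngtP a b).
by rewrite -val_eqE /=; case: (ltngtP a b).
Qed.

(** With the symmetrised couplings [gh] the sum can run over all ordered pairs of distinct sites,
    where reindexing by the transposition is free. *)
Lemma hamiltonian_swap g o :
  hamiltonian beta h D g (swapo o) = hamiltonian beta h D (g \o swap_idx) o.
Proof.
rewrite /hamiltonian; congr (_ * _ + _ * _ + _ * _); last 2 first.
- by rewrite [RHS](reindex_inj (@perm_inj _ tau)); apply: eq_bigr => i _; rewrite ffunE.
- by rewrite [RHS](reindex_inj (@perm_inj _ tau)); apply: eq_bigr => i _; rewrite ffunE.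
pose gh (a b : 'I_N) := if (a < b)%N then g (site_idx a b) else g (site_idx b a).
pose phi (a b : 'I_N) := gh a b * (sp (o (tau a)) * sp (o (tau b))).
have ghS (a b : 'I_N) : gh a b = gh b a.
  by rewrite /gh; case: ltngtP => // ab; congr (g (site_idx _ _)); exact: val_inj.
have phiS (a b : 'I_N) : phi a b = phi b a by rewrite /phi ghS mulrCA mulrC -!mulrA mulrC -mulrA.
have two : (2 : R) != 0 by rewrite pnatr_eq0.
transitivity (\sum_(a < N) \sum_(b < N | (a < b)%N) phi a b).
  by apply: eq_bigr => a _; apply: eq_bigr => b ab; rewrite /phi /gh ab !ffunE mulrA.
transitivity (\sum_(a < N) \sum_(b < N | (a < b)%N) phi (tau a) (tau b)).
  apply: (mulfI two); rewrite sum_lt_sym// sum_lt_sym => [|a b]; last exact: phiS.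
  rewrite (reindex_inj (@perm_inj _ tau)); apply: eq_bigr => a _.
  rewrite (reindex_inj (@perm_inj _ tau)); apply: eq_bigl => b.
  by rewrite (inj_eq (@perm_inj _ tau)).
apply: eq_bigr => a _; apply: eq_bigr => b ab; rewrite /phi !tpermK /gh mulrA.
congr (_ * _ * _); rewrite /gij /= -/(site_idx a b) swap_idx_site /pair_idx ab.
by case: ltnP.
Qed.

Lemma rav_site_swap g f :
  rav (hamiltonian beta h D g) (fun s => f (swaps s)) =
  rav (hamiltonian beta h D (g \o swap_idx)) f.
Proof.
have hS s : \sum_l hamiltonian beta h D g (swaps s l) =
            \sum_l hamiltonian beta h D (g \o swap_idx) (s l).
  by apply: eq_bigr => l _; rewrite ffunE hamiltonian_swap.
rewrite /rav /avg; congr (_ / _); rewrite (reindex_inj (inv_inj swapsK)); apply: eq_bigr => s _.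
  by rewrite swapsK hS.
by rewrite hS.
Qed.

Lemma nu_site_swap f :
  nu beta h D p q (pi / 2) (fun s => f (swaps s)) = nu beta h D p q (pi / 2) f.
Proof.
rewrite !nu_pihalf !gaussE_gaussL.
have pl : polylip (M N') (fun g => rav (hamiltonian beta h D g) f).
  by have := polylip_nu beta h D p q (pi / 2) f; under eq_fun do rewrite ham_pihalf.
transitivity (gaussL (coords (N * N))
    (fun g => rav (hamiltonian beta h D (g \o swap_idx)) f) (fun=> 0)).
  by apply: eq_gaussL => g; exact: rav_site_swap.
rewrite (@gaussL_relabel R swap_idx _ (fun g => rav (hamiltonian beta h D g) f))//; last exact: swap_idxK.
by rewrite -(gaussL_perm _ pl (coords_uniq _) perm_swap_idx).
Qed.

End SiteSymmetry.

(** * Moments of the overlaps *)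

Section InterpolationInequalities.
Variable R : realType.
Implicit Types (t x y : R).

Lemma sin_cos_ge0 t : 0 <= t <= pi / 2 -> 0 <= sin t * cos t.
Proof.
move=> /andP[t0 t1]; have p0 := pi_gt0 R; apply: mulr_ge0.
  by apply: sin_ge0_pi; apply/andP; split => //; lra.
by apply: cos_ge0_pihalf; apply/andP; split => //; lra.
Qed.

Lemma deriv_ge0_le (F F1 : R -> R) : (forall t, is_derive t (1 : R) F (F1 t)) ->
  (forall t, 0 <= t <= pi / 2 -> 0 <= F1 t) ->
  forall x y, 0 <= x -> x <= y -> y <= pi / 2 -> F x <= F y.
Proof.
move=> dF F0 x y x0; rewrite le_eqVlt => /orP[/eqP -> //|xy] yp.
have cF : {within `[x, y], continuous F}.
  apply: continuous_subspaceT => z.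
  by apply/differentiable_continuous/derivable1_diffP; apply: ex_derive.
have [c] := MVT xy (fun z _ => dF z) cF; rewrite in_itv/= => /andP[c1 c2] E.
rewrite -subr_ge0 E mulr_ge0 ?subr_ge0 ?(ltW xy)//.
by apply: F0; rewrite (le_trans x0 (ltW c1)) (le_trans (ltW c2) yp).
Qed.

Lemma is_derive_sin2 t : is_derive t (1 : R) (fun t : R => sin t ^+ 2) (2 * (sin t * cos t)).
Proof.
have -> : (fun x : R => sin x ^+ 2) = sin ^+ 2 by apply/funext => y; rewrite expr2.
apply: is_derive_eq; rewrite /GRing.scale/= expr1 -mulr_natl; ring.
Qed.

(** Both [S sin^2 + psi] and [S sin^2 - psi] are nondecreasing on [[0, pi / 2]], and
    [sin^2 <= 1]. *)
Lemma interp_ineq (psi psi1 : R -> R) (S : R) :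
  (forall t, is_derive t (1 : R) psi (2 * (sin t * cos t) * psi1 t)) ->
  (forall t, 0 <= t <= pi / 2 -> `|psi1 t| <= S) ->
  forall t, 0 <= t <= pi / 2 -> `|psi t - psi 0| <= S.
Proof.
move=> dpsi HS t /andP[t0 tp].
have S0 : 0 <= S by apply: le_trans (HS t _) => //; rewrite t0 tp.
have p0 := pi_gt0 R.
have s1 : sin t ^+ 2 <= 1.
  by rewrite -[sin t ^+ 2]real_normK ?num_real// expr_le1// norm_sin_le1.
have Ss : S * sin t ^+ 2 <= S by rewrite ler_piMr.
have d1 x : is_derive x (1 : R) (fun x : R => S * sin x ^+ 2 - psi x)
    (2 * (sin x * cos x) * (S - psi1 x)).
  have d2 := is_derive_sin2 x; have d3 := dpsi x.
  have -> : (fun x : R => S * sin x ^+ 2 - psi x) = S *: (fun t : R => sin t ^+ 2) - psi.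
    by apply/funext.
  by apply: is_derive_eq; rewrite /GRing.scale/=; ring.
have d2 x : is_derive x (1 : R) (fun x : R => S * sin x ^+ 2 + psi x)
    (2 * (sin x * cos x) * (S + psi1 x)).
  have d2 := is_derive_sin2 x; have d3 := dpsi x.
  have -> : (fun x : R => S * sin x ^+ 2 + psi x) = S *: (fun t : R => sin t ^+ 2) + psi.
    by apply/funext.
  by apply: is_derive_eq; rewrite /GRing.scale/=; ring.
have k1 : S * sin 0 ^+ 2 - psi 0 <= S * sin t ^+ 2 - psi t.
  apply: (deriv_ge0_le d1) => // x xp; apply: mulr_ge0; first by rewrite mulr_ge0 ?sin_cos_ge0.
  rewrite subr_ge0; apply: le_trans (HS x xp); exact: ler_norm.
have k2 : S * sin 0 ^+ 2 + psi 0 <= S * sin t ^+ 2 + psi t.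
  apply: (deriv_ge0_le d2) => // x xp; apply: mulr_ge0; first by rewrite mulr_ge0 ?sin_cos_ge0.
  by rewrite -lerBlDl sub0r lerNl; apply: le_trans (HS x xp); rewrite -normrN ler_norm.
rewrite sin0 expr0n/= mulr0 in k1 k2.
by rewrite ler_norml; apply/andP; split; lra.
Qed.

(** Apply [interp_ineq] to [psi - psi1 0 * sin^2], for which [psi1 t - psi1 0] plays the role of the
    derivative; a first application to [psi1] bounds that difference. *)
Lemma interp_ineq2 (psi psi1 psi2 : R -> R) (S : R) :
  (forall t, is_derive t (1 : R) psi (2 * (sin t * cos t) * psi1 t)) ->
  (forall t, is_derive t (1 : R) psi1 (2 * (sin t * cos t) * psi2 t)) ->
  (forall t, 0 <= t <= pi / 2 -> `|psi2 t| <= S) ->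
  `|psi (pi / 2) - psi 0 - psi1 0| <= S.
Proof.
move=> dpsi dpsi1 HS; have p0 := pi_gt0 R.
have H1 := interp_ineq dpsi1 HS.
pose F x := psi x - psi1 0 * sin x ^+ 2.
have dF x : is_derive x (1 : R) F (2 * (sin x * cos x) * (psi1 x - psi1 0)).
  have d2 := is_derive_sin2 x; have d3 := dpsi x.
  have -> : F = psi - psi1 0 *: (fun t : R => sin t ^+ 2) by apply/funext.
  by apply: is_derive_eq; rewrite /GRing.scale/=; ring.
have := interp_ineq dF H1 (t := pi / 2).
rewrite /F sin0 sin_pihalf expr0n/= mulr0 subr0 expr1n mulr1.
have -> : psi (pi / 2) - psi1 0 - psi 0 = psi (pi / 2) - psi 0 - psi1 0 by ring.
by apply; rewrite lexx andbT; lra.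
Qed.

(** [expR (C sin^2 t) psi t] is nondecreasing. The bound runs towards [pi / 2] because
    exchangeability of the sites is available there: averages along the path are to be controlled by
    those of the original system. *)
Lemma gronwall_interp (psi psi1 : R -> R) (C : R) :
  (forall t, is_derive t (1 : R) psi (2 * (sin t * cos t) * psi1 t)) ->
  (forall t, 0 <= psi t) -> 0 <= C ->
  (forall t, 0 <= t <= pi / 2 -> `|psi1 t| <= C * psi t) ->
  forall t, 0 <= t <= pi / 2 -> psi t <= expR C * psi (pi / 2).
Proof.
move=> dpsi psi0 C0 HC t /andP[t0 tp].
pose F x := expR (C * sin x ^+ 2) * psi x.
have dF x : is_derive x (1 : R) F
   (expR (C * sin x ^+ 2) * (2 * (sin x * cos x)) * (C * psi x + psi1 x)).
  have d2 := is_derive_sin2 x; have d3 := dpsi x.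
  have -> : F = (expR \o (C *: (fun t : R => sin t ^+ 2))) * psi by apply/funext.
  apply: is_derive_eq; rewrite /GRing.scale/=; ring.
have : F t <= F (pi / 2).
  apply: (deriv_ge0_le dF) => // x xp; apply: mulr_ge0.
    by rewrite mulr_ge0 ?expR_ge0// mulr_ge0 ?sin_cos_ge0.
  by rewrite -lerBlDl sub0r lerNl; apply: le_trans (HC x xp); rewrite -normrN ler_norm.
rewrite /F sin_pihalf expr1n mulr1; apply: le_trans.
by rewrite ler_peMl// -expR0 ler_expR mulr_ge0// sqr_ge0.
Qed.

End InterpolationInequalities.

Section UniformBounds.
Variables (R : realType) (Sc N' : nat) (beta h D p q : R) (n0 : nat).
Notation N := N'.+1.
Notation O := (config Sc N).
Notation T := {ffun 'I_n0 -> O}.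
Notation sp := (@spin R Sc).
Implicit Types (o : O) (s : T) (u v l : 'I_n0) (f : T -> R) (t : R).
Notation eps := (@eps R Sc N').
Notation nu := (@nu R Sc N' beta h D p q n0).
Notation Um := (@Um R Sc N' p q n0).
Notation U := (@U R Sc N' p q n0).
Notation B := (Sc%:R ^+ 2 : R).
Notation Lg := (@Lgen R Sc N' beta p q n0).

Hypothesis q0 : 0 <= q.
Hypothesis qB : q <= B.
Hypothesis pB : `|p| <= B.

Lemma eps2_bound o o' : `|eps o * eps o'| <= B.
Proof. by rewrite normrM expr2 ler_pM// spin_bound. Qed.

Lemma Qv_bound u v : `|Qv p q u v| <= B.
Proof. by rewrite /Qv; case: eqP => // _; rewrite ger0_norm. Qed.

Lemma sp2_bound o o' i : `|sp (o i) * sp (o' i)| <= B.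
Proof. by rewrite normrM expr2 ler_pM// spin_bound. Qed.

Lemma Um_bound u v s : `|Um u v s| <= 2 * B.
Proof.
rewrite mulr_natl mulr2n /Submission.Um; apply: (le_trans (ler_normB _ _)); apply: lerD; last exact: Qv_bound.
have N0 : (0 : R) < N%:R by rewrite ltr0n.
rewrite /Rm normrM gtr0_norm ?invr_gt0// mulrC ler_pdivrMr//.
apply: (le_trans (ler_norm_sum _ _ _)).
apply: (@le_trans _ _ (\sum_(i < N) `|sp (s u i) * sp (s v i)|)).
  by rewrite [leRHS](bigID (fun i : 'I_N => i != ord_max))/= lerDl sumr_ge0.
rewrite mulrC mulr_natl -[X in _ *+ X](card_ord N) -sumr_const.
by apply: ler_sum => i _; exact: sp2_bound.
Qed.

Lemma sum_norm_rwt n : (n < n0)%N -> \sum_(u < n0) `|rwt R n u| = 2 * n%:R.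
Proof.
move=> nn0.
rewrite (bigID (fun u : 'I_n0 => (u < n)%N)) /=.
have -> : \sum_(u < n0 | (u < n)%N) `|rwt R n u| = n%:R.
  rewrite (eq_bigr (fun=> 1)); last by move=> u un; rewrite /rwt un normr1.
  by rewrite -(big_ord_widen n0 (fun=> 1)) ?sumr_const ?card_ord// ltnW.
rewrite (bigD1 (Ordinal nn0)) /=; last by rewrite ltnn.
rewrite big1 => [|u /andP[un /eqP uo]]; last first.
  rewrite /rwt (negbTE un); case: eqP => [e|_]; last by rewrite normr0.
  by case: uo; exact: val_inj.
rewrite /rwt /= ltnn eqxx addr0 normrN ger0_norm//; ring.
Qed.

Lemma sum_rwt2_bound n (X : 'I_n0 -> 'I_n0 -> R) C : (n.+1 < n0)%N ->
  (forall u v, `|X u v| <= C) ->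
  `|\sum_u \sum_v rwt R n u * rwt R n.+1 v * X u v| <= (2 * n%:R) * (2 * n.+1%:R) * C.
Proof.
move=> nn0 HX; rewrite -sum_norm_rwt ?(ltnW nn0)// -sum_norm_rwt// big_distrlr mulr_suml.
apply: (le_trans (ler_norm_sum _ _ _)); apply: ler_sum => u _; rewrite mulr_suml.
apply: (le_trans (ler_norm_sum _ _ _)); apply: ler_sum => v _.
by rewrite !normrM ler_wpM2l// mulr_ge0.
Qed.

(** The product of [beta^2 / 2], the total weights [2 n] and [2 (n + 1)], and the bounds [B] of
    [eps eps] and [2 B] of [Um]. *)
Definition Lcst n : R := beta ^+ 2 * (4 * n%:R * n.+1%:R) * (B * B).

Lemma Lcst_ge0 n : 0 <= Lcst n.
Proof.
apply: mulr_ge0; last by apply: mulr_ge0; exact: sqr_ge0.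
by apply: mulr_ge0; [exact: sqr_ge0|rewrite !mulr_ge0].
Qed.

Lemma Lgen_bound n s : (n.+1 < n0)%N -> `|Lg n s| <= Lcst n.
Proof.
move=> nn0; rewrite /Lgen normrM ger0_norm ?divr_ge0 ?sqr_ge0//.
have := @sum_rwt2_bound n (fun u v => eps (s u) * eps (s v) * Um u v s) (B * (2 * B)) nn0.
under eq_bigr do under eq_bigr do rewrite mulrA.
move=> H; apply: (@le_trans _ _ (beta ^+ 2 / 2 * (2 * n%:R * (2 * n.+1%:R) * (B * (2 * B))))).
  rewrite ler_wpM2l ?divr_ge0 ?sqr_ge0//; apply: H => u v.
  by rewrite normrM ler_pM// ?eps2_bound ?Um_bound.
by rewrite /Lcst le_eqVlt; apply/orP; left; apply/eqP; field.
Qed.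

Lemma first_dep_mulL n f : first_dep n f -> first_dep n.+2 (fun s => f s * Lg n s).
Proof.
move=> df s s' ss'; rewrite (df s s'); last first.
  by move=> l ln; apply: ss'; rewrite ltnW// ltnW.
congr (_ * (_ * _)); apply: eq_bigr => u _; apply: eq_bigr => v _.
have [un|un] := ltnP u n.+1; last by rewrite /rwt ltnNge ltnW//= gtn_eqF// !mul0r.
have [vn|vn] := ltnP v n.+2; last first.
  by rewrite [rwt R n.+1 v]/rwt ltnNge ltnW//= gtn_eqF// mulr0 !mul0r.
by rewrite /Submission.Um /Rm !ss'// ltnW.
Qed.

Lemma nu_gronwall n f t : first_dep n f -> (n.+1 < n0)%N -> (forall s, 0 <= f s) ->
  0 <= t <= pi / 2 -> nu t f <= expR (Lcst n) * nu (pi / 2) f.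
Proof.
move=> df nn0 f0 tp.
apply: (@gronwall_interp R (fun t => nu t f) (fun t => nu t (fun s => f s * Lg n s)) (Lcst n)) => //.
- by move=> t'; exact: is_derive_nu.
- by move=> t'; exact: nu_ge0.
- exact: Lcst_ge0.
move=> t' _; apply: (le_trans (nu_norm_le _ _ _ _ _ _ _)); rewrite -nuZ; apply: nu_le => s.
by rewrite normrM (ger0_norm (f0 s)) mulrC ler_wpM2r// Lgen_bound.
Qed.

Lemma nu_interp1 n f S t : first_dep n f -> (n.+1 < n0)%N ->
  (forall t, 0 <= t <= pi / 2 -> `|nu t (fun s => f s * Lg n s)| <= S) ->
  0 <= t <= pi / 2 -> `|nu t f - nu 0 f| <= S.
Proof.
move=> df nn0 HS tp.
apply: (@interp_ineq R (fun t => nu t f) _ S _ HS t tp) => t'; exact: is_derive_nu.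
Qed.

Lemma nu_interp2 n f S : first_dep n f -> (n.+3 < n0)%N ->
  (forall t, 0 <= t <= pi / 2 -> `|nu t (fun s => f s * Lg n s * Lg n.+2 s)| <= S) ->
  `|nu (pi / 2) f - nu 0 f - nu 0 (fun s => f s * Lg n s)| <= S.
Proof.
move=> df nn0 HS.
apply: (@interp_ineq2 R (fun t => nu t f) (fun t => nu t (fun s => f s * Lg n s)) _ S _ _ HS) => t.
  by apply: is_derive_nu => //; exact: ltnW (ltnW nn0).
by apply: is_derive_nu => //; exact: first_dep_mulL.
Qed.

End UniformBounds.

(** * Elementary inequalities between powers *)

Section PowerInequalities.
Variable R : realType.
Implicit Types x y : R.

Lemma mul_pow_le_sum x y k : `|x| * `|y| ^+ k <= `|x| ^+ k.+1 + `|y| ^+ k.+1.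
Proof.
have [xy|xy] := lerP `|x| `|y|.
  rewrite -[leLHS]add0r lerD ?exprn_ge0//.
  by rewrite exprS ler_wpM2r ?exprn_ge0.
rewrite -[leLHS]addr0 lerD ?exprn_ge0//.
by rewrite exprS ler_wpM2l// lerX// ltW.
Qed.

Lemma pow_diff_le x y k :
  `|x ^+ k.+1 - y ^+ k.+1| <= k.+1%:R * (`|x - y| * (`|x| ^+ k + `|y| ^+ k)).
Proof.
rewrite subrXX normrM [leRHS]mulrCA ler_wpM2l//.
apply: (le_trans (ler_norm_sum _ _ _)).
rewrite mulr_natl -[X in _ *+ X](card_ord k.+1) -sumr_const; apply: ler_sum => i _.
have ik : (i <= k)%N by rewrite -ltnS.
rewrite normrM !normrX /=; have [xy|xy] := lerP `|x| `|y|.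
  rewrite -[leLHS]add0r lerD ?exprn_ge0//.
  rewrite -[in leRHS](subnK ik) exprD ler_wpM2r ?exprn_ge0// lerX//.
rewrite -[leLHS]addr0 lerD ?exprn_ge0//.
by rewrite -[in leRHS](subnK ik) exprD ler_wpM2l ?exprn_ge0// lerX// ltW.
Qed.

(** The factor of [|x| ^+ k] is 2 for every [k], instead of one growing with [k]; this keeps the
    smallness condition on beta independent of the order of the moment. Take [d] with
    [(1 + d) ^+ k <= 2]: if [|y| <= d |x|] the first term suffices, otherwise [|x| < |y| / d] and
    the second does. *)
Lemma pow_add_le k : exists2 C : R, 0 <= C &
  forall x y, `|x + y| ^+ k <= 2 * `|x| ^+ k + C * `|y| ^+ k.
Proof.
have [d d0 Hd] : exists2 d : R, 0 < d & (1 + d) ^+ k <= 2.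
  elim: k => [|k [d d0 Hd]]; first by exists 1 => //; rewrite expr0; lra.
  exists (Num.min d (1 / (2 ^+ k.+1))).
    by rewrite lt_min d0 divr_gt0// exprn_gt0.
  set e := Num.min _ _.
  have e0 : 0 <= e by rewrite le_min (ltW d0) divr_ge0// exprn_ge0.
  have e1 : e <= 1.
    by rewrite ge_min; apply/orP; right; rewrite ler_pdivrMr ?exprn_gt0// mul1r exprn_ege1// ler1n.
  (* The chord bound for the convex function [(1 + e) ^+ j] of [e] in [[0, 1]]. *)
  have eb : forall j, (1 + e) ^+ j <= 1 + e * (2 ^+ j - 1).
    elim=> [|j IH]; first by rewrite !expr0 subrr mulr0 addr0.
    rewrite exprSr; apply: (le_trans (ler_wpM2r _ IH)); first by lra.
    rewrite exprS; have : 1 <= 2 ^+ j :> R by rewrite exprn_ege1// ler1n.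
    move: (2 ^+ j) => w w1; rewrite -subr_ge0.
    have -> : 1 + e * (2 * w - 1) - (1 + e * (w - 1)) * (1 + e) = e * (1 - e) * (w - 1) by ring.
    by rewrite !mulr_ge0// subr_ge0.
  apply: (le_trans (eb _)).
  have : e * 2 ^+ k.+1 <= 1.
    by rewrite -ler_pdivlMr ?exprn_gt0//; rewrite ge_min lexx orbT.
  move: (2 ^+ k.+1) => w; rewrite mulrBr mulr1; lra.
exists ((1 + d^-1) ^+ k); first by rewrite exprn_ge0// addr_ge0// invr_ge0 ltW.
move=> x y; apply: (@le_trans _ _ ((`|x| + `|y|) ^+ k)); first by rewrite lerX// ler_normD.
have [xy|xy] := lerP `|y| (d * `|x|).
  rewrite -[leLHS]addr0 lerD//; last first.
    by rewrite mulr_ge0// exprn_ge0// addr_ge0// invr_ge0 ltW.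
  apply: (@le_trans _ _ (((1 + d) * `|x|) ^+ k)).
    by rewrite lerX ?addr_ge0// mulrDl mul1r lerD2l.
  by rewrite exprMn ler_wpM2r// exprn_ge0.
rewrite -[leLHS]add0r lerD ?mulr_ge0 ?exprn_ge0//.
rewrite -exprMn lerX ?addr_ge0// mulrDl mul1r addrC lerD2l.
by rewrite mulrC ler_pdivlMr// mulrC ltW.
Qed.

End PowerInequalities.

(** * Cavity moments of the last spin *)

Section Factorization.
Variables (R : realType) (Sc N' : nat) (beta h D p q : R) (n0 : nat).
Notation N := N'.+1.
Notation O := (config Sc N).
Notation T := {ffun 'I_n0 -> O}.
Notation sp := (@spin R Sc).
Implicit Types (o : O) (s : T) (u v l : 'I_n0) (f : T -> R) (t : R).
Notation eps := (@eps R Sc N').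
Notation nu := (@nu R Sc N' beta h D p q n0).
Notation Um := (@Um R Sc N' p q n0).
Notation U := (@U R Sc N' p q n0).
Notation mom := (mom Sc beta h D p q).

Definition eps_prod (us : seq 'I_n0) s : R := \prod_(u <- us) eps (s u).
(* us lists replicas with multiplicity, the multiplicity being the power of the spin. *)
Definition mE (us : seq 'I_n0) : R := etaE (fun z => \prod_(l <- undup us) mom (count_mem l us) z).

(** Being linear in [f], the property passes from monomials in the last spins to the centred
    products of the expansion. *)
Definition decouples f (c : R) := forall W, nolast W -> nu 0 (fun s => f s * W s) = c * nu 0 W.

Lemma mom0 z : mom 0 z = 1.
Proof.
rewrite /Defs.mom /site_avg.
under eq_bigr do rewrite expr0 mul1r.
rewrite divff// gt_eqF// /site_w.
exact: (partition_gt0 (Ordinal (spin_dim_gt0 Sc))).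
Qed.

Lemma decouples_eps_prod us : decouples (eps_prod us) (mE us).
Proof.
move=> W nW; have := nu0_factor beta h D p q (fun l => count_mem l us) nW.
have -> : etaE (mono_eta Sc beta h D p q (fun l : 'I_n0 => count_mem l us)) = mE us.
  congr etaE; apply/funext => z; rewrite /mono_eta (bigID (fun l => l \in undup us))/=.
  rewrite [X in _ * X]big1 ?mulr1 => [|l]; last first.
    by rewrite mem_undup => /count_memPn ->; rewrite mom0.
  by rewrite -big_uniq ?undup_uniq.
move=> <-; apply: eq_nu => s; congr (_ * _); rewrite /mono /eps_prod.
elim: us => [|u us IH]; first by rewrite big_nil big1// => l _; rewrite expr0.
rewrite big_cons IH (bigD1 u)//= [RHS](bigD1 u)//= eqxx exprS -!mulrA; congr (_ * _).
congr (_ * _); apply: eq_bigr => l lu.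
by rewrite eq_sym (negbTE lu).
Qed.

Lemma decouplesB f f' c c' : decouples f c -> decouples f' c' -> decouples (fun s => f s - f' s) (c - c').
Proof.
move=> F F' W nW; rewrite mulrBl -F// -F'// -nuB; apply: eq_nu => s.
by rewrite mulrBl.
Qed.

Lemma decouplesZ f c x : decouples f c -> decouples (fun s => x * f s) (x * c).
Proof.
by move=> F W nW; rewrite -mulrA -F// -nuZ; apply: eq_nu => s; rewrite mulrA.
Qed.

Lemma decouples_eq f f' c : f =1 f' -> decouples f c -> decouples f' c.
Proof. by move=> /funext ->. Qed.

Hypothesis fix_pt : fixed_point Sc beta h D p q.

Lemma mE_nil : mE [::] = 1.
Proof.
rewrite /mE /=; rewrite (_ : (fun z => _) = fun=> 1); first exact: gint1.
by apply/funext => z; rewrite big_nil.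
Qed.

(** The fixed-point equations for [p] and [q] enter here. They centre [epsc], so that the
    zeroth-order term of every expansion vanishes. *)
Lemma mE2 u v : mE [:: u; v] = Qv p q u v.
Proof.
have [q0 [qE pE]] := fix_pt; rewrite /mE /Qv /= inE; case: eqP => [->|/eqP uv].
  rewrite [RHS]pE; congr etaE; apply/funext => z.
  by rewrite big_seq1 /= !eqxx.
rewrite [RHS]qE; congr etaE; apply/funext => z.
by rewrite !big_cons big_nil /= !eqxx (negbTE uv) eq_sym (negbTE uv) mulr1 expr2.
Qed.

Definition epsc u v s : R := eps (s u) * eps (s v) - Qv p q u v.

Lemma eps_prod2 u v s : eps_prod [:: u; v] s = eps (s u) * eps (s v).
Proof. by rewrite /eps_prod !big_cons big_nil mulr1. Qed.

Lemma decouples_epsc u v : decouples (epsc u v) 0.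
Proof.
rewrite -[0](subrr (Qv p q u v)) -{1}mE2.
have := decouplesB (decouples_eps_prod [:: u; v]) (decouplesZ (Qv p q u v) (decouples_eps_prod [::])).
rewrite mE_nil mulr1; apply: decouples_eq => s; rewrite /epsc eps_prod2.
by rewrite /eps_prod big_nil mulr1.
Qed.

Lemma nolast_Um u v : nolast (Um u v).
Proof.
move=> s s'; rewrite /Submission.Um /Rm; congr (_ * _ - _); apply: eq_bigr => i im.
by rewrite !ffunE (negbTE im).
Qed.

Lemma nolastM f f' : nolast f -> nolast f' -> nolast (fun s => f s * f' s).
Proof. by move=> nf nf' s s'; rewrite nf nf'. Qed.

Lemma nolastX f k : nolast f -> nolast (fun s => f s ^+ k).
Proof. by move=> nf s s'; rewrite nf. Qed.

Lemma swapsE i s u j : swaps i s u j = s u (tperm i ord_max j).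
Proof. by rewrite !ffunE. Qed.

Lemma U_swaps i u v s : U u v (swaps i s) = U u v s.
Proof.
rewrite /Submission.U /Rfull; congr (_ * _ - _).
rewrite [RHS](reindex_inj (@perm_inj _ (tperm i ord_max))).
by apply: eq_bigr => j _; rewrite !ffunE.
Qed.

(* By exchangeability of the sites, U is an average over sites of copies of epsc. *)
Lemma nu_site_cavity u v W : (forall i s, W (swaps i s) = W s) ->
  nu (pi / 2) (fun s => U u v s * W s) = nu (pi / 2) (fun s => epsc u v s * W s).
Proof.
move=> sW; have N0 : N%:R != 0 :> R by rewrite pnatr_eq0.
transitivity (N%:R^-1 * \sum_(i < N) nu (pi / 2) (fun s => epsc u v s * W s)); last first.
  by rewrite sumr_const card_ord mulrnAr -mulr_natl mulrA mulfV// mul1r.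
transitivity (N%:R^-1 * \sum_(i < N) nu (pi / 2) (fun s => (sp (s u i) * sp (s v i) - Qv p q u v) * W s)).
  rewrite -nu_sum -nuZ; apply: eq_nu => s; rewrite -mulr_suml mulrA; congr (_ * _).
  rewrite sumrB sumr_const card_ord /Submission.U /Rfull mulrBr -[X in _ - _ * X]mulr_natl mulKf//.
apply: (congr1 (fun x => N%:R^-1 * x)); apply: eq_bigr => i _.
rewrite -(nu_site_swap _ _ _ _ _ i (fun s => (sp (s u i) * sp (s v i) - Qv p q u v) * W s)).
by apply: eq_nu => s; rewrite sW !swapsE tpermL.
Qed.

End Factorization.

Opaque nu.

(** * One induction step for the moments of a single deviation *)

Section MomentStep.
Variables (R : realType) (Sc N' : nat) (beta h D p q : R) (n0 : nat).
Notation N := N'.+1.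
Notation O := (config Sc N).
Notation T := {ffun 'I_n0 -> O}.
Notation sp := (@spin R Sc).
Implicit Types (o : O) (s : T) (u v l : 'I_n0) (f : T -> R) (t : R).
Notation eps := (@eps R Sc N').
Notation nu := (@nu R Sc N' beta h D p q n0).
Notation Um := (@Um R Sc N' p q n0).
Notation U := (@U R Sc N' p q n0).
Notation B := (Sc%:R ^+ 2 : R).
Notation Lg := (@Lgen R Sc N' beta p q n0).
Notation epsc := (@epsc R Sc N' p q n0).

Hypothesis fix_pt : fixed_point Sc beta h D p q.
Hypothesis qB : q <= B.
Hypothesis pB : `|p| <= B.
Hypothesis n3 : (3 < n0)%N.

Let q0 : 0 <= q. Proof. by case: fix_pt. Qed.

Definition rep_0 : 'I_n0 := Ordinal (ltn_trans (isT : (0 < 3)%N) n3).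
Definition rep_1 : 'I_n0 := Ordinal (ltn_trans (isT : (1 < 3)%N) n3).

Lemma U_permrep (pi : {perm 'I_n0}) u v s : U u v (permrep pi s) = U (pi u) (pi v) s.
Proof. by rewrite /Submission.U /Rfull /Qv (inj_eq perm_inj) !ffunE. Qed.

Lemma Um_permrep (pi : {perm 'I_n0}) u v s : Um u v (permrep pi s) = Um (pi u) (pi v) s.
Proof. by rewrite /Submission.Um /Rm /Qv (inj_eq perm_inj) !ffunE. Qed.

Lemma two_transitive u v x y : u != v -> x != y ->
  exists pi : {perm 'I_n0}, pi x = u /\ pi y = v.
Proof.
move=> uv xy; pose y' := tperm x u y.
have y'u : y' != u by rewrite -[X in _ != X](tpermL x u) (inj_eq perm_inj) eq_sym.
exists (tperm x u * tperm y' v)%g; rewrite !permM tpermL -/y' tpermL tpermD//.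
by rewrite eq_sym.
Qed.

(** Up to a permutation of the replicas there are two kinds of pairs, so this sum dominates the
    moment of every pair. *)
Definition pairs_moment (V : 'I_n0 -> 'I_n0 -> T -> R) t k : R :=
  nu t (fun s => `|V rep_0 rep_1 s| ^+ k) + nu t (fun s => `|V rep_0 rep_0 s| ^+ k).

Lemma pairs_moment_le (V : 'I_n0 -> 'I_n0 -> T -> R) t k u v :
  (forall pi u v s, V u v (permrep pi s) = V (pi u) (pi v) s) ->
  nu t (fun s => `|V u v s| ^+ k) <= pairs_moment V t k.
Proof.
move=> VP; have pos x y : 0 <= nu t (fun s => `|V x y s| ^+ k).
  by apply: nu_ge0 => s; rewrite exprn_ge0.
rewrite /pairs_moment; have [<-|uv] := eqVneq u v.
  apply: ler_wpDl; first exact: pos.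
  rewrite -(nu_perm beta h D p q t (fun s => `|V u u s| ^+ k) (tperm u rep_0)).
  by apply: nu_le => s; rewrite VP tpermL.
apply: ler_wpDr; first exact: pos.
have x01 : rep_0 != rep_1 by [].
have [pi [e0 e1]] := two_transitive x01 uv.
rewrite -(nu_perm beta h D p q t (fun s => `|V u v s| ^+ k) pi).
by apply: nu_le => s; rewrite VP e0 e1.
Qed.

Lemma epsc_bound u v s : `|epsc u v s| <= 2 * B.
Proof.
rewrite mulr_natl mulr2n; apply: (le_trans (ler_normB _ _)); apply: lerD.
  exact: eps2_bound.
exact: Qv_bound.
Qed.

Lemma U_sub_Um u v s : `|U u v s - Um u v s| <= B / N%:R.
Proof.
have -> : U u v s - Um u v s = eps (s u) * eps (s v) * N%:R^-1 by rewrite U_Um; ring.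
rewrite normrM [X in _ * X]ger0_norm ?invr_ge0// ler_wpM2r ?invr_ge0//.
exact: eps2_bound.
Qed.

Lemma first_dep_Um2 (u v : 'I_n0) k : (u < 2)%N -> (v < 2)%N ->
  first_dep 2 (fun s => `|Um u v s| ^+ k).
Proof.
move=> u2 v2 s s' ss'; congr (`|_| ^+ _); rewrite /Submission.Um /Rm.
by rewrite !ss'.
Qed.

Lemma pairs_moment_Um t k : 0 <= t <= pi / 2 ->
  pairs_moment Um t k <= expR (Lcst Sc beta 2) * pairs_moment Um (pi / 2) k.
Proof.
move=> tp; rewrite /pairs_moment mulrDr.
by apply: lerD; apply: nu_gronwall => //; try exact: first_dep_Um2; move=> s; rewrite exprn_ge0.
Qed.

Lemma nu_Um_le k (C : R) : (forall x y : R, `|x + y| ^+ k <= 2 * `|x| ^+ k + C * `|y| ^+ k) ->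
  0 <= C -> forall u v t,
  nu t (fun s => `|Um u v s| ^+ k) <= 2 * nu t (fun s => `|U u v s| ^+ k) + C * (B / N%:R) ^+ k.
Proof.
move=> HC C0 u v t; rewrite -(@nu_cst R Sc N' beta h D p q n0 t (C * _)) -nuZ -nuD; apply: nu_le => s.
have := HC (U u v s) (Um u v s - U u v s); rewrite addrC subrK => /le_trans; apply.
by rewrite lerD2l ler_wpM2l// lerX// distrC U_sub_Um.
Qed.

(** [mul_pow_le_sum] separates the overlaps of different pairs of replicas. The constant is
    [beta^2 / 2] times the weights 4 and 6, the bounds [2 B] of [epsc] and [B] of [eps eps], and 2
    for the two separated powers. *)
Lemma nu_cavity_pow t k u v : 0 <= t <= pi / 2 ->
  `|nu t (fun s => epsc u v s * Um u v s ^+ k * Lg 2 s)| <=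
    beta ^+ 2 * (B * B) * 48 * pairs_moment Um t k.+1.
Proof.
move=> tp.
pose X s (x y : 'I_n0) := epsc u v s * Um u v s ^+ k * (eps (s x) * eps (s y) * Um x y s).
have E : nu t (fun s => epsc u v s * Um u v s ^+ k * Lg 2 s) =
  beta ^+ 2 / 2 * \sum_x \sum_y rwt R 2 x * rwt R 3 y * nu t (fun s => X s x y).
  under [in RHS]eq_bigr do under eq_bigr do rewrite -nuZ.
  under [in RHS]eq_bigr do rewrite -nu_sum.
  rewrite -nu_sum -nuZ; apply: eq_nu => s; rewrite /Lgen mulrCA; congr (_ * _).
  rewrite mulr_sumr; apply: eq_bigr => x _; rewrite mulr_sumr; apply: eq_bigr => y _.
  by rewrite /X; ring.
rewrite E normrM ger0_norm ?divr_ge0 ?sqr_ge0//.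
have XB x y : `|nu t (fun s => X s x y)| <= 2 * B * B * (2 * pairs_moment Um t k.+1).
  apply: (le_trans (nu_norm_le _ _ _ _ _ _ _)).
  apply: (@le_trans _ _ (nu t (fun s => 2 * B * B * (`|Um x y s| ^+ k.+1 + `|Um u v s| ^+ k.+1)))).
    apply: nu_le => s; rewrite /X !normrM normrX.
    have -> : `|epsc u v s| * `|Um u v s| ^+ k * (`|eps (s x)| * `|eps (s y)| * `|Um x y s|) =
      (`|epsc u v s| * (`|eps (s x) * eps (s y)|)) * (`|Um x y s| * `|Um u v s| ^+ k).
      by rewrite normrM; ring.
    apply: ler_pM; rewrite ?mulr_ge0 ?exprn_ge0// ?mul_pow_le_sum//.
    by apply: ler_pM => //; [exact: epsc_bound|exact: eps2_bound].
  rewrite nuZ nuD ler_wpM2l ?mulr_ge0 ?sqr_ge0// mulr_natl mulr2n.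
  by apply: lerD; apply: pairs_moment_le; exact: Um_permrep.
have := sum_rwt2_bound (n := 2) n3 XB.
move=> /(ler_wpM2l (_ : 0 <= beta ^+ 2 / 2)) H.
apply: (le_trans (H _)); first by rewrite divr_ge0 ?sqr_ge0.
by rewrite le_eqVlt; apply/orP; left; apply/eqP; field.
Qed.

Lemma first_dep_cavity2 (u v : 'I_n0) k : (u < 2)%N -> (v < 2)%N ->
  first_dep 2 (fun s => epsc u v s * Um u v s ^+ k).
Proof. by move=> u2 v2 s s' ss'; rewrite /Submission.epsc /Submission.Um /Rm !ss'. Qed.

(** The constant of [nu_cavity_pow] times the Gronwall factor for two replicas; it tends to 0 with
    beta and is the same for all moment orders. *)
Definition kappa : R := beta ^+ 2 * (B * B) * 48 * expR (Lcst Sc beta 2).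

Lemma even_norm (x : R) m : x ^+ m.*2 = `|x| ^+ m.*2.
Proof. by rewrite -mul2n !exprM real_normK ?num_real. Qed.

(** One of the [2m + 2] factors [U] becomes [epsc] by exchangeability. Replacing the other [2m + 1]
    by [Um] costs [B / N] times a moment of order [2m]. What is left vanishes at [t = 0], and its
    derivative brings back moments of order [2m + 2] with the factor [kappa]. *)
Lemma moment_one_edge m (C1 C2 : R) (u v : 'I_n0) : (u < 2)%N -> (v < 2)%N ->
  0 <= C1 -> 0 <= C2 ->
  (forall x y : R, `|x + y| ^+ m.+1.*2 <= 2 * `|x| ^+ m.+1.*2 + C1 * `|y| ^+ m.+1.*2) ->
  (forall x y : R, `|x + y| ^+ m.*2 <= 2 * `|x| ^+ m.*2 + C2 * `|y| ^+ m.*2) ->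
  nu (pi / 2) (fun s => `|U u v s| ^+ m.+1.*2) <=
  kappa * (2 * pairs_moment U (pi / 2) m.+1.*2 + 2 * (C1 * (B / N%:R) ^+ m.+1.*2)) +
  2 * B * (m.*2.+1%:R * (B / N%:R)) *
    (3 * pairs_moment U (pi / 2) m.*2 + C2 * (B / N%:R) ^+ m.*2).
Proof.
have alg (x P c : R) : x <= P -> x + (2 * x + c) <= 3 * P + c by lra.
move=> u2 v2 C10 C20 HC1 HC2; have p0 := pi_gt0 R.
have pp : 0 <= (pi / 2 : R) <= pi / 2 by rewrite lexx andbT; lra.
have -> : nu (pi / 2) (fun s => `|U u v s| ^+ m.+1.*2) =
  nu (pi / 2) (fun s => epsc u v s * Um u v s ^+ m.*2.+1) +
  nu (pi / 2) (fun s => epsc u v s * (U u v s ^+ m.*2.+1 - Um u v s ^+ m.*2.+1)).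
  rewrite -nuD; transitivity (nu (pi / 2) (fun s => epsc u v s * U u v s ^+ m.*2.+1)).
    rewrite -nu_site_cavity; last by move=> i s; rewrite U_swaps.
    by apply: eq_nu => s; rewrite -even_norm doubleS exprS.
  by apply: eq_nu => s; ring.
apply: lerD.
  apply: (le_trans (ler_norm _)).
  have z0 : nu 0 (fun s => epsc u v s * Um u v s ^+ m.*2.+1) = 0.
    have F := @decouples_epsc R Sc N' beta h D p q n0 fix_pt u v.
    by rewrite (F (fun s => Um u v s ^+ m.*2.+1)) ?mul0r//; apply: nolastX; exact: nolast_Um.
  suff HS t : 0 <= t <= pi / 2 -> `|nu t (fun s => epsc u v s * Um u v s ^+ m.*2.+1 * Lg 2 s)| <=
      kappa * (2 * pairs_moment U (pi / 2) m.+1.*2 + 2 * (C1 * (B / N%:R) ^+ m.+1.*2)).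
    have := nu_interp1 q0 (first_dep_cavity2 m.*2.+1 u2 v2) n3 HS pp.
    by rewrite z0 subr0.
  move=> tp; apply: (le_trans (nu_cavity_pow _ _ _ tp)); rewrite /kappa -[leRHS]mulrA.
  rewrite ler_wpM2l//.
    by apply: mulr_ge0 => //; apply: mulr_ge0; [exact: sqr_ge0|apply: mulr_ge0; exact: sqr_ge0].
  apply: (le_trans (pairs_moment_Um _ tp)); rewrite ler_wpM2l ?expR_ge0//.
  rewrite -doubleS.
  have a1 := nu_Um_le HC1 C10 rep_0 rep_1 (pi / 2).
  have a2 := nu_Um_le HC1 C10 rep_0 rep_0 (pi / 2).
  apply: (le_trans (lerD a1 a2)).
  have alg2 (x y c : R) : 2 * x + c + (2 * y + c) = 2 * (x + y) + 2 * c by ring.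
  by rewrite alg2.
apply: (le_trans (ler_norm _)); apply: (le_trans (nu_norm_le _ _ _ _ _ _ _)).
apply: (@le_trans _ _ (nu (pi / 2) (fun s => 2 * B * (m.*2.+1%:R * (B / N%:R)) *
   (`|U u v s| ^+ m.*2 + `|Um u v s| ^+ m.*2)))).
  apply: nu_le => s; rewrite normrM -mulrA; apply: ler_pM => //; first exact: epsc_bound.
  apply: (le_trans (pow_diff_le _ _ _)); rewrite -[leRHS]mulrA ler_wpM2l//.
  by apply: ler_wpM2r; [rewrite addr_ge0// exprn_ge0|exact: U_sub_Um].
have c0 : 0 <= 2 * B * (m.*2.+1%:R * (B / N%:R)).
  by apply: mulr_ge0; [rewrite mulr_ge0// sqr_ge0|rewrite mulr_ge0// divr_ge0// sqr_ge0].
rewrite nuZ ler_wpM2l// nuD.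
have a1 := nu_Um_le HC2 C20 u v (pi / 2).
have a2 := pairs_moment_le (pi / 2) m.*2 u v U_permrep.
exact: le_trans (lerD (lexx _) a1) (alg _ _ _ a2).
Qed.

End MomentStep.

(** * The cavity identity *)

Lemma double_expn i j k : ((i + j) * k + (i + j) * k = 2 * j * k + i * (2 * k))%N /\
  ((i + j) * k + (i + j) * k = 2 * i * k + j * (2 * k))%N.
Proof. by split; lia. Qed.

(** * Orders of magnitude in powers of [rho = N^(-1/2)] *)

Section Orders.
Variables (R : realType) (Sc : nat) (beta h D p q : R) (n0 : nat).
Notation T N' := {ffun 'I_n0 -> config Sc N'.+1}.
Notation nu N' := (@nu R Sc N' beta h D p q n0).
Notation Um N' := (@Um R Sc N' p q n0).
Notation U N' := (@U R Sc N' p q n0).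
Notation B := (Sc%:R ^+ 2 : R).
Notation Lg N' := (@Lgen R Sc N' beta p q n0).

Hypothesis fix_pt : fixed_point Sc beta h D p q.
Hypothesis qB : q <= B.
Hypothesis pB : `|p| <= B.
Hypothesis n3 : (3 < n0)%N.
Hypothesis small : 4 * kappa Sc beta <= 1 / 2.

Let q0 : 0 <= q. Proof. by case: fix_pt. Qed.

Notation PM N' V k := (@pairs_moment R Sc N' beta h D p q n0 n3 V (pi / 2) k).

Lemma absorb_half (a k c : R) : a <= k * a + c -> k <= 1 / 2 -> 0 <= a -> a <= 2 * c.
Proof. by move=> H k2 a0; have : k * a <= 1 / 2 * a by [rewrite ler_wpM2r|]; lra. Qed.

(* At small beta the leading term of moment_one_edge is absorbed in the left-hand side. *)
Lemma moment_bound m : exists2 C, 0 <= C &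
  forall N', PM N' (U N') m.*2 <= C * (N'.+1%:R^-1) ^+ m.
Proof.
elim: m => [|m [C C0 IH]].
  exists 2 => // N'; rewrite /pairs_moment expr0 mulr1.
  have E (V : T N' -> R) : nu N' (pi / 2) (fun s => `|V s| ^+ 0) = 1.
    by rewrite -[RHS](@nu_cst R Sc N' beta h D p q n0 (pi / 2)); apply: eq_nu => s; rewrite expr0.
  by rewrite !E.
have [C1 C10 HC1] := @pow_add_le R m.+1.*2.
have [C2 C20 HC2] := @pow_add_le R m.*2.
have k0 : 0 <= kappa Sc beta.
  rewrite /kappa; apply: mulr_ge0; last exact: expR_ge0.
  by apply: mulr_ge0 => //; apply: mulr_ge0; [exact: sqr_ge0|apply: mulr_ge0; exact: sqr_ge0].
have B0 : 0 <= B by exact: sqr_ge0.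
(* The outer 2 counts the two kinds of pairs. The two summands collect the remainders of order
   [N^-(2m+2)] and [N^-1 N^-m], both at most [N^-(m+1)]. *)
pose D1 := 2 * (kappa Sc beta * (2 * (C1 * B ^+ m.+1.*2)) +
   2 * B * (m.*2.+1%:R * B) * (3 * C + C2 * B ^+ m.*2)).
have D10 : 0 <= D1.
  have a1 : 0 <= C1 * B ^+ m.+1.*2 by rewrite mulr_ge0// exprn_ge0.
  have a2 : 0 <= C2 * B ^+ m.*2 by rewrite mulr_ge0// exprn_ge0.
  have a3 : 0 <= 3 * C + C2 * B ^+ m.*2 by rewrite addr_ge0// mulr_ge0.
  have a4 : 0 <= 2 * B * (m.*2.+1%:R * B) by rewrite mulr_ge0// mulr_ge0.
  rewrite /D1; apply: mulr_ge0 => //; apply: addr_ge0; apply: mulr_ge0 => //.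
  exact: mulr_ge0.
exists (2 * D1) => [|N']; first exact: mulr_ge0.
set x : R := N'.+1%:R^-1.
have x0 : 0 <= x by rewrite invr_ge0.
have x1 : x <= 1 by rewrite invf_le1 ?ltr0n// ler1n.
have xpow i j : (j <= i)%N -> x ^+ i <= x ^+ j by move=> ij; rewrite ler_wiXn2l.
have step (u v : 'I_n0) (u2 : (u < 2)%N) (v2 : (v < 2)%N) :=
  @moment_one_edge R Sc N' beta h D p q n0 fix_pt qB pB n3 m C1 C2 u v u2 v2 C10 C20 HC1 HC2.
have := lerD (step (rep_0 n3) (rep_1 n3) isT isT) (step (rep_0 n3) (rep_0 n3) isT isT).
rewrite -/(pairs_moment beta h D p q n3 (U N') (pi / 2) m.+1.*2) -/x.
have pm0 k : 0 <= PM N' (U N') k.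
  by rewrite /pairs_moment addr_ge0//; apply: nu_ge0 => s; rewrite exprn_ge0.
move: (IH N') (pm0 m.+1.*2) (pm0 m.*2); rewrite -/x.
move: (PM N' (U N') m.+1.*2) (PM N' (U N') m.*2) => a b bC a0 b0 H.
rewrite -mulrA; apply: (@absorb_half a (4 * kappa Sc beta) (D1 * x ^+ m.+1)) => //.
have dbl (y : R) : y + y = 2 * y by ring.
apply: (le_trans H); rewrite dbl.
have h1 : C1 * (B * x) ^+ m.+1.*2 <= C1 * B ^+ m.+1.*2 * x ^+ m.+1.
  rewrite exprMn -mulrA !ler_wpM2l ?exprn_ge0//; apply: xpow.
  by rewrite -addnn leq_addr.
have h2 : x * (3 * b + C2 * (B * x) ^+ m.*2) <= (3 * C + C2 * B ^+ m.*2) * x ^+ m.+1.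
  have -> : (3 * C + C2 * B ^+ m.*2) * x ^+ m.+1 =
    x * (3 * (C * x ^+ m) + C2 * (B ^+ m.*2 * x ^+ m)) by rewrite [x ^+ m.+1]exprS; set y := (_ ^+ m.*2); set w := x ^+ m; ring.
  rewrite ler_wpM2l//; apply: lerD; first by rewrite ler_wpM2l.
  rewrite ler_wpM2l// exprMn ler_wpM2l ?exprn_ge0//; apply: xpow.
  by rewrite -addnn leq_addr.
have h3 : kappa Sc beta * (C1 * (B * x) ^+ m.+1.*2) <= kappa Sc beta * (C1 * B ^+ m.+1.*2 * x ^+ m.+1).
  by rewrite ler_wpM2l.
have h4 : 2 * B * (m.*2.+1%:R * B) * (x * (3 * b + C2 * (B * x) ^+ m.*2)) <=
   2 * B * (m.*2.+1%:R * B) * ((3 * C + C2 * B ^+ m.*2) * x ^+ m.+1).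
  by rewrite ler_wpM2l//; apply: mulr_ge0; apply: mulr_ge0.
rewrite /D1; clear -h3 h4.
move: h3 h4; set X := C1 * (B * x) ^+ m.+1.*2; set Y := 3 * b + _; set W := (3 * C + _).
set k := kappa Sc beta; set z := x ^+ m.+1; set c1 := C1 * B ^+ _; set mm : R := m.*2.+1%:R.
move=> h3 h4.
have -> : 2 * (k * (2 * a + 2 * X) + 2 * B * (mm * (B * x)) * Y) =
  4 * k * a + (4 * (k * X) + 2 * (2 * B * (mm * B) * (x * Y))) by ring.
have -> : 2 * (k * (2 * c1) + 2 * B * (mm * B) * W) * z =
  4 * (k * (c1 * z)) + 2 * (2 * B * (mm * B) * (W * z)) by ring.
by rewrite lerD2l lerD// ler_wpM2l.
Qed.

Definition rho (N' : nat) : R := (Num.sqrt N'.+1%:R)^-1.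

Lemma rho_gt0 N' : 0 < rho N'.
Proof. by rewrite invr_gt0 sqrtr_gt0 ltr0n. Qed.

Lemma rho_ge0 N' : 0 <= rho N'. Proof. exact: ltW (rho_gt0 N'). Qed.

Lemma rho_le1 N' : rho N' <= 1.
Proof.
rewrite invf_le1 ?sqrtr_gt0 ?ltr0n// -[leLHS]sqrtr1 ler_wsqrtr//.
by rewrite ler1n.
Qed.

Lemma rho2 N' : rho N' ^+ 2 = N'.+1%:R^-1.
Proof. by rewrite exprVn sqr_sqrtr. Qed.

(** Sequences are indexed by [N' = N - 1], so that [N] is positive by construction. *)
Definition rhoO (j : nat) (a : nat -> R) := exists2 C, 0 <= C & forall N', `|a N'| <= C * rho N' ^+ j.

Lemma rhoO_eq j a b : a =1 b -> rhoO j a -> rhoO j b.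
Proof. by move=> ab [C C0 H]; exists C => // N'; rewrite -ab. Qed.

Lemma rhoO_add j a b : rhoO j a -> rhoO j b -> rhoO j (fun N' => a N' + b N').
Proof.
move=> [C C0 H] [C' C0' H']; exists (C + C') => [|N']; first exact: addr_ge0.
by rewrite mulrDl (le_trans (ler_normD _ _))// lerD.
Qed.

Lemma rhoO_scale j c a : rhoO j a -> rhoO j (fun N' => c * a N').
Proof.
move=> [C C0 H]; exists (`|c| * C) => [|N']; first exact: mulr_ge0.
by rewrite normrM -mulrA ler_wpM2l.
Qed.

Lemma rhoO_sub j a b : rhoO j a -> rhoO j b -> rhoO j (fun N' => a N' - b N').
Proof.
move=> Ha Hb; apply: (rhoO_eq _ (rhoO_add Ha (rhoO_scale (-1) Hb))) => N'.
by rewrite mulN1r.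
Qed.

Lemma rhoO_mul i j a b : rhoO i a -> rhoO j b -> rhoO (i + j) (fun N' => a N' * b N').
Proof.
move=> [C C0 H] [C' C0' H']; exists (C * C') => [|N']; first exact: mulr_ge0.
rewrite normrM exprD; apply: (le_trans (ler_pM _ _ (H N') (H' N'))) => //.
by rewrite mulrACA.
Qed.

Lemma rhoO_sum j (I : Type) (r : seq I) (P : pred I) (F : I -> nat -> R) :
  (forall i, P i -> rhoO j (F i)) -> rhoO j (fun N' => \sum_(i <- r | P i) F i N').
Proof.
move=> HF; elim: r => [|i r IH].
  by exists 0 => // N'; rewrite big_nil normr0 mul0r.
case Pi: (P i); last by apply: rhoO_eq IH => N'; rewrite big_cons Pi.
by apply: (rhoO_eq _ (rhoO_add (HF i Pi) IH)) => N'; rewrite big_cons Pi.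
Qed.

Lemma rhoO_invN : rhoO 2 (fun N' => N'.+1%:R^-1).
Proof. by exists 1 => // N'; rewrite mul1r rho2 ger0_norm// invr_ge0. Qed.

(* X is of order rho ^ j in all moments of the original system. *)
Definition Ord (j : nat) (X : forall N', T N' -> R) := forall k, exists2 C, 0 <= C &
  forall N', nu N' (pi / 2) (fun s => `|X N' s| ^+ k) <= C * rho N' ^+ (j * k).

Lemma Ord_eq j X Y : (forall N', X N' =1 Y N') -> Ord j X -> Ord j Y.
Proof.
move=> XY HX k; have [C C0 H] := HX k; exists C; first exact: C0.
move=> N'; apply: le_trans (H N'); apply: nu_le => s; rewrite XY; exact: lexx.
Qed.

Lemma Ord_weak i j X : (i <= j)%N -> Ord j X -> Ord i X.
Proof.
move=> ij HX k; have [C C0 H] := HX k; exists C => // N'; apply: (le_trans (H N')).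
by rewrite ler_wpM2l// ler_wiXn2l ?rho_ge0 ?rho_le1// leq_mul2r ij orbT.
Qed.

Lemma Ord_bounded X (A : R) : (forall N' s, `|X N' s| <= A) -> Ord 0 X.
Proof.
move=> HX k; exists (`|A| ^+ k) => [|N']; first by rewrite exprn_ge0.
rewrite mul0n expr0 mulr1 -[leRHS](@nu_cst R Sc N' beta h D p q n0 (pi / 2)).
by apply: nu_le => s; rewrite lerX// (le_trans (HX N' s))// ler_norm.
Qed.

Lemma Ord_add j X Y : Ord j X -> Ord j Y -> Ord j (fun N' s => X N' s + Y N' s).
Proof.
move=> HX HY k; have [C C0 H] := HX k; have [C' C0' H'] := HY k.
have [c c0 Hc] := @pow_add_le R k.
exists (2 * C + c * C') => [|N']; first by rewrite addr_ge0 ?mulr_ge0.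
apply: (@le_trans _ _ (nu N' (pi / 2) (fun s => 2 * `|X N' s| ^+ k + c * `|Y N' s| ^+ k))).
  by apply: nu_le => s; exact: Hc.
rewrite nuD !nuZ [leRHS]mulrDl; apply: lerD; rewrite -[leRHS]mulrA; apply: ler_wpM2l.
- exact: ler0n.
- exact: H.
- exact: c0.
- exact: H'.
Qed.

Lemma two_ab_le (a b : R) : 2 * (a * b) <= a ^+ 2 + b ^+ 2.
Proof. by have := sqr_ge0 (a - b); rewrite sqrrB -mulr_natl; lra. Qed.

(** [two_ab_le] with weights [rho^(j k)] and [rho^(i k)] takes the place of the Cauchy-Schwarz
    inequality; since [Ord] asks for all moments, the doubled exponents are available. *)
Lemma Ord_mul i j X Y : Ord i X -> Ord j Y -> Ord (i + j) (fun N' s => X N' s * Y N' s).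
Proof.
move=> HX HY k; have [C C0 H] := HX (2 * k)%N; have [C' C0' H'] := HY (2 * k)%N.
exists (C + C') => [|N']; first exact: addr_ge0.
set r := rho N'; have r0 : 0 < r ^+ ((i + j) * k) by rewrite exprn_gt0// rho_gt0.
have r00 n : 0 <= r ^+ n by rewrite exprn_ge0// rho_ge0.
rewrite -(ler_pM2l r0) -nuZ.
apply: (@le_trans _ _ (nu N' (pi / 2) (fun s =>
   r ^+ (2 * j * k) * `|X N' s| ^+ (2 * k) + r ^+ (2 * i * k) * `|Y N' s| ^+ (2 * k)))).
  apply: nu_le => s.
  have := two_ab_le (r ^+ (j * k) * `|X N' s| ^+ k) (r ^+ (i * k) * `|Y N' s| ^+ k).
  rewrite !exprMn -!exprM ![(_ * 2)%N]mulnC !mulnA; apply: le_trans.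
  have -> : r ^+ (j * k) * `|X N' s| ^+ k * (r ^+ (i * k) * `|Y N' s| ^+ k) =
     r ^+ ((i + j) * k) * `|X N' s * Y N' s| ^+ k.
    by rewrite mulnDl exprD normrM exprMn; ring.
  by rewrite ler_peMl ?ler1n// mulr_ge0// exprn_ge0.
rewrite nuD !nuZ.
have -> : r ^+ ((i + j) * k) * ((C + C') * r ^+ ((i + j) * k)) =
  r ^+ (2 * j * k) * (C * r ^+ (i * (2 * k))) + r ^+ (2 * i * k) * (C' * r ^+ (j * (2 * k))).
  have [e1 e2] := double_expn i j k.
  transitivity (C * r ^+ ((i + j) * k + (i + j) * k) + C' * r ^+ ((i + j) * k + (i + j) * k)).
    by rewrite exprD; ring.
  by rewrite {1}e1 e2 !exprD; ring.
by apply: lerD; apply: ler_wpM2l.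
Qed.

Lemma Ord_sum j (I : Type) (r : seq I) (P : pred I) (F : I -> forall N', T N' -> R) :
  (forall i, Ord j (F i)) -> Ord j (fun N' s => \sum_(i <- r | P i) F i N' s).
Proof.
move=> HF; elim: r => [|i r IH].
  have Z : Ord j (fun N' _ => 0).
    move=> k; exists 1 => // N'; rewrite mul1r.
    case: k => [|k].
      rewrite muln0 expr0 -[leRHS](@nu_cst R Sc N' beta h D p q n0 (pi / 2)).
      by apply: nu_le => s; rewrite expr0.
    apply: (@le_trans _ _ 0); last by rewrite exprn_ge0// rho_ge0.
    rewrite -[leRHS](@nu_cst R Sc N' beta h D p q n0 (pi / 2)).
    by apply: nu_le => s; rewrite normr0 expr0n.
  by apply: Ord_eq Z => N' s; rewrite big_nil.
case Pi: (P i); last by apply: Ord_eq IH => N' s; rewrite big_cons Pi.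
by apply: (Ord_eq _ (Ord_add (HF i) IH)) => N' s; rewrite big_cons Pi.
Qed.

Lemma Ord_scale j c X : Ord j X -> Ord j (fun N' s => c * X N' s).
Proof.
by apply: (@Ord_mul 0 j (fun _ _ => c)); apply: (@Ord_bounded _ `|c|) => N' s; exact: lexx.
Qed.

Lemma Ord_sub j X Y : Ord j X -> Ord j Y -> Ord j (fun N' s => X N' s - Y N' s).
Proof.
move=> HX HY; apply: (Ord_eq _ (Ord_add HX (Ord_scale (-1) HY))) => N' s.
by rewrite mulN1r.
Qed.

Lemma Ord_invN j X : Ord j X -> Ord j.+2 (fun N' s => N'.+1%:R^-1 * X N' s).
Proof.
have I : Ord 2 (fun N' _ => N'.+1%:R^-1).
  move=> k; exists 1 => // N'; rewrite mul1r exprM rho2.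
  rewrite -[leRHS](@nu_cst R Sc N' beta h D p q n0 (pi / 2)).
  by apply: nu_le => s; rewrite ger0_norm// invr_ge0.
exact: Ord_mul I.
Qed.

(** [moment_bound] controls even powers; the others follow by the same weighted inequality, against
    the constant [rho ^+ k]. *)
Lemma Ord_U u v : Ord 1 (fun N' s => U N' u v s).
Proof.
move=> k; have [C C0 H] := moment_bound k.
exists (C + 1) => [|N']; first exact: addr_ge0.
set r := rho N'; have r0 : 0 < r ^+ k by rewrite exprn_gt0// rho_gt0.
rewrite mul1n -(ler_pM2l r0) -nuZ.
apply: (@le_trans _ _ (nu N' (pi / 2) (fun s => `|U N' u v s| ^+ k.*2 + r ^+ k.*2))).
  apply: nu_le => s; have := two_ab_le (r ^+ k) (`|U N' u v s| ^+ k).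
  rewrite -!exprM muln2 addrC; apply: le_trans.
  by rewrite ler_peMl ?ler1n// mulr_ge0 ?exprn_ge0// rho_ge0.
rewrite nuD nu_cst.
have -> : r ^+ k * ((C + 1) * r ^+ k) = C * (N'.+1%:R^-1) ^+ k + r ^+ k.*2.
  by rewrite -rho2 -exprM -/r mul2n -addnn exprD; ring.
apply: lerD => //; apply: le_trans (H N').
by apply: pairs_moment_le; exact: U_permrep.
Qed.

Lemma Ord_eps u v : Ord 0 (fun N' s => @eps R Sc N' (s u) * @eps R Sc N' (s v)).
Proof. by apply: (@Ord_bounded _ B) => N' s; exact: eps2_bound. Qed.

Lemma Ord_Um u v : Ord 1 (fun N' s => Um N' u v s).
Proof.
have H := Ord_sub (Ord_U u v) (Ord_weak (isT : (1 <= 2)%N) (Ord_invN (Ord_eps u v))).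
by apply: Ord_eq H => N' s; rewrite U_Um addrK.
Qed.

(** The generator is linear in [Um], so each derivative along the path gains one power of [rho]. *)
Lemma Ord_Lgen n : Ord 1 (fun N' s => Lg N' n s).
Proof.
apply: Ord_scale; apply: Ord_sum => u; apply: Ord_sum => v.
apply: (@Ord_mul 0 1); last exact: Ord_Um.
by apply: Ord_scale; exact: Ord_eps.
Qed.

Lemma Ord_nu_pihalf j X : Ord j X -> rhoO j (fun N' => nu N' (pi / 2) (X N')).
Proof.
move=> HX; have [C C0 H] := HX 1%N; exists C => // N'.
apply: (le_trans (nu_norm_le _ _ _ _ _ _ _)); have := H N'.
by rewrite muln1; apply: le_trans; apply: nu_le => s; rewrite expr1.
Qed.

(** [nu_gronwall], whose constant does not involve [N], carries the order from [pi / 2] to the whole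
    path. *)
Lemma Ord_nu j n (X : forall N', T N' -> R) : Ord j X -> (forall N', first_dep n (X N')) ->
  (n.+1 < n0)%N -> exists2 C, 0 <= C & forall N' t, 0 <= t <= pi / 2 ->
  `|nu N' t (X N')| <= C * rho N' ^+ j.
Proof.
move=> HX dX nn0; have [C C0 H] := HX 1%N.
exists (expR (Lcst Sc beta n) * C) => [|N' t tp]; first by rewrite mulr_ge0// expR_ge0.
apply: (le_trans (nu_norm_le _ _ _ _ _ _ _)).
have dN : first_dep n (fun s => `|X N' s|) by move=> s s' ss'; rewrite (dX N' s s').
have nn (s : T N') : 0 <= `|X N' s| by exact: normr_ge0.
apply: (le_trans (nu_gronwall beta h D q0 qB pB dN nn0 nn tp)).
rewrite -[leRHS]mulrA; apply: ler_wpM2l; first exact: expR_ge0.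
have := H N'; rewrite muln1; apply: le_trans.
by apply: nu_le => s; rewrite expr1.
Qed.

Lemma Ord_interp1 j n (X : forall N', T N' -> R) : Ord j X -> (forall N', first_dep n (X N')) ->
  (n.+3 < n0)%N -> rhoO j.+1 (fun N' => nu N' (pi / 2) (X N') - nu N' 0 (X N')).
Proof.
move=> HX dX nn0.
have HL : Ord j.+1 (fun N' s => X N' s * Lg N' n s).
  by rewrite -addn1; apply: Ord_mul => //; exact: Ord_Lgen.
have [C C0 H] := Ord_nu HL (fun N' => first_dep_mulL beta p q (dX N')) nn0.
exists C => // N'; apply: (nu_interp1 q0 (dX N') _ (H N')); first exact: ltnW (ltnW nn0).
by have := pi_gt0 R; rewrite lexx andbT; lra.
Qed.

Lemma Ord_interp2 j n (X : forall N', T N' -> R) : Ord j X -> (forall N', first_dep n (X N')) ->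
  (n.+1.+4 < n0)%N -> rhoO j.+2 (fun N' => nu N' (pi / 2) (X N') - nu N' 0 (X N') -
     nu N' 0 (fun s => X N' s * Lg N' n s)).
Proof.
move=> HX dX nn0.
have HL : Ord j.+2 (fun N' s => X N' s * Lg N' n s * Lg N' n.+2 s).
  have -> : j.+2 = (j + 1 + 1)%N by rewrite !addn1.
  by apply: Ord_mul; [apply: Ord_mul => //|]; exact: Ord_Lgen.
have [C C0 H] := Ord_nu HL (fun N' => first_dep_mulL beta p q (first_dep_mulL beta p q (dX N'))) nn0.
by exists C => // N'; apply: (nu_interp2 q0 (dX N') _ (H N')); exact: ltnW (ltnW nn0).
Qed.

End Orders.

(** * Second-order expansion for products of deviations *)

Section CavityIdentity.
Variables (R : realType) (Sc : nat) (beta h D p q : R) (n0 : nat).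
Notation T N' := {ffun 'I_n0 -> config Sc N'.+1}.
Notation nu N' := (@nu R Sc N' beta h D p q n0).
Notation Um N' := (@Um R Sc N' p q n0).
Notation U N' := (@U R Sc N' p q n0).
Notation eps N' := (@eps R Sc N').
Notation B := (Sc%:R ^+ 2 : R).
Notation Lg N' := (@Lgen R Sc N' beta p q n0).
Notation Ord := (@Ord R Sc beta h D p q n0).
Notation decouples N' := (@decouples R Sc N' beta h D p q n0).
Notation graph := (seq ('I_n0 * 'I_n0)).

Hypothesis fix_pt : fixed_point Sc beta h D p q.
Hypothesis qB : q <= B.
Hypothesis pB : `|p| <= B.
Hypothesis n3 : (3 < n0)%N.
Hypothesis small : 4 * kappa Sc beta <= 1 / 2.

(* A graph is a list of pairs of replicas; the pair (u, u) is a loop, and an edge (u, v)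
   stands for the factor U u v. *)
Definition prodU N' (G : graph) (s : T N') : R := \prod_(e <- G) U N' e.1 e.2 s.
Definition prodUm N' (G : graph) (s : T N') : R := \prod_(e <- G) Um N' e.1 e.2 s.
Definition epse N' (e : 'I_n0 * 'I_n0) (s : T N') : R := eps N' (s e.1) * eps N' (s e.2).
Definition in_first n (G : graph) := all (fun e : 'I_n0 * 'I_n0 => (e.1 < n)%N && (e.2 < n)%N) G.

Let OU := Ord_U fix_pt qB pB n3 small.
Let OUm := Ord_Um fix_pt qB pB n3 small.

Lemma prodU_cons N' e G s : @prodU N' (e :: G) s = U N' e.1 e.2 s * prodU G s.
Proof. by rewrite /prodU big_cons. Qed.

Lemma prodUm_cons N' e G s : @prodUm N' (e :: G) s = Um N' e.1 e.2 s * prodUm G s.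
Proof. by rewrite /prodUm big_cons. Qed.

Lemma Ord_epse e : Ord 0 (fun N' s => @epse N' e s).
Proof. exact: Ord_eps. Qed.

Lemma Ord_one : Ord 0 (fun N' s => 1).
Proof. by apply: (@Ord_bounded _ _ _ _ _ _ _ _ _ 1) => N' s; rewrite normr1. Qed.

Lemma Ord_mul1 j (X Y : forall N', T N' -> R) : Ord 1 X -> Ord j Y ->
  Ord j.+1 (fun N' s => X N' s * Y N' s).
Proof. exact: Ord_mul. Qed.

Lemma Ord_mul0 j (X Y : forall N', T N' -> R) : Ord 0 X -> Ord j Y ->
  Ord j (fun N' s => X N' s * Y N' s).
Proof. exact: Ord_mul. Qed.

Lemma Ord_prodU G : Ord (size G) (fun N' s => @prodU N' G s).
Proof.
elim: G => [|e G IH].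
  by apply: Ord_eq Ord_one => N' s; rewrite /prodU big_nil.
by apply: (Ord_eq _ (Ord_mul1 (OU e.1 e.2) IH)) => N' s; rewrite prodU_cons.
Qed.

Lemma Ord_prodUm G : Ord (size G) (fun N' s => @prodUm N' G s).
Proof.
elim: G => [|e G IH].
  by apply: Ord_eq Ord_one => N' s; rewrite /prodUm big_nil.
by apply: (Ord_eq _ (Ord_mul1 (OUm e.1 e.2) IH)) => N' s; rewrite prodUm_cons.
Qed.

Lemma Ord_prod_diff G : Ord (size G).+1 (fun N' s => @prodU N' G s - prodUm G s).
Proof.
elim: G => [|e G IH].
  rewrite [size _]/=; apply: (Ord_eq _ (Ord_weak (isT : (1 <= 2)%N) (Ord_invN (Ord_scale 0 Ord_one)))) => N' s.
  by rewrite /prodU /prodUm !big_nil mul0r mulr0 subrr.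
have H1 := Ord_invN (Ord_mul (Ord_epse e) (Ord_prodU G)).
rewrite [size _]/=; apply: (Ord_eq _ (Ord_add H1 (Ord_mul1 (OUm e.1 e.2) IH))) => N' s.
by rewrite prodU_cons prodUm_cons U_Um -/(epse e s); ring.
Qed.

(** Expand the product of the factors [Um + eps eps / N]. Each replacement of a deviation by
    [eps eps / N] gains one power of [rho], so two replacements are already an error; a single one
    deletes its edge. *)
Lemma Ord_prod_diff2 G : uniq G -> Ord (size G).+2 (fun N' s =>
  @prodU N' G s - prodUm G s - N'.+1%:R^-1 * \sum_(e <- G) epse e s * prodUm (rem e G) s).
Proof.
elim: G => [_|e G IH].
  rewrite [size _]/=; apply: (Ord_eq _ (Ord_invN (Ord_scale 0 Ord_one))) => N' s.
  by rewrite /prodU /prodUm !big_nil subrr; ring.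
rewrite [uniq _]/= => /andP[eG uG].
have H1 := Ord_invN (Ord_mul (Ord_epse e) (Ord_prod_diff G)).
rewrite [size _]/=; apply: (Ord_eq _ (Ord_add H1 (Ord_mul1 (OUm e.1 e.2) (IH uG)))) => N' s.
rewrite big_cons [rem e _]/= eqxx.
have -> : \sum_(j <- G) epse j s * prodUm (rem j (e :: G)) s =
  Um N' e.1 e.2 s * \sum_(j <- G) epse j s * prodUm (rem j G) s.
  rewrite big_seq [in RHS]big_seq mulr_sumr; apply: eq_bigr => j jG.
  have /negPf ej : e != j by apply: contraNneq eG => ->.
  by rewrite [rem _ _]/= ej prodUm_cons mulrCA.
rewrite prodU_cons prodUm_cons U_Um -/(epse e s).
set S := \sum_(_ <- _) _; ring.
Qed.

Lemma first_dep_prodUm n G N' : in_first n G -> first_dep n (@prodUm N' G).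
Proof.
move=> /allP GH s s' ss'; rewrite /prodUm big_seq [in RHS]big_seq; apply: eq_bigr => e /GH /andP[e1 e2].
by rewrite /Submission.Um /Rm !ss'.
Qed.

Lemma nolast_prodUm N' G : nolast (@prodUm N' G).
Proof.
move=> s s'; rewrite /prodUm; apply: eq_bigr => e _; exact: nolast_Um.
Qed.

Lemma in_first_rem n e G : in_first n G -> in_first n (rem e G).
Proof. by move=> /allP H; apply/allP => x /mem_rem /H. Qed.

Lemma in_first_weak m n G : (m <= n)%N -> in_first m G -> in_first n G.
Proof.
by move=> mn /allP H; apply/allP => x /H /andP[a b]; rewrite !(leq_trans _ mn).
Qed.

Lemma rwt_large n (u : 'I_n0) : (n < u)%N -> rwt R n u = 0.
Proof. by move=> un; rewrite /rwt ltnNge (ltnW un) /= (gtn_eqF un). Qed.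

Variables (n : nat) (G : graph).
Hypothesis nn0 : (n.+1.+4 < n0)%N.
Hypothesis uG : uniq G.
Hypothesis Gn : in_first n G.
Variables (ff : forall N', T N' -> R) (A : R) (c : 'I_n0 -> 'I_n0 -> R).
Hypothesis ffA : forall N' s, `|@ff N' s| <= A.
Hypothesis ffd : forall N', first_dep n (@ff N').
Hypothesis ff0 : forall N', decouples N' (@ff N') 0.
Hypothesis ffc : forall N' u v, decouples N' (fun s => @ff N' s * (eps N' (s u) * eps N' (s v))) (c u v).

Let Off : Ord 0 ff := @Ord_bounded R Sc beta h D p q n0 ff A ffA.
Let r := size G.

(** These products have order [r + 1] already, so passing from [t = 0] to [pi / 2] and from [Um] to
    [U] costs only order [r + 2]. *)
Lemma rhoO_edge u v : rhoO r.+2 (fun N' => rwt R n u * rwt R n.+1 v * c u v *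
  (nu N' 0 (fun s => Um N' u v s * prodUm G s) - nu N' (pi / 2) (fun s => U N' u v s * prodU G s))).
Proof.
have [un|un] := ltnP n u.
  by exists 0 => // N'; rewrite rwt_large// !mul0r normr0.
have [vn|vn] := ltnP n.+1 v.
  by exists 0 => // N'; rewrite (rwt_large vn) mulr0 !mul0r normr0.
apply: rhoO_scale.
have H1 : Ord r.+1 (fun N' s => prodUm ((u, v) :: G) s) := Ord_prodUm ((u, v) :: G).
have d1 N' : first_dep n.+2 (@prodUm N' ((u, v) :: G)).
  apply: first_dep_prodUm; rewrite /in_first /= -/(in_first _ _).
  rewrite !ltnS vn (leq_trans un)//=; apply: in_first_weak Gn; exact: leq_trans (leqnSn _) _.
have H2 := Ord_interp1 fix_pt qB pB n3 small H1 d1 nn0.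
have H3 := Ord_nu_pihalf (Ord_prod_diff ((u, v) :: G)).
have E N' : - (nu N' (pi / 2) (@prodUm N' ((u, v) :: G)) - nu N' 0 (@prodUm N' ((u, v) :: G))) -
   nu N' (pi / 2) (fun s => @prodU N' ((u, v) :: G) s - prodUm ((u, v) :: G) s) =
  nu N' 0 (fun s => Um N' u v s * prodUm G s) - nu N' (pi / 2) (fun s => U N' u v s * prodU G s).
  rewrite nuB.
  have -> t : nu N' t (fun s => Um N' u v s * prodUm G s) = nu N' t (@prodUm N' ((u, v) :: G)).
    by apply: eq_nu => s; rewrite prodUm_cons.
  have -> t : nu N' t (fun s => U N' u v s * prodU G s) = nu N' t (@prodU N' ((u, v) :: G)).
    by apply: eq_nu => s; rewrite prodU_cons.
  have alg (a b d : R) : - (a - b) - (d - a) = b - d by ring.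
  exact: alg.
apply: (rhoO_eq E); apply: rhoO_sub; last exact: H3.
by apply: (rhoO_eq _ (rhoO_scale (-1) H2)) => N'; rewrite mulN1r.
Qed.

(** The factor [1/N] gives two orders and the remaining edges [r - 1], so a single first-order
    interpolation, with its gain of one, suffices to decouple [ff * epse]. *)
Lemma rhoO_selfedge e : e \in G -> rhoO r.+2 (fun N' => N'.+1%:R^-1 *
  (nu N' (pi / 2) (fun s => @ff N' s * epse e s * prodUm (rem e G) s) -
   c e.1 e.2 * nu N' (pi / 2) (@prodU N' (rem e G)))).
Proof.
move=> eG; have r1 : r = (size (rem e G)).+1.
  by rewrite size_rem// prednK// /r; case: (G) eG.
have [e1 e2] : (e.1 < n)%N /\ (e.2 < n)%N by move/allP: Gn => /(_ _ eG) /andP.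
have n3n0 : (n.+3 < n0)%N by exact: ltnW (ltnW nn0).
have dP N' := @first_dep_prodUm n (rem e G) N' (in_first_rem e Gn).
have -> : r.+2 = (2 + r)%N by rewrite addnC addn2.
apply: rhoO_mul; first exact: rhoO_invN.
have H1 : Ord (size (rem e G)) (fun N' s => @ff N' s * epse e s * prodUm (rem e G) s).
  exact: (Ord_mul0 (Ord_mul0 Off (Ord_epse e)) (Ord_prodUm (rem e G))).
have d1 N' : first_dep n (fun s => @ff N' s * epse e s * prodUm (rem e G) s).
  by move=> s s' ss'; rewrite (ffd ss') (dP N' s s' ss') /epse !ss'.
have H2 := Ord_interp1 fix_pt qB pB n3 small H1 d1 n3n0.
have H3 := Ord_interp1 fix_pt qB pB n3 small (Ord_prodUm (rem e G)) dP n3n0.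
have H4 := Ord_nu_pihalf (Ord_prod_diff (rem e G)).
rewrite -{}r1 in H2 H3 H4.
apply: (rhoO_eq _ (rhoO_sub H2 (rhoO_scale (c e.1 e.2) (rhoO_add H3 H4)))) => N'.
rewrite nuB (ffc e.1 e.2 (@nolast_prodUm N' (rem e G))).
have alg (a x b d y : R) : a - x * b - x * (d - b + (y - d)) = a - x * y by ring.
exact: alg.
Qed.

(** In the application [ff] is a centred product [epsc a b], hence its decoupled mean 0. [H1]
    replaces [U] by [Um] at the price of the [1/N] terms, [H2] expands at [t = 0], where only the
    generator term survives, and [H3] and [H4] bring the remaining averages back to the original
    system. *)
Lemma cavity_identity : rhoO r.+2 (fun N' => nu N' (pi / 2) (fun s => @ff N' s * prodU G s) -
  (beta ^+ 2 / 2 * (\sum_u \sum_v rwt R n u * rwt R n.+1 v * c u v *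
      nu N' (pi / 2) (fun s => U N' u v s * prodU G s)) +
   N'.+1%:R^-1 * \sum_(e <- G) c e.1 e.2 * nu N' (pi / 2) (@prodU N' (rem e G)))).
Proof.
have dP N' := @first_dep_prodUm n G N' Gn.
have H1 := Ord_nu_pihalf (Ord_mul0 Off (Ord_prod_diff2 uG)).
have d1 N' : first_dep n (fun s => @ff N' s * prodUm G s).
  by move=> s s' ss'; rewrite (ffd ss') (dP N' s s' ss').
have H2 := Ord_interp2 fix_pt qB pB n3 small (Ord_mul0 Off (Ord_prodUm G)) d1 nn0.
have H3 : rhoO r.+2 (fun N' => beta ^+ 2 / 2 * \sum_u \sum_v rwt R n u * rwt R n.+1 v * c u v *
  (nu N' 0 (fun s => Um N' u v s * prodUm G s) - nu N' (pi / 2) (fun s => U N' u v s * prodU G s))).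
  by apply: rhoO_scale; apply: rhoO_sum => u _; apply: rhoO_sum => v _; exact: rhoO_edge.
have H4 : rhoO r.+2 (fun N' => \sum_(e <- G | e \in G) N'.+1%:R^-1 *
  (nu N' (pi / 2) (fun s => @ff N' s * epse e s * prodUm (rem e G) s) -
   c e.1 e.2 * nu N' (pi / 2) (@prodU N' (rem e G)))).
  by apply: rhoO_sum => e eG; exact: rhoO_selfedge.
apply: (rhoO_eq _ (rhoO_add (rhoO_add H1 H2) (rhoO_add H3 H4))) => N'.
rewrite -big_seq -mulr_sumr.
have -> : \sum_(e <- G) (nu N' (pi / 2) (fun s => @ff N' s * epse e s * prodUm (rem e G) s) -
   c e.1 e.2 * nu N' (pi / 2) (@prodU N' (rem e G))) =
  \sum_(e <- G) nu N' (pi / 2) (fun s => @ff N' s * epse e s * prodUm (rem e G) s) -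
  \sum_(e <- G) c e.1 e.2 * nu N' (pi / 2) (@prodU N' (rem e G)) by rewrite sumrB.
have -> : \sum_u \sum_v rwt R n u * rwt R n.+1 v * c u v *
  (nu N' 0 (fun s => Um N' u v s * prodUm G s) - nu N' (pi / 2) (fun s => U N' u v s * prodU G s)) =
  \sum_u \sum_v rwt R n u * rwt R n.+1 v * c u v * nu N' 0 (fun s => Um N' u v s * prodUm G s) -
  \sum_u \sum_v rwt R n u * rwt R n.+1 v * c u v * nu N' (pi / 2) (fun s => U N' u v s * prodU G s).
  rewrite -sumrB; apply: eq_bigr => u _; rewrite -sumrB; apply: eq_bigr => v _.
  by rewrite mulrBr.
have -> : nu N' 0 (fun s => @ff N' s * prodUm G s * Lg N' n s) =
  beta ^+ 2 / 2 * \sum_u \sum_v rwt R n u * rwt R n.+1 v * c u v *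
    nu N' 0 (fun s => Um N' u v s * prodUm G s).
  transitivity (nu N' 0 (fun s => beta ^+ 2 / 2 * \sum_u \sum_v rwt R n u * rwt R n.+1 v *
      (@ff N' s * (eps N' (s u) * eps N' (s v)) * (Um N' u v s * prodUm G s)))).
    apply: eq_nu => s; rewrite /Lgen [LHS]mulrCA; congr (_ * _).
    rewrite mulr_sumr; apply: eq_bigr => u _; rewrite mulr_sumr; apply: eq_bigr => v _.
    by rewrite /epse; ring.
  rewrite nuZ nu_sum; apply: (congr1 (fun x => beta ^+ 2 / 2 * x)); apply: eq_bigr => u _.
  rewrite nu_sum; apply: eq_bigr => v _.
  rewrite nuZ (ffc u v (nolastM (nolast_Um p q u v) (@nolast_prodUm N' G))).
  by rewrite [LHS]mulrA.
have -> : nu N' 0 (fun s => @ff N' s * prodUm G s) = 0.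
  by rewrite (ff0 (@nolast_prodUm N' G)) mul0r.
have -> : nu N' (pi / 2) (fun s => @ff N' s * (@prodU N' G s - prodUm G s -
    N'.+1%:R^-1 * \sum_(e <- G) epse e s * prodUm (rem e G) s)) =
  nu N' (pi / 2) (fun s => @ff N' s * prodU G s) - nu N' (pi / 2) (fun s => @ff N' s * prodUm G s) -
  N'.+1%:R^-1 * \sum_(e <- G) nu N' (pi / 2) (fun s => @ff N' s * epse e s * prodUm (rem e G) s).
  rewrite -nu_sum -nuZ -!nuB; apply: eq_nu => s; rewrite !mulrBr; congr (_ - _).
  rewrite mulrCA; congr (_ * _); rewrite mulr_sumr; apply: eq_bigr => e _.
  by rewrite mulrA.
have alg (a b k i S1 S2 S3 S4 : R) : a - b - i * S1 + (b - 0 - k * S3) +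
  (k * (S3 - S4) + i * (S1 - S2)) = a - (k * S4 + i * S2) by ring.
exact: alg.
Qed.

End CavityIdentity.

(** * The linear system for overlap moments *)

Ltac decide_eqs := repeat (match goal with
  | |- context[?a == ?a] => rewrite eqxx
  | H : is_true (?a != ?b) |- context[?a == ?b] => rewrite (negbTE H)
  | H : is_true (?a != ?b) |- context[?b == ?a] => rewrite [b == a]eq_sym (negbTE H)
  end).
(** [c] is the moment belonging to the coincidence pattern at hand: one half of the tactic evaluates
    the left side to [c], the other half the indicators on the right. *)
Ltac mE_case c := transitivity c; [congr etaE; apply/funext => z;
  rewrite /= ?inE; decide_eqs; rewrite /= ?big_cons ?big_nil /=; decide_eqs; rewrite /=; ring |
  decide_eqs; rewrite /=; ring].

(** * Fourth cavity moments as polynomials in indicators *)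

Section EtaMoments.
Variables (R : realType) (Sc : nat) (beta h D p q : R).
Notation mom := (mom Sc beta h D p q).
Notation eok f := (polylip 1 (fun g : nat -> R => f (g 0%N))).

Lemma eok_gintegrable (f : R -> R) : eok f -> gintegrable f.
Proof.
move=> pf; apply: polylip1_gintegrable; have := polylip_upd (fun=> 0) 0%N pf.
by congr polylip1; apply/funext => x; rewrite upd_same.
Qed.

Lemma etaEB (f g : R -> R) : eok f -> eok g -> etaE (fun z => f z - g z) = etaE f - etaE g.
Proof. by move=> pf pg; rewrite !etaE_gint gintB//; exact: eok_gintegrable. Qed.

Lemma eok_mom j : eok (mom j).
Proof. exact: polylip_mom. Qed.

(** The digits list the powers of the last spin carried by the distinct replicas: [m112] has two
    single spins and one square. *)
Definition m1111 := etaE (fun z => mom 1 z ^+ 4).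
Definition m112 := etaE (fun z => mom 1 z ^+ 2 * mom 2 z).
Definition m22 := etaE (fun z => mom 2 z ^+ 2).
Definition m13 := etaE (fun z => mom 1 z * mom 3 z).
Definition m4 := etaE (fun z => mom 4 z).

Let e1111 : eok (fun z => mom 1 z ^+ 4). Proof. exact/polylipX/eok_mom. Qed.
Let e112 : eok (fun z => mom 1 z ^+ 2 * mom 2 z).
Proof. by apply: polylipM; [exact/polylipX/eok_mom|exact: eok_mom]. Qed.
Let e22 : eok (fun z => mom 2 z ^+ 2). Proof. exact/polylipX/eok_mom. Qed.
Let e13 : eok (fun z => mom 1 z * mom 3 z). Proof. by apply: polylipM; exact: eok_mom. Qed.
Let e4 : eok (fun z => mom 4 z). Proof. exact: eok_mom. Qed.

Lemma cDE : cD Sc beta h D p q = m4 - m22.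
Proof. exact: etaEB. Qed.

Lemma cFE : cF Sc beta h D p q = m22 - m112.
Proof. exact: etaEB. Qed.

Lemma cGE : cG Sc beta h D p q = m112 - m1111.
Proof.
by rewrite /cG -etaEB//; congr etaE; apply/funext => z; ring.
Qed.

Lemma cEE : cE Sc beta h D p q = m13 - m112.
Proof.
by rewrite /cE -etaEB//; congr etaE; apply/funext => z; ring.
Qed.

Lemma cAE : cA Sc beta h D p q = m22 - 2 * m112 + m1111.
Proof.
have -> : m22 - 2 * m112 + m1111 = (m22 - m112) - (m112 - m1111) by ring.
rewrite /cA -!etaEB//; try exact: polylipB.
by congr etaE; apply/funext => z; ring.
Qed.

Variable n0 : nat.
Notation mE := (@mE R Sc beta h D p q n0).
Implicit Types a b u w : 'I_n0.

(** Inclusion and exclusion over the coincidences among the four replicas. A polynomial in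
    indicators is the form in which the weighted double sum over [u] and [w] can be evaluated term
    by term. *)
Lemma mE4_distinct a b u w : a != b -> mE [:: a; b; u; w] = m1111 +
  (m112 - m1111) * ((u == a)%:R + (u == b)%:R + (w == a)%:R + (w == b)%:R) +
  (m112 - m1111) * (u == w)%:R +
  (m22 - 2 * m112 + m1111) * ((u == a)%:R * (w == b)%:R + (u == b)%:R * (w == a)%:R) +
  (m13 - 3 * m112 + 2 * m1111) * ((u == a)%:R * (w == a)%:R + (u == b)%:R * (w == b)%:R).
Proof.
move=> ab; have ba : b != a by rewrite eq_sym.
rewrite /Submission.mE.
have [->|ua] := eqVneq u a; [|have [->|ub] := eqVneq u b].
- have [->|wa] := eqVneq w a; [|have [->|wb] := eqVneq w b].
  + mE_case m13.
  + mE_case m22.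
  + mE_case m112.
- have [->|wa] := eqVneq w a; [|have [->|wb] := eqVneq w b].
  + mE_case m22.
  + mE_case m13.
  + mE_case m112.
- have [->|wa] := eqVneq w a; [|have [->|wb] := eqVneq w b].
  + mE_case m112.
  + mE_case m112.
  + have [->|uw] := eqVneq u w; [mE_case m112|mE_case m1111].
Qed.

Lemma mE4_same a u w : mE [:: a; a; u; w] = m112 +
  (m13 - m112) * ((u == a)%:R + (w == a)%:R) + (m22 - m112) * (u == w)%:R +
  (m4 - 2 * m13 - m22 + 2 * m112) * ((u == a)%:R * (w == a)%:R).
Proof.
rewrite /Submission.mE.
have [->|ua] := eqVneq u a; have [->|wa] := eqVneq w a.
- mE_case m4.
- mE_case m13.
- mE_case m13.
- have [->|uw] := eqVneq u w; [mE_case m22|mE_case m112].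
Qed.

End EtaMoments.

(** * The weighted double sum when fresh replicas are exchangeable *)

Section CavityForm.
Variables (R : realType) (n0 n v : nat) (x y : 'I_n0) (V : 'I_n0 -> 'I_n0 -> R).
Implicit Types (a b k l u w : 'I_n0) (c : 'I_n0 -> 'I_n0 -> R).
Hypothesis vx : (v <= x)%N.
Hypothesis vy : (v <= y)%N.
Hypothesis xn : (x < n)%N.
Hypothesis yn : (y < n)%N.
Hypothesis xy : x != y.
Hypothesis nn0 : (n.+1 < n0)%N.
Hypothesis Vsym : forall u w, V u w = V w u.
Hypothesis V_old_fresh : forall w u, (w < v)%N -> (v <= u)%N -> V w u = V w x.
Hypothesis V_fresh : forall u w, u != w -> (v <= u)%N -> (v <= w)%N -> V u w = V x y.
Hypothesis V_loop : forall u, (v <= u)%N -> V u u = V x x.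

Notation t := (V x y).
Notation s := (V x x).
(* Replicas u >= v are exchangeable. In terms of cX, cY, cZ, which vanish for them,
   V u w = t + cX u + cX w + cZ u w if u != w, and V u u = s + cY u. *)
Definition cX k := V k x - t.
Definition cY k := V k k - s.
Definition cZ k l := V k l - V k x - V l x + t.
Definition cZrow k := \sum_(l < n0 | (l < v)%N && (l != k)) cZ k l.
Definition sumX := \sum_(k < n0 | (k < v)%N) cX k.
Definition sumY := \sum_(k < n0 | (k < v)%N) cY k.
Definition sumZ := \sum_(k < n0 | (k < v)%N) cZrow k.

Lemma rwt_small m u : (u < m)%N -> rwt R m u = 1.
Proof. by rewrite /rwt => ->. Qed.

(** The weights sum to zero, so a row may be centred at its value on fresh replicas; below, this
    leaves only the old replicas and the diagonal. *)
Lemma row_center m u (c : R) : (m < n0)%N ->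
  \sum_w rwt R m w * V u w = \sum_w rwt R m w * (V u w - c).
Proof.
move=> mn0; transitivity (\sum_w rwt R m w * V u w - \sum_(w < n0) rwt R m w * c).
  by rewrite sum_rwt// subr0.
by rewrite -sumrB; apply: eq_bigr => w _; rewrite mulrBr.
Qed.

Lemma row_old m k : (v <= m)%N -> (m < n0)%N -> (k < v)%N ->
  \sum_w rwt R m w * V k w = sumX + cZrow k + (s + cY k - t - 2 * cX k).
Proof.
move=> vm mn0 kv; rewrite (row_center k (V k x) mn0).
rewrite (bigID (fun w : 'I_n0 => (w < v)%N)) /= [X in _ + X]big1 ?addr0 => [|w]; last first.
  by rewrite -leqNgt => vw; rewrite V_old_fresh// subrr mulr0.
under eq_bigr => w wv do rewrite (rwt_small (leq_trans wv vm)) mul1r.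
rewrite (bigD1 k)//=.
have -> : \sum_(w < n0 | (w < v)%N && (w != k)) (V k w - V k x) =
   cZrow k + \sum_(w < n0 | (w < v)%N && (w != k)) cX w.
  by rewrite /cZrow -big_split; apply: eq_bigr => w _; rewrite /cZ /cX /=; ring.
rewrite [sumX](bigD1 k)//=; set S := \sum_(_ < _ | _) cX _.
by rewrite /cY /cX; ring.
Qed.

Lemma row_fresh m u : (v <= m)%N -> (m < n0)%N -> (v <= u)%N ->
  \sum_w rwt R m w * V u w = sumX + rwt R m u * (s - t).
Proof.
move=> vm mn0 vu; rewrite (row_center u t mn0).
rewrite (bigID (fun w : 'I_n0 => (w < v)%N)) /=; congr (_ + _).
  apply: eq_bigr => w wv.
  by rewrite (rwt_small (leq_trans wv vm)) mul1r Vsym V_old_fresh.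
rewrite (bigD1 u) -?leqNgt//= V_loop// big1 ?addr0// => w /andP[].
rewrite -leqNgt => vw wu; rewrite V_fresh ?subrr ?mulr0//.
by rewrite eq_sym.
Qed.

Definition Lam c := \sum_u \sum_w rwt R n u * rwt R n.+1 w * c u w * V u w.

Lemma LamD c c' : Lam (fun u w => c u w + c' u w) = Lam c + Lam c'.
Proof.
rewrite -big_split; apply: eq_bigr => u _; rewrite -big_split; apply: eq_bigr => w _ /=.
by ring.
Qed.

Lemma LamB c c' : Lam (fun u w => c u w - c' u w) = Lam c - Lam c'.
Proof.
rewrite -sumrB; apply: eq_bigr => u _; rewrite -sumrB; apply: eq_bigr => w _ /=.
by ring.
Qed.

Lemma LamZ r c : Lam (fun u w => r * c u w) = r * Lam c.
Proof.
rewrite mulr_sumr; apply: eq_bigr => u _; rewrite mulr_sumr; apply: eq_bigr => w _ /=.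
by ring.
Qed.

Lemma eq_Lam c c' : (forall u w, c u w = c' u w) -> Lam c = Lam c'.
Proof. by move=> cc; apply: eq_bigr => u _; apply: eq_bigr => w _; rewrite cc. Qed.

Let vn : (v <= n)%N. Proof. exact: leq_trans vx (ltnW xn). Qed.

Lemma Lam_row a : (a < n)%N -> Lam (fun u w => (u == a)%:R) = \sum_w rwt R n.+1 w * V a w.
Proof.
move=> an; rewrite /Lam (bigD1 a)//= [X in _ + X]big1 ?addr0 => [|u ua]; last first.
  by rewrite big1// => w _; rewrite (negbTE ua) mulr0 mul0r.
by apply: eq_bigr => w _; rewrite eqxx mulr1 rwt_small// mul1r.
Qed.

Lemma Lam_col a : (a < n)%N -> Lam (fun u w => (w == a)%:R) = \sum_u rwt R n u * V a u.
Proof.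
move=> an; apply: eq_bigr => u _; rewrite (bigD1 a)//= [X in _ + X]big1 ?addr0 => [|w wa].
  by rewrite eqxx mulr1 [rwt R n.+1 a]rwt_small ?mulr1 1?Vsym// ltnW.
by rewrite (negbTE wa) mulr0 mul0r.
Qed.

Lemma Lam_delta a b : (a < n)%N -> (b < n)%N ->
  Lam (fun u w => (u == a)%:R * (w == b)%:R) = V a b.
Proof.
move=> an bn; rewrite /Lam (bigD1 a)//= [X in _ + X]big1 ?addr0 => [|u ua]; last first.
  by rewrite big1// => w _; rewrite (negbTE ua) mul0r mulr0 mul0r.
rewrite (bigD1 b)//= [X in _ + X]big1 ?addr0 => [|w wb]; last first.
  by rewrite (negbTE wb) !mulr0 mul0r.
by rewrite !eqxx !rwt_small ?mul1r// ltnW.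
Qed.

Lemma Lam_diag : Lam (fun u w => (u == w)%:R) = sumY.
Proof.
have n1 : (n < n0)%N by exact: ltnW.
transitivity (\sum_u rwt R n u * (V u u - s)).
  transitivity (Lam (fun u w => (u == w)%:R) - \sum_(u < n0) rwt R n u * s).
    by rewrite sum_rwt// subr0.
  rewrite -sumrB; apply: eq_bigr => u _.
  rewrite mulrBr (bigD1 u)//= big1 ?addr0 => [|w wu].
    by rewrite eqxx mulr1 rwt_diag.
  by rewrite eq_sym (negbTE wu) mulr0 mul0r.
rewrite (bigID (fun u : 'I_n0 => (u < v)%N)) /= [X in _ + X]big1 ?addr0 => [|u].
  by apply: eq_bigr => u uv; rewrite rwt_small ?mul1r// (leq_trans uv).
by rewrite -leqNgt => vu; rewrite V_loop// subrr mulr0.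
Qed.

(** Both variables are centred. For fresh [u] the row exceeds [sumX + (s - t)] by
    [(rwt R n.+1 u - 1) * (s - t)], which is killed by the factor [rwt R n u]. *)
Lemma Lam_one : Lam (fun u w => 1) = sumZ + sumY - 2 * sumX.
Proof.
have n1 : (n < n0)%N by exact: ltnW.
transitivity (\sum_u rwt R n u * (\sum_w rwt R n.+1 w * V u w - (sumX + (s - t)))).
  transitivity (Lam (fun u w => 1) - \sum_(u < n0) rwt R n u * (sumX + (s - t))).
    by rewrite sum_rwt// subr0.
  rewrite -sumrB; apply: eq_bigr => u _.
  rewrite mulrBr mulr_sumr; congr (_ - _); apply: eq_bigr => w _.
  by rewrite mulr1 mulrA.
rewrite (bigID (fun u : 'I_n0 => (u < v)%N)) /= [X in _ + X]big1 ?addr0 => [|u].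
  rewrite /sumZ /sumY /sumX mulr_sumr -big_split -sumrB /=; apply: eq_bigr => u uv.
  rewrite (row_old (leqW vn) nn0 uv) rwt_small ?mul1r ?(leq_trans uv)//.
  rewrite -/sumX; ring.
rewrite -leqNgt => vu; rewrite (row_fresh (leqW vn) nn0 vu).
have E := rwt_diag R n u; set S := sumX.
transitivity ((rwt R n u * rwt R n.+1 u - rwt R n u) * (s - t)); first by ring.
by rewrite E subrr mul0r.
Qed.

Definition rowL a := if (a < v)%N then sumX + cZrow a + (s + cY a - t - 2 * cX a) else sumX + (s - t).

Lemma Lam_rowE a : (a < n)%N -> Lam (fun u w => (u == a)%:R) = rowL a.
Proof.
move=> an; rewrite Lam_row// /rowL; case: ltnP => va; first exact: row_old (leqW vn) _ _.
by rewrite (row_fresh (leqW vn) nn0 va) rwt_small ?mul1r// ltnW.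
Qed.

Lemma Lam_colE a : (a < n)%N -> Lam (fun u w => (w == a)%:R) = rowL a.
Proof.
have n1 : (n < n0)%N by exact: ltnW.
move=> an; rewrite Lam_col// /rowL; case: ltnP => va; first exact: row_old.
by rewrite (row_fresh vn n1 va) rwt_small ?mul1r.
Qed.

Variables (Sc : nat) (beta h D p q : R).
Notation mE := (@mE R Sc beta h D p q n0).
Notation cA := (cA Sc beta h D p q).
Notation cD := (cD Sc beta h D p q).
Notation cE := (cE Sc beta h D p q).
Notation cF := (cF Sc beta h D p q).
Notation cG := (cG Sc beta h D p q).
Notation m1111 := (m1111 Sc beta h D p q).
Notation m112 := (m112 Sc beta h D p q).

Lemma mE4_distinctE a b u w : a != b -> mE [:: a; b; u; w] = m1111 * 1 +
  cG * ((u == a)%:R + (u == b)%:R + (w == a)%:R + (w == b)%:R) + cG * (u == w)%:R +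
  cA * ((u == a)%:R * (w == b)%:R + (u == b)%:R * (w == a)%:R) +
  (cE - 2 * cG) * ((u == a)%:R * (w == a)%:R + (u == b)%:R * (w == b)%:R).
Proof. by move=> ab; rewrite mE4_distinct// cGE cAE cEE; ring. Qed.

Lemma mE4_sameE a u w : mE [:: a; a; u; w] = m112 * 1 +
  cE * ((u == a)%:R + (w == a)%:R) + cF * (u == w)%:R +
  (cD - 2 * cE) * ((u == a)%:R * (w == a)%:R).
Proof. by rewrite mE4_same cFE cDE cEE; ring. Qed.

Lemma Lam_distinct a b : a != b -> (a < n)%N -> (b < n)%N ->
  Lam (fun u w => mE [:: a; b; u; w]) = m1111 * (sumZ + sumY - 2 * sumX) +
  cG * (2 * rowL a + 2 * rowL b) + cG * sumY + 2 * cA * V a b + (cE - 2 * cG) * (V a a + V b b).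
Proof.
move=> ab an bn; rewrite (eq_Lam (fun u w => mE4_distinctE u w ab)).
rewrite !LamD !LamZ !LamD !Lam_rowE// !Lam_colE// !Lam_delta// Lam_one Lam_diag [V b a]Vsym.
ring.
Qed.

Lemma Lam_same a : (a < n)%N ->
  Lam (fun u w => mE [:: a; a; u; w]) = m112 * (sumZ + sumY - 2 * sumX) +
  cE * (2 * rowL a) + cF * sumY + (cD - 2 * cE) * V a a.
Proof.
move=> an; rewrite (eq_Lam (fun u w => mE4_sameE a u w)).
rewrite !LamD !LamZ !LamD !Lam_rowE// !Lam_colE// !Lam_delta// Lam_one Lam_diag.
ring.
Qed.

Lemma Lam_Qv : Lam (fun u w => Qv p q u w) = q * (sumZ + sumY - 2 * sumX) + (p - q) * sumY.
Proof.
rewrite -Lam_one -Lam_diag -!LamZ -LamD; apply: eq_Lam => u w.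
by rewrite /Qv; case: eqP => _ /=; ring.
Qed.

End CavityForm.

(** * The cavity equation for one additional edge *)

Section EdgeEquation.
Variables (R : realType) (Sc : nat) (beta h D p q : R) (n0 v : nat).
Notation T N' := {ffun 'I_n0 -> config Sc N'.+1}.
Notation nu N' := (@nu R Sc N' beta h D p q n0).
Notation U N' := (@U R Sc N' p q n0).
Notation B := (Sc%:R ^+ 2 : R).
Notation prodU N' := (@prodU R Sc p q n0 N').
Notation mE := (@mE R Sc beta h D p q n0).
Notation graph := (seq ('I_n0 * 'I_n0)).

Hypothesis fix_pt : fixed_point Sc beta h D p q.
Hypothesis qB : q <= B.
Hypothesis pB : `|p| <= B.
Hypothesis small : 4 * kappa Sc beta <= 1 / 2.
Hypothesis vn0 : (v.+4.+3 < n0)%N.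

Variables (x y : 'I_n0) (G : graph).
Hypothesis xE : x = v :> nat.
Hypothesis yE : y = v.+1 :> nat.
Hypothesis uG : uniq G.
Hypothesis Gv : in_first v G.

(** [G] lives on the replicas below [v], and [x = v], [y = v + 1] stand for the fresh ones.
    Permuting replicas from [v] on does not change these values, which is what the abstract double
    sum requires. *)
Definition nuV N' u w := nu N' (pi / 2) (fun s => U N' u w s * prodU N' G s).
Notation V N' := (nuV N').

Lemma nuV_perm N' (pi : {perm 'I_n0}) u w : (forall l : 'I_n0, (l < v)%N -> pi l = l) ->
  V N' (pi u) (pi w) = V N' u w.
Proof.
move=> fixv; rewrite -[RHS](nu_perm beta h D p q _ _ pi); apply: eq_nu => s.
rewrite -U_permrep; congr (_ * _); rewrite /Submission.prodU big_seq [RHS]big_seq.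
apply: eq_bigr => e /(allP Gv)/andP[e1 e2].
by rewrite U_permrep !fixv.
Qed.

Lemma nuV_sym N' u w : V N' u w = V N' w u.
Proof.
apply: eq_nu => s; congr (_ * _); rewrite /Submission.U /Rfull /Qv eq_sym; congr (_ * _ - _).
by apply: eq_bigr => i _; rewrite mulrC.
Qed.

Let tperm_fix (a b l : 'I_n0) : (v <= a)%N -> (v <= b)%N -> (l < v)%N -> tperm a b l = l.
Proof.
by move=> va vb lv; rewrite tpermD//; apply: contraTneq lv => <-; rewrite -leqNgt.
Qed.

Let vx : (v <= x)%N. Proof. by rewrite xE. Qed.
Let vy : (v <= y)%N. Proof. by rewrite yE. Qed.
Let xn : (x < v.+2)%N. Proof. by rewrite xE. Qed.
Let yn : (y < v.+2)%N. Proof. by rewrite yE. Qed.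
Let xy : x != y. Proof. by rewrite -(inj_eq val_inj) /= xE yE neq_ltn ltnSn. Qed.
Let nn0 : (v.+3 < n0)%N. Proof. by move: vn0; clear; lia. Qed.

Lemma nuV_old_fresh N' (w u : 'I_n0) : (w < v)%N -> (v <= u)%N -> V N' w u = V N' w x.
Proof.
move=> wv vu; rewrite -(@nuV_perm N' (tperm x u) w x) => [|l lv]; last exact: tperm_fix.
by rewrite tpermL tperm_fix.
Qed.

Lemma nuV_loop N' (u : 'I_n0) : (v <= u)%N -> V N' u u = V N' x x.
Proof.
move=> vu; rewrite -(@nuV_perm N' (tperm x u) x x) => [|l lv]; last exact: tperm_fix.
by rewrite tpermL.
Qed.

Lemma nuV_fresh N' (u w : 'I_n0) : u != w -> (v <= u)%N -> (v <= w)%N -> V N' u w = V N' x y.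
Proof.
move=> uw vu vw; pose y' := tperm x u y.
have y'u : y' != u by rewrite -[X in _ != X](tpermL x u) (inj_eq perm_inj) eq_sym.
have vy' : (v <= y')%N by rewrite /y'; case: tpermP.
rewrite -(@nuV_perm N' (tperm x u * tperm y' w)%g x y) => [|l lv]; last first.
  by rewrite permM !tperm_fix.
by rewrite !permM tpermL -/y' tpermL tpermD// eq_sym.
Qed.

Definition edgec a b u w := mE [:: a; b; u; w] - Qv p q a b * Qv p q u w.
Definition nuW N' e := nu N' (pi / 2) (prodU N' (rem e G)).
Notation LamV N' := (Lam v.+2 (V N')).

Definition edge_err N' a b := V N' a b - (beta ^+ 2 / 2 * LamV N' (edgec a b) +
  N'.+1%:R^-1 * \sum_(e <- G) edgec a b e.1 e.2 * nuW N' e).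

(** Exchangeability of the sites turns [U a b] into [epsc a b], to which [cavity_identity] applies.
    With [n = v + 2], both old replicas and the two fresh ones [x], [y] are allowed for [a] and
    [b]. *)
Lemma edge_errO (a b : 'I_n0) : (a < v.+2)%N -> (b < v.+2)%N -> rhoO (size G).+2 (fun N' => edge_err N' a b).
Proof.
move=> an bn; have n3 : (3 < n0)%N by move: vn0; clear; lia.
have Gn : in_first v.+2 G by apply: in_first_weak Gv; exact: leq_trans (leqnSn _) (leqnSn _).
have fd N' : first_dep v.+2 (@epsc R Sc N' p q n0 a b).
  by move=> s s' ss'; rewrite /epsc !ss'.
have f0 N' : decouples beta h D p q (@epsc R Sc N' p q n0 a b) 0 by exact: decouples_epsc.
have fc N' u w : decouples beta h D p q (fun s : T N' => epsc p q a b s * (eps R (s u) * eps R (s w)))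
    (edgec a b u w).
  have := decouplesB (@decouples_eps_prod R Sc N' beta h D p q n0 [:: a; b; u; w])
    (decouplesZ (Qv p q a b) (@decouples_eps_prod R Sc N' beta h D p q n0 [:: u; w])).
  rewrite (mE2 fix_pt) => F; apply: (decouples_eq _ F) => s.
  by rewrite eps_prod2 /epsc /eps_prod !big_cons big_nil; ring.
have bd N' (s : T N') : `|epsc p q a b s| <= 2 * B 
  by exact: (epsc_bound fix_pt qB pB).
have H := cavity_identity fix_pt qB pB n3 small vn0 uG Gn bd fd f0 fc.
apply: (rhoO_eq _ H) => N'; rewrite -nu_site_cavity.
  by [].
move=> i s; rewrite /Submission.prodU; apply: eq_bigr => e _; exact: U_swaps.
Qed.

End EdgeEquation.

Lemma sum_indicator (R : realType) (n0 : nat) (P : pred 'I_n0) (e : 'I_n0) (f : 'I_n0 -> R) :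
  \sum_(k | P k) (e == k)%:R * f k = (P e)%:R * f e.
Proof.
case Pe: (P e); last first.
  rewrite mul0r big1// => k Pk; have /negbTE -> : e != k by apply: contraFneq Pe => ->.
  by rewrite mul0r.
rewrite (bigD1 e)//= eqxx big1 ?addr0// => k /andP[_ ke].
by rewrite eq_sym (negbTE ke) mul0r.
Qed.

(** * Summing the edge equations over the old replicas *)

Section Aggregate.
Variables (R : realType) (n0 v : nat) (x y : 'I_n0) (V : 'I_n0 -> 'I_n0 -> R).
Notation n := v.+2.
Hypothesis vx : (v <= x)%N.
Hypothesis vy : (v <= y)%N.
Hypothesis xn : (x < n)%N.
Hypothesis yn : (y < n)%N.
Hypothesis xy : x != y.
Hypothesis nn0 : (n.+1 < n0)%N.
Hypothesis Vsym : forall u w, V u w = V w u.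
Hypothesis V_old_fresh : forall w u : 'I_n0, (w < v)%N -> (v <= u)%N -> V w u = V w x.
Hypothesis V_fresh : forall u w : 'I_n0, u != w -> (v <= u)%N -> (v <= w)%N -> V u w = V x y.
Hypothesis V_loop : forall u : 'I_n0, (v <= u)%N -> V u u = V x x.

Variables (Sc : nat) (beta h D p q iN : R) (G : seq ('I_n0 * 'I_n0)) (W : 'I_n0 * 'I_n0 -> R).
Hypothesis Gv : in_first v G.
Notation cA := (cA Sc beta h D p q).
Notation cD := (cD Sc beta h D p q).
Notation cE := (cE Sc beta h D p q).
Notation cF := (cF Sc beta h D p q).
Notation cG := (cG Sc beta h D p q).
Notation cI3 := (cI3 Sc beta h D p q).
Notation cI5 := (cI5 Sc beta h D p q).
Notation cK4 := (cK4 Sc beta h D p q).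
Notation m1111 := (m1111 Sc beta h D p q).
Notation m112 := (m112 Sc beta h D p q).
Notation m22 := (m22 Sc beta h D p q).
Notation edgec := (@edgec R Sc beta h D p q n0).
Notation LamV := (Lam n V).
Notation SX := (sumX v x y V).
Notation SY := (sumY v x V).
Notation SZ := (sumZ v x y V).
Notation X := (cX x y V).
Notation Y := (cY x V).
Notation Z := (cZ x y V).
Notation Zrow := (cZrow v x y V).
Notation t := (V x y).
Notation s := (V x x).
Notation rowL := (rowL v x y V).

Definition lin_err a b := V a b - (beta ^+ 2 / 2 * LamV (edgec a b) +
  iN * \sum_(e <- G) edgec a b e.1 e.2 * W e).

Definition WE := \sum_(e <- G | e.1 != e.2) W e.
Definition WL := \sum_(e <- G | e.1 == e.2) W e.

Let cI3E : cI3 = m1111 - q ^+ 2. Proof. by []. Qed.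
Let cI5E : cI5 = m112 - p * q. Proof. by []. Qed.
Let cK4E : cK4 = m22 - p ^+ 2. Proof. by []. Qed.

Lemma Lam_edgec_distinct (a b : 'I_n0) : a != b -> (a < n)%N -> (b < n)%N ->
  LamV (edgec a b) = cI3 * (SZ + SY - 2 * SX) + (cI5 - cI3) * SY +
  2 * cG * (rowL a + rowL b) + 2 * cA * V a b + (cE - 2 * cG) * (V a a + V b b).
Proof.
move=> ab an bn; rewrite /Submission.edgec LamB LamZ (Lam_distinct vx xn nn0 Vsym V_old_fresh V_fresh V_loop)// (Lam_Qv vx xn nn0 Vsym V_old_fresh V_fresh V_loop)//.
rewrite /Qv (negbTE ab) cI3E cI5E.
have -> : m112 = cG + m1111 by rewrite cGE subrK.
by ring.
Qed.

Lemma Lam_edgec_same (a : 'I_n0) : (a < n)%N ->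
  LamV (edgec a a) = cI5 * (SZ + SY - 2 * SX) + (cK4 - cI5) * SY +
  2 * cE * rowL a + (cD - 2 * cE) * V a a.
Proof.
move=> an; rewrite /Submission.edgec LamB LamZ (Lam_same vx xn nn0 Vsym V_old_fresh V_fresh V_loop)// (Lam_Qv vx xn nn0 Vsym V_old_fresh V_fresh V_loop)//.
rewrite /Qv eqxx cK4E cI5E.
have -> : m22 = cF + m112 by rewrite cFE subrK.
by ring.
Qed.

Let rowx : rowL x = SX + (s - t).
Proof. by rewrite /Submission.rowL ltnNge vx. Qed.
Let rowy : rowL y = SX + (s - t).
Proof. by rewrite /Submission.rowL ltnNge vy. Qed.
Let rowk (k : 'I_n0) : (k < v)%N -> rowL k = SX + Zrow k + (s + Y k - t - 2 * X k).
Proof. by rewrite /Submission.rowL => ->. Qed.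
Let old_n (k : 'I_n0) : (k < v)%N -> (k < n)%N.
Proof. by move=> kv; rewrite ltnS ltnW// ltnW. Qed.
Let old_neq (k u : 'I_n0) : (k < v)%N -> (v <= u)%N -> k != u.
Proof. by move=> kv vu; rewrite -(inj_eq val_inj) neq_ltn (leq_trans kv vu). Qed.

(** The terms common to all pairs cancel in the difference; the rest is local to [k] and can be
    summed over [k]. *)
Lemma Lam_diffX (k : 'I_n0) : (k < v)%N -> LamV (edgec k x) - LamV (edgec x y) =
  2 * cG * Zrow k + cE * Y k + (2 * cA - 4 * cG) * X k.
Proof.
move=> kv; rewrite !Lam_edgec_distinct ?(old_n kv) ?(old_neq kv vx)// rowx rowy rowk//.
by rewrite (V_loop vy) /Submission.cX /Submission.cY; ring.
Qed.

Lemma Lam_diffY (k : 'I_n0) : (k < v)%N -> LamV (edgec k k) - LamV (edgec x x) =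
  2 * cE * Zrow k + cD * Y k - 4 * cE * X k.
Proof.
move=> kv; rewrite !Lam_edgec_same ?(old_n kv)// rowx rowk//.
by rewrite /Submission.cX /Submission.cY; ring.
Qed.

(** The second difference removes the row terms as well, so the equation for [Z] closes on itself
    with factor [1 - beta^2 A]. *)
Lemma Lam_diffZ (k l : 'I_n0) : (k < v)%N -> (l < v)%N -> k != l ->
  LamV (edgec k l) - LamV (edgec k x) - LamV (edgec l x) + LamV (edgec x y) = 2 * cA * Z k l.
Proof.
move=> kv lv kl; rewrite !Lam_edgec_distinct ?(old_n kv) ?(old_n lv) ?(old_neq kv vx) ?(old_neq lv vx)// rowx rowy.
by rewrite (V_loop vy) /Submission.cZ; ring.
Qed.

Lemma Lamt : LamV (edgec x y) =
  cI3 * SZ + cI5 * SY + (4 * cG - 2 * cI3) * SX + 2 * cE * s + (2 * cA - 4 * cG) * t.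
Proof. by rewrite !Lam_edgec_distinct// rowx rowy (V_loop vy); ring. Qed.

Lemma Lams : LamV (edgec x x) =
  cI5 * SZ + cK4 * SY + 2 * (cE - cI5) * SX + cD * s - 2 * cE * t.
Proof. by rewrite !Lam_edgec_same// rowx; ring. Qed.

Lemma edgec_distinct (a b u w : 'I_n0) : a != b -> edgec a b u w =
  cI3 + (cI5 - cI3) * (u == w)%:R +
  cG * ((u == a)%:R + (u == b)%:R + (w == a)%:R + (w == b)%:R) +
  cA * ((u == a)%:R * (w == b)%:R + (u == b)%:R * (w == a)%:R) +
  (cE - 2 * cG) * ((u == a)%:R * (w == a)%:R + (u == b)%:R * (w == b)%:R).
Proof.
move=> ab; rewrite /Submission.edgec mE4_distinctE// /Qv (negbTE ab) cI3E cI5E.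
have -> : m112 = cG + m1111 by rewrite cGE subrK.
by case: (u == w) => /=; ring.
Qed.

Lemma edgec_same (a u w : 'I_n0) : edgec a a u w =
  cI5 + (cK4 - cI5) * (u == w)%:R + cE * ((u == a)%:R + (w == a)%:R) +
  (cD - 2 * cE) * ((u == a)%:R * (w == a)%:R).
Proof.
rewrite /Submission.edgec mE4_sameE// /Qv eqxx cK4E cI5E.
have -> : m22 = cF + m112 by rewrite cFE subrK.
by case: (u == w) => /=; ring.
Qed.

(** After summation the coefficient of an edge depends only on whether it is a loop. This separates
    the moments with one factor [T] less from those with one factor [S] less. *)
Lemma self_split (f : 'I_n0 * 'I_n0 -> R) (c1 c2 : R) :
  (forall e, e \in G -> f e = c1 + (c2 - c1) * (e.1 == e.2)%:R) ->
  \sum_(e <- G) f e * W e = c1 * WE + c2 * WL.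
Proof.
move=> H; rewrite big_seq (eq_bigr (fun e => (c1 + (c2 - c1) * (e.1 == e.2)%:R) * W e)) -?big_seq.
  rewrite (bigID (fun e => e.1 == e.2)) /= addrC /WE /WL !mulr_sumr; congr (_ + _).
    by apply: eq_bigr => e /negbTE ->; rewrite mulr0 addr0.
  by apply: eq_bigr => e ->; rewrite mulr1 addrC subrK.
by move=> e eG; rewrite H.
Qed.

Let mem_old e : e \in G -> ((e.1 < v)%N * (e.2 < v)%N).
Proof. by move=> /(allP Gv)/andP[]. Qed.

Let selfkx (k : 'I_n0) e : (k < v)%N -> e \in G -> edgec k x e.1 e.2 - edgec x y e.1 e.2 =
  (e.1 == k)%:R * cG + (e.2 == k)%:R * cG + (e.1 == k)%:R * ((cE - 2 * cG) * (e.2 == k)%:R).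
Proof.
move=> kv /mem_old[e1 e2]; rewrite !edgec_distinct ?(old_neq kv vx)//.
rewrite !(negbTE (old_neq e1 vx)) !(negbTE (old_neq e2 vx)) !(negbTE (old_neq e1 vy)) !(negbTE (old_neq e2 vy)).
by case: (e.1 == k); case: (e.2 == k) => /=; ring.
Qed.

Lemma sum_err (I : finType) (P : pred I) (dV dL : I -> R) (dc : I -> 'I_n0 * 'I_n0 -> R) :
  \sum_(i | P i) (dV i - (beta ^+ 2 / 2 * dL i + iN * \sum_(e <- G) dc i e * W e)) =
  \sum_(i | P i) dV i - (beta ^+ 2 / 2 * \sum_(i | P i) dL i +
    iN * \sum_(e <- G) (\sum_(i | P i) dc i e) * W e).
Proof.
rewrite sumrB big_split /= -!mulr_sumr exchange_big; congr (_ - (_ + _ * _)).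
by apply: eq_bigr => e _; rewrite mulr_suml.
Qed.

(** Summation over [k] closes the system: [cZrow] sums to [sumZ]. A proper edge is met once at each
    endpoint, whence [2 * cG]; for a loop the two coincide and the product term turns [2 * cG] into
    [cE]. *)
Lemma sum_errX : \sum_(k < n0 | (k < v)%N) (lin_err k x - lin_err x y) =
  SX - (beta ^+ 2 / 2 * (2 * cG * SZ + cE * SY + (2 * cA - 4 * cG) * SX) +
        iN * (2 * cG * WE + cE * WL)).
Proof.
rewrite (eq_bigr (fun k => X k - (beta ^+ 2 / 2 * (LamV (edgec k x) - LamV (edgec x y)) +
  iN * \sum_(e <- G) (edgec k x e.1 e.2 - edgec x y e.1 e.2) * W e))) => [|k kv]; last first.
  under eq_bigr do rewrite mulrBl.
  by rewrite sumrB /lin_err /Submission.cX; ring.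
rewrite sum_err (self_split (c1 := 2 * cG) (c2 := cE)) => [|e eG]; last first.
  have [e1 e2] := mem_old eG.
  rewrite (eq_bigr _ (fun k kv => selfkx kv eG)).
  rewrite !big_split /= !(sum_indicator (fun k : 'I_n0 => (k < v)%N)) e1 e2 [e.2 == e.1]eq_sym /=.
  by ring.
congr (_ - (_ * _ + _)); rewrite (eq_bigr _ (fun k kv => Lam_diffX kv)) /sumZ /sumY /sumX !mulr_sumr.
by rewrite -!big_split.
Qed.

Lemma sum_errY : \sum_(k < n0 | (k < v)%N) (lin_err k k - lin_err x x) =
  SY - (beta ^+ 2 / 2 * (2 * cE * SZ + cD * SY - 4 * cE * SX) +
        iN * (2 * cE * WE + cD * WL)).
Proof.
rewrite (eq_bigr (fun k => Y k - (beta ^+ 2 / 2 * (LamV (edgec k k) - LamV (edgec x x)) +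
  iN * \sum_(e <- G) (edgec k k e.1 e.2 - edgec x x e.1 e.2) * W e))) => [|k kv]; last first.
  under eq_bigr do rewrite mulrBl.
  by rewrite sumrB /lin_err /Submission.cY; ring.
rewrite sum_err (self_split (c1 := 2 * cE) (c2 := cD)) => [|e eG]; last first.
  have [e1 e2] := mem_old eG.
  rewrite (eq_bigr (fun k => (e.1 == k)%:R * cE + (e.2 == k)%:R * cE +
     (e.1 == k)%:R * ((cD - 2 * cE) * (e.2 == k)%:R))) => [|k kv].
    rewrite !big_split /= !(sum_indicator (fun k : 'I_n0 => (k < v)%N)) e1 e2 [e.2 == e.1]eq_sym /=.
    by ring.
  rewrite !edgec_same !(negbTE (old_neq e1 vx)) !(negbTE (old_neq e2 vx)).
  by case: (e.1 == k); case: (e.2 == k) => /=; ring.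
congr (_ - (_ * _ + _)); rewrite (eq_bigr _ (fun k kv => Lam_diffY kv)) /sumZ /sumY /sumX !mulr_sumr.
by rewrite -!big_split -sumrB.
Qed.

(** A proper edge is met as [(k, l)] in both orders and a loop never, because [l != k]. *)
Lemma sum_errZ : \sum_(k < n0 | (k < v)%N) \sum_(l < n0 | (l < v)%N && (l != k))
    (lin_err k l - lin_err k x - lin_err l x + lin_err x y) =
  SZ - (beta ^+ 2 / 2 * (2 * cA * SZ) + iN * (2 * cA * WE)).
Proof.
rewrite (eq_bigr (fun k => Zrow k - (beta ^+ 2 / 2 * (2 * cA * Zrow k) +
  iN * \sum_(e <- G) (\sum_(l < n0 | (l < v)%N && (l != k))
    (cA * ((e.1 == k)%:R * (e.2 == l)%:R + (e.1 == l)%:R * (e.2 == k)%:R))) * W e))) => [|k kv]; last first.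
  rewrite [X in beta ^+ 2 / 2 * X]mulr_sumr -sum_err; apply: eq_bigr => l /andP[lv lk].
  rewrite -Lam_diffZ// 1?eq_sym//.
  have -> : \sum_(e <- G) cA * ((e.1 == k)%:R * (e.2 == l)%:R + (e.1 == l)%:R * (e.2 == k)%:R) * W e =
    \sum_(e <- G) edgec k l e.1 e.2 * W e - \sum_(e <- G) edgec k x e.1 e.2 * W e -
    \sum_(e <- G) edgec l x e.1 e.2 * W e + \sum_(e <- G) edgec x y e.1 e.2 * W e.
    rewrite -!sumrB -big_split big_seq [RHS]big_seq; apply: eq_bigr => e eG.
    have [e1 e2] := mem_old eG; have kl : k != l by rewrite eq_sym.
    rewrite !edgec_distinct ?(old_neq kv vx) ?(old_neq lv vx)//.
    rewrite !(negbTE (old_neq e1 vx)) !(negbTE (old_neq e2 vx)) !(negbTE (old_neq e1 vy)) !(negbTE (old_neq e2 vy)) /=.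
    by ring.
  by rewrite /lin_err /Submission.cZ; ring.
rewrite sum_err (self_split (c1 := 2 * cA) (c2 := 0)) => [|e eG].
  by rewrite -!mulr_sumr mul0r addr0.
have [e1 e2] := mem_old eG.
rewrite (eq_bigr (fun k => (e.1 == k)%:R * (cA * (e.2 != k)%:R) + (e.2 == k)%:R * (cA * (e.1 != k)%:R))).
  rewrite big_split /= !(sum_indicator (fun k : 'I_n0 => (k < v)%N)) e1 e2 [e.2 == e.1]eq_sym /=.
  by case: (e.1 == e.2) => /=; ring.
move=> k kv; rewrite -mulr_sumr big_split /=.
rewrite (eq_bigr (fun l => (e.2 == l)%:R * (e.1 == k)%:R)) => [|l _]; last exact: mulrC.
by rewrite !(sum_indicator (fun l : 'I_n0 => (l < v)%N && (l != k))) e1 e2 /=; ring.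
Qed.

Lemma err_t : lin_err x y = t - (beta ^+ 2 / 2 *
  (cI3 * SZ + cI5 * SY + (4 * cG - 2 * cI3) * SX + 2 * cE * s + (2 * cA - 4 * cG) * t) +
  iN * (cI3 * WE + cI5 * WL)).
Proof.
rewrite /lin_err Lamt (self_split (c1 := cI3) (c2 := cI5))// => e eG.
have [e1 e2] := mem_old eG; rewrite edgec_distinct//.
rewrite !(negbTE (old_neq e1 vx)) !(negbTE (old_neq e2 vx)) !(negbTE (old_neq e1 vy)) !(negbTE (old_neq e2 vy)) /=.
by ring.
Qed.

Lemma err_s : lin_err x x = s - (beta ^+ 2 / 2 *
  (cI5 * SZ + cK4 * SY + 2 * (cE - cI5) * SX + cD * s - 2 * cE * t) +
  iN * (cI5 * WE + cK4 * WL)).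
Proof.
rewrite /lin_err Lams (self_split (c1 := cI5) (c2 := cK4))// => e eG.
have [e1 e2] := mem_old eG; rewrite edgec_same.
rewrite !(negbTE (old_neq e1 vx)) !(negbTE (old_neq e2 vx)) /=.
by ring.
Qed.

End Aggregate.

(** The determinant [M] cleared of its fraction, in the form of the side condition left by
    [field]. *)
Lemma double_det_neq0 (R : realType) (b F G E DD : R) :
  (1 - b ^+ 2 * (F - 3 * G)) * (1 - b ^+ 2 / 2 * DD) + b ^+ 4 * E ^+ 2 != 0 ->
  (1 - b ^+ 2 * (F - 3 * G)) * (2 - b ^+ 2 * DD) + b ^+ 4 * E ^+ 2 * 2 != 0.
Proof.
move=> m; have -> : (1 - b ^+ 2 * (F - 3 * G)) * (2 - b ^+ 2 * DD) + b ^+ 4 * E ^+ 2 * 2 =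
  2 * ((1 - b ^+ 2 * (F - 3 * G)) * (1 - b ^+ 2 / 2 * DD) + b ^+ 4 * E ^+ 2) by field.
by rewrite mulf_neq0// pnatr_eq0.
Qed.

(** * Explicit solution of the linear systems *)

Section Solve.
Variables (R : realType) (Sc : nat) (beta h D p q : R) (N : nat) (SX SY SZ WE WL t s : R).
Notation cA := (cA Sc beta h D p q).
Notation cD := (cD Sc beta h D p q).
Notation cE := (cE Sc beta h D p q).
Notation cF := (cF Sc beta h D p q).
Notation cG := (cG Sc beta h D p q).
Notation cI3 := (cI3 Sc beta h D p q).
Notation cI5 := (cI5 Sc beta h D p q).
Notation cK4 := (cK4 Sc beta h D p q).
Notation cM := (cM Sc beta h D p q).
Notation cM1 := (cM1 Sc beta h D p q).
Notation cM2 := (cM2 Sc beta h D p q).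
Notation cM3 := (cM3 Sc beta h D p q).
Notation iN := (N%:R^-1 : R).
Hypothesis M0 : cM != 0.
Hypothesis M30 : cM3 != 0.
Hypothesis N0 : N%:R != 0 :> R.

(** Hence [cM3 = 1 - beta^2 cA]: the denominator in [A_2^2] and the factor [M_3] in [A_1^2] are the
    same number. *)
Lemma cA_FG : cA = cF - cG.
Proof. by rewrite cAE cFE cGE; ring. Qed.

(* The cavity errors eX, ..., es of the linear equations, and the errors dX, dY, dZ of
   their solutions. *)
Definition eX := SX - (beta ^+ 2 / 2 * (2 * cG * SZ + cE * SY + (2 * cA - 4 * cG) * SX) +
        iN * (2 * cG * WE + cE * WL)).
Definition eY := SY - (beta ^+ 2 / 2 * (2 * cE * SZ + cD * SY - 4 * cE * SX) +
        iN * (2 * cE * WE + cD * WL)).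
Definition eZ := SZ - (beta ^+ 2 / 2 * (2 * cA * SZ) + iN * (2 * cA * WE)).
Definition et := t - (beta ^+ 2 / 2 *
  (cI3 * SZ + cI5 * SY + (4 * cG - 2 * cI3) * SX + 2 * cE * s + (2 * cA - 4 * cG) * t) +
  iN * (cI3 * WE + cI5 * WL)).
Definition es := s - (beta ^+ 2 / 2 *
  (cI5 * SZ + cK4 * SY + 2 * (cE - cI5) * SX + cD * s - 2 * cE * t) +
  iN * (cI5 * WE + cK4 * WL)).
Definition dX := SX - (2 * cA1sq Sc beta h D p q N * WE + cC1sq Sc beta h D p q N * WL).
Definition dY := SY - (2 * cC1sq Sc beta h D p q N * WE + cB1sq Sc beta h D p q N * WL).
Definition dZ := SZ - 2 * cA2sq Sc beta h D p q N * WE.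
Definition tail_t := beta ^+ 2 / 2 * (cI3 * dZ + cI5 * dY + (4 * cG - 2 * cI3) * dX).
Definition tail_s := beta ^+ 2 / 2 * (cI5 * dZ + cK4 * dY + 2 * (cE - cI5) * dX).

Lemma solveZ : dZ = cM3^-1 * eZ.
Proof.
move: M30 N0; rewrite /dZ /eZ /cA2sq cA_FG /cM3 /NR.
move: cF cG (N%:R) => F G n; move=> m3 n0; field.
by rewrite n0 m3.
Qed.

(** [(SX, SY)] solves the system with rows [(M_1, - beta^2 E / 2)] and [(2 beta^2 E, M_2)], of
    determinant [M], with [SZ] on the right. [A_1^2], [B_1^2] and [C_1^2] come from the [1/N] terms
    and the leading part of [SZ]; the errors and [dZ] remain. *)
Lemma solveX : dX = cM^-1 *
  (cM2 * (eX + beta ^+ 2 * cG * dZ) + beta ^+ 2 / 2 * cE * (eY + beta ^+ 2 * cE * dZ)).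
Proof.
move: M0 M30 N0; rewrite /dX /dZ /eX /eY /cA2sq /cA1sq /cC1sq cA_FG /cM /cM1 /cM2 /cM3 /NR.
move: cF cG cE cD (N%:R) => F G E DD n; move=> m m3 n0; field.
by rewrite n0 m3 double_det_neq0.
Qed.

Lemma solveY : dY = cM^-1 *
  (cM1 * (eY + beta ^+ 2 * cE * dZ) - 2 * beta ^+ 2 * cE * (eX + beta ^+ 2 * cG * dZ)).
Proof.
move: M0 M30 N0; rewrite /dY /dZ /eX /eY /cA2sq /cB1sq /cC1sq cA_FG /cM /cM1 /cM2 /cM3 /NR.
move: cF cG cE cD (N%:R) => F G E DD n; move=> m m3 n0; field.
by rewrite n0 m3 double_det_neq0.
Qed.

(** [(t, s)] solves the system with rows [(M_1, - beta^2 E)] and [(beta^2 E, M_2)], again of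
    determinant [M]. The leading parts of [SX], [SY], [SZ] on its right side produce [A_0^2] and
    [C_0^2]; the errors [dX], [dY], [dZ] go into the tails. *)
Lemma solve_t : t - (cA0sq Sc beta h D p q N * WE + cC0sq Sc beta h D p q N * WL) =
  cM^-1 * (cM2 * (et + tail_t) + beta ^+ 2 * cE * (es + tail_s)).
Proof.
move: M0 N0; rewrite /tail_t /tail_s /dX /dY /dZ /et /es /cA0sq /cC0sq.
rewrite cA_FG /NR.
move: (cA1sq _ _ _ _ _ _ _) (cA2sq _ _ _ _ _ _ _) (cB1sq _ _ _ _ _ _ _) (cC1sq _ _ _ _ _ _ _) => a1 a2 b1 c1.
rewrite /cM /cM1 /cM2.
move: cF cG cE cD cI3 cI5 cK4 (N%:R) => F G E DD i3 i5 k4 n; move=> m n0; field.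
by rewrite n0 double_det_neq0.
Qed.

(** Loops are expanded only once no factor [T] is left, which is the case [WE = 0]. *)
Lemma solve_s : WE = 0 -> s - cB0sq Sc beta h D p q N * WL =
  cM^-1 * (cM1 * (es + tail_s) - beta ^+ 2 * cE * (et + tail_t)).
Proof.
move: M0 N0; rewrite /tail_t /tail_s /dX /dY /dZ /et /es /cB0sq => + + ->.
rewrite cA_FG /NR.
move: (cA1sq _ _ _ _ _ _ _) (cA2sq _ _ _ _ _ _ _) (cB1sq _ _ _ _ _ _ _) (cC1sq _ _ _ _ _ _ _) => a1 a2 b1 c1.
rewrite /cM /cM1 /cM2.
move: cF cG cE cD cI3 cI5 cK4 (N%:R) => F G E DD i3 i5 k4 n; move=> m n0; field.
by rewrite n0 double_det_neq0.
Qed.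

End Solve.

(** * Recursion for adding an edge or a loop *)

Section Recursion.
Variables (R : realType) (Sc : nat) (beta h D p q : R) (n0 v : nat).
Notation nu N' := (@nu R Sc N' beta h D p q n0).
Notation U N' := (@U R Sc N' p q n0).
Notation B := (Sc%:R ^+ 2 : R).
Notation prodU N' := (@prodU R Sc p q n0 N').
Notation graph := (seq ('I_n0 * 'I_n0)).

Hypothesis fix_pt : fixed_point Sc beta h D p q.
Hypothesis qB : q <= B.
Hypothesis pB : `|p| <= B.
Hypothesis small : 4 * kappa Sc beta <= 1 / 2.
Hypothesis vn0 : (v.+4.+3 < n0)%N.
Hypothesis M0 : cM Sc beta h D p q != 0.
Hypothesis M30 : cM3 Sc beta h D p q != 0.

Variables (x y : 'I_n0) (G : graph).
Hypothesis xE : x = v :> nat.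
Hypothesis yE : y = v.+1 :> nat.
Hypothesis uG : uniq G.
Hypothesis Gv : in_first v G.

Notation V N' := (@nuV R Sc beta h D p q n0 G N').
Notation W N' := (@nuW R Sc beta h D p q n0 G N').
Notation err N' := (@lin_err R n0 v (V N') Sc beta h D p q (N'.+1%:R^-1) G (W N')).

Let vx : (v <= x)%N. Proof. by rewrite xE. Qed.
Let vy : (v <= y)%N. Proof. by rewrite yE. Qed.
Let xn : (x < v.+2)%N. Proof. by rewrite xE. Qed.
Let yn : (y < v.+2)%N. Proof. by rewrite yE. Qed.
Let xy : x != y. Proof. by rewrite -(inj_eq val_inj) /= xE yE neq_ltn ltnSn. Qed.
Let nn0 : (v.+3 < n0)%N. Proof. by move: vn0; clear; lia. Qed.

Let errO (a b : 'I_n0) : (a < v.+2)%N -> (b < v.+2)%N -> rhoO (size G).+2 (fun N' => err N' a b).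
Proof. exact: (edge_errO fix_pt qB pB small vn0 uG Gv). Qed.

Let old_n (k : 'I_n0) : (k < v)%N -> (k < v.+2)%N.
Proof. by move=> kv; rewrite ltnS ltnW// ltnW. Qed.

Notation r2 := (size G).+2.
Let Vs N' := @nuV_sym R Sc beta h D p q n0 G N'.
Let Vof N' := @nuV_old_fresh R Sc beta h D p q n0 v x G xE Gv N'.
Let Vf N' := @nuV_fresh R Sc beta h D p q n0 v x y G xE yE Gv N'.
Let Vl N' := @nuV_loop R Sc beta h D p q n0 v x G xE Gv N'.

Let NN0 N' : N'.+1%:R != 0 :> R. Proof. by rewrite pnatr_eq0. Qed.

Notation SX N' := (sumX v x y (V N')).
Notation SY N' := (sumY v x (V N')).
Notation SZ N' := (sumZ v x y (V N')).
Notation E N' := (WE G (W N')).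
Notation L N' := (WL G (W N')).

Let OeZ : rhoO r2 (fun N' => eZ Sc beta h D p q N'.+1 (SZ N') (E N')).
Proof.
apply: (@rhoO_eq R _ (fun N' => \sum_(k < n0 | (k < v)%N) \sum_(l < n0 | (l < v)%N && (l != k))
    (err N' k l - err N' k x - err N' l x + err N' x y))) => [N'|].
  exact: (sum_errZ vx vy xn yn xy nn0 (@Vs N') (@Vof N') (@Vf N') (@Vl N')).
apply: rhoO_sum => k kv; apply: rhoO_sum => l /andP[lv _].
by apply: rhoO_add; [apply: rhoO_sub; [apply: rhoO_sub|]|]; apply: errO => //; exact: old_n.
Qed.

Let OeX : rhoO r2 (fun N' => eX Sc beta h D p q N'.+1 (SX N') (SY N') (SZ N') (E N') (L N')).
Proof.
apply: (@rhoO_eq R _ (fun N' => \sum_(k < n0 | (k < v)%N) (err N' k x - err N' x y))) => [N'|].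
  exact: (sum_errX vx vy xn yn xy nn0 (@Vs N') (@Vof N') (@Vf N') (@Vl N')).
by apply: rhoO_sum => k kv; apply: rhoO_sub; apply: errO => //; exact: old_n.
Qed.

Let OeY : rhoO r2 (fun N' => eY Sc beta h D p q N'.+1 (SX N') (SY N') (SZ N') (E N') (L N')).
Proof.
apply: (@rhoO_eq R _ (fun N' => \sum_(k < n0 | (k < v)%N) (err N' k k - err N' x x))) => [N'|].
  exact: (sum_errY vx xn nn0 (@Vs N') (@Vof N') (@Vf N') (@Vl N')).
by apply: rhoO_sum => k kv; apply: rhoO_sub; apply: errO => //; exact: old_n.
Qed.

Let Oet : rhoO r2 (fun N' => et Sc beta h D p q N'.+1 (SX N') (SY N') (SZ N') (E N') (L N')
  (V N' x y) (V N' x x)).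
Proof.
apply: (@rhoO_eq R _ (fun N' => err N' x y)) => [N'|]; last exact: errO.
exact: (err_t vx vy xn yn xy nn0 (@Vs N') (@Vof N') (@Vf N') (@Vl N')).
Qed.

Let Oes : rhoO r2 (fun N' => es Sc beta h D p q N'.+1 (SX N') (SY N') (SZ N') (E N') (L N')
  (V N' x y) (V N' x x)).
Proof.
apply: (@rhoO_eq R _ (fun N' => err N' x x)) => [N'|]; last exact: errO.
exact: (err_s vx xn nn0 (@Vs N') (@Vof N') (@Vf N') (@Vl N')).
Qed.

Let OdZ : rhoO r2 (fun N' => dZ Sc beta h D p q N'.+1 (SZ N') (E N')).
Proof.
by apply: (rhoO_eq _ (rhoO_scale (cM3 Sc beta h D p q)^-1 OeZ)) => N'; rewrite -solveZ.
Qed.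

Let OdX : rhoO r2 (fun N' => dX Sc beta h D p q N'.+1 (SX N') (E N') (L N')).
Proof.
apply: (@rhoO_eq R _ _ _ (fun N' => esym (solveX (SX N') (SY N') (SZ N') (E N') (L N') M0 M30 (NN0 N')))).
by do ![exact: OeX|exact: OeY|exact: OdZ|apply: rhoO_scale|apply: rhoO_add].
Qed.

Let OdY : rhoO r2 (fun N' => dY Sc beta h D p q N'.+1 (SY N') (E N') (L N')).
Proof.
apply: (@rhoO_eq R _ _ _ (fun N' => esym (solveY (SX N') (SY N') (SZ N') (E N') (L N') M0 M30 (NN0 N')))).
by do ![exact: OeX|exact: OeY|exact: OdZ|apply: rhoO_scale|apply: rhoO_sub|apply: rhoO_add].
Qed.

Let Otail_t : rhoO r2 (fun N' => tail_t Sc beta h D p q N'.+1 (SX N') (SY N') (SZ N') (E N') (L N')).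
Proof.
by rewrite /tail_t; do ![exact: OdX|exact: OdY|exact: OdZ|apply: rhoO_scale|apply: rhoO_add].
Qed.

Let Otail_s : rhoO r2 (fun N' => tail_s Sc beta h D p q N'.+1 (SX N') (SY N') (SZ N') (E N') (L N')).
Proof.
by rewrite /tail_s; do ![exact: OdX|exact: OdY|exact: OdZ|apply: rhoO_scale|apply: rhoO_add].
Qed.

Lemma edge_recursion : rhoO r2 (fun N' => V N' x y -
  (cA0sq Sc beta h D p q N'.+1 * E N' + cC0sq Sc beta h D p q N'.+1 * L N')).
Proof.
apply: (@rhoO_eq R _ _ _ (fun N' => esym (solve_t (SX N') (SY N') (SZ N') (E N') (L N')
  (V N' x y) (V N' x x) M0 (NN0 N')))).
apply: rhoO_scale; apply: rhoO_add; apply: rhoO_scale; apply: rhoO_add.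
- exact: Oet.
- exact: Otail_t.
- exact: Oes.
- exact: Otail_s.
Qed.

Lemma loop_recursion : (forall N', E N' = 0) ->
  rhoO r2 (fun N' => V N' x x - cB0sq Sc beta h D p q N'.+1 * L N').
Proof.
move=> E0.
apply: (@rhoO_eq R _ _ _ (fun N' => esym (solve_s (SX N') (SY N') (SZ N') (L N')
  (V N' x y) (V N' x x) M0 (NN0 N') (E0 N')))).
apply: rhoO_scale; apply: rhoO_sub; apply: rhoO_scale; apply: rhoO_add.
- exact: Oes.
- exact: Otail_s.
- exact: Oet.
- exact: Otail_t.
Qed.

End Recursion.

(** * Moments of T and S *)

Section Graphs.
Variable n0 : nat.
Notation graph := (seq ('I_n0 * 'I_n0)).
Implicit Types (a : 'I_n0) (e : 'I_n0 * 'I_n0) (G : graph).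

Definition avoids a G := all (fun e : 'I_n0 * 'I_n0 => (a != e.1) && (a != e.2)) G.

(** No replica occurs in two edges, so that at fixed disorder the edge factors are independent. *)
Fixpoint disjoint_graph G :=
  if G is e :: G' then [&& avoids e.1 G', avoids e.2 G' & disjoint_graph G'] else true.

Definition nedges G := count (fun e : 'I_n0 * 'I_n0 => e.1 != e.2) G.
Definition nloops G := count (fun e : 'I_n0 * 'I_n0 => e.1 == e.2) G.

Lemma disjoint_uniq G : disjoint_graph G -> uniq G.
Proof.
elim: G => //= e G IH /and3P[/allP a1 _ dG]; rewrite IH// andbT.
by apply/negP => /a1; rewrite eqxx.
Qed.

Lemma avoids_rem a e G : avoids a G -> avoids a (rem e G).
Proof. by move=> /allP H; apply/allP => f /mem_rem /H. Qed.

Lemma disjoint_rem e G : disjoint_graph G -> disjoint_graph (rem e G).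
Proof.
elim: G => //= f G IH /and3P[a1 a2 dG]; case: (f == e) => //=.
by rewrite !avoids_rem// IH.
Qed.

Lemma count_rem_mem (P : pred ('I_n0 * 'I_n0)) e G : e \in G ->
  count P (rem e G) = (count P G - P e)%N.
Proof. by move=> eG; rewrite (seq.permP (perm_to_rem eG) P) /= addKn. Qed.

Lemma size_nedges G : size G = (nedges G + nloops G)%N.
Proof. by rewrite addnC /nedges /nloops -(count_predC (fun e => e.1 == e.2)). Qed.

Lemma avoids_first v G a : in_first v G -> (v <= a)%N -> avoids a G.
Proof.
move=> /allP H va; apply/allP => e /H /andP[e1 e2].
by rewrite -!(inj_eq val_inj) !neq_ltn (leq_trans e1 va) (leq_trans e2 va) !orbT.
Qed.

Lemma exists_disjoint_graph k k' : (k.*2 + k' <= n0)%N -> exists G,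
  [/\ disjoint_graph G, in_first (k.*2 + k') G, nedges G = k & nloops G = k'].
Proof.
elim: k => [|k IH] kn.
  elim: k' kn => [|k' IH] kn; first by exists [::].
  have [|G [dG Gv e0 l0]] := IH; first exact: ltnW.
  have v0 : (k' < n0)%N by [].
  pose a : 'I_n0 := Ordinal v0; exists ((a, a) :: G); split => /=.
  - by rewrite !(avoids_first Gv)// dG.
  - by rewrite !add0n !ltnSn /=; apply: in_first_weak Gv; exact: leqnSn.
  - by rewrite /nedges /= eqxx; exact: e0.
  - by rewrite /nloops /= eqxx -l0.
have [|G [dG Gv ek lk]] := IH; first by apply: leq_trans kn; rewrite doubleS !addSn ltnW.
set v := (k.*2 + k')%N in Gv; have E : (k.+1.*2 + k' = v.+2)%N by rewrite doubleS.
rewrite E in kn *; have v0 : (v < n0)%N by exact: ltnW.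
pose a : 'I_n0 := Ordinal v0; pose b : 'I_n0 := Ordinal kn.
have ab : a != b by rewrite -(inj_eq val_inj) /= neq_ltn ltnSn.
exists ((a, b) :: G); split => /=.
- by rewrite (avoids_first Gv)//= (avoids_first (a := b) Gv (leqnSn v))//= dG.
- rewrite ltnS leqnSn ltnSn /=; apply: in_first_weak Gv; exact: leq_trans (leqnSn _) (leqnSn _).
- by rewrite /nedges /= ab -ek.
- by rewrite /nloops /= (negbTE ab); exact: lk.
Qed.

End Graphs.

Section Disorder.
Variables (R : realType) (Sc N' : nat) (beta h D p q : R) (n0 : nat).
Notation N := N'.+1.
Notation O := (config Sc N).
Notation T := {ffun 'I_n0 -> O}.
Notation sp := (@spin R Sc).
Notation nu := (@nu R Sc N' beta h D p q n0).
Notation U := (@U R Sc N' p q n0).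
Notation prodU := (@prodU R Sc p q n0 N').

Lemma prodU_setrep G (s : T) u o : avoids u G -> prodU G (setrep s u o) = prodU G s.
Proof.
move=> /allP uG; rewrite /Submission.prodU big_seq [RHS]big_seq; apply: eq_bigr => e /uG /andP[u1 u2].
by rewrite /Submission.U /Rfull !ffunE eq_sym (negbTE u1) eq_sym (negbTE u2).
Qed.

(** The endpoints of the first edge are fresh for the rest, so each is averaged out by [rav_fresh];
    two distinct endpoints give the square of a site average. *)
Lemma rav_prodU (H : O -> R) G : disjoint_graph G -> rav H (prodU G) =
  (N%:R^-1 * \sum_(i < N) (avg H (fun o => sp (o i))) ^+ 2 - q) ^+ nedges G *
  (N%:R^-1 * \sum_(i < N) avg H (fun o => sp (o i) ^+ 2) - p) ^+ nloops G.
Proof.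
elim: G => [_|[a b] G IH /=].
  rewrite !expr0 mulr1 -[RHS](avg_cst [ffun=> o0 Sc N'] (fun s : T => \sum_l H (s l)) 1).
  by congr avg; apply/funext => s; rewrite /Submission.prodU big_nil.
move=> /and3P[aG bG dG]; rewrite /nedges /nloops /= -/(nedges G) -/(nloops G).
have fa (s : T) o : prodU G (setrep s a o) = prodU G s by exact: prodU_setrep.
have [ab|ab] := eqVneq a b; rewrite /= ?add0n ?add1n exprS.
  transitivity (N%:R^-1 * \sum_(i < N) rav H (fun s : T => prodU G s * sp (s a i) ^+ 2) -
      p * rav H (prodU G)).
    rewrite /rav -(avg_sum (rep0 (o0 Sc N') n0)) -!avgZ -avgB; congr avg; apply/funext => s.
    rewrite prodU_cons /Submission.U /Qv /Rfull -ab eqxx mulrBl -mulrA; congr (_ * _ - _).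
    by rewrite mulr_suml; apply: eq_bigr => i _; rewrite mulrC expr2.
  have F i : rav H (fun s : T => prodU G s * sp (s a i) ^+ 2) =
      rav H (prodU G) * avg H (fun o => sp (o i) ^+ 2).
    exact: (rav_fresh (o0 Sc N') H (fun o : O => sp (o i) ^+ 2) fa).
  rewrite (eq_bigr _ (fun i _ => F i)).
  by rewrite -mulr_sumr IH//; ring.
transitivity (N%:R^-1 * \sum_(i < N) rav H (fun s : T => prodU G s * sp (s a i) * sp (s b i)) -
      q * rav H (prodU G)).
  rewrite /rav -(avg_sum (rep0 (o0 Sc N') n0)) -!avgZ -avgB; congr avg; apply/funext => s.
  rewrite prodU_cons /Submission.U /Qv /Rfull (negbTE ab) mulrBl -mulrA; congr (_ * _ - _).
  by rewrite mulr_suml; apply: eq_bigr => i _; rewrite mulrC mulrA.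
have F i : rav H (fun s : T => prodU G s * sp (s a i) * sp (s b i)) =
    rav H (prodU G) * avg H (fun o => sp (o i)) ^+ 2.
  rewrite expr2 mulrA -(rav_fresh (o0 Sc N') H (fun o : O => sp (o i)) fa).
  apply: (rav_fresh (o0 Sc N') H (fun o : O => sp (o i))) => s o.
  by rewrite prodU_setrep// ffunE (negbTE ab).
rewrite (eq_bigr _ (fun i _ => F i)).
by rewrite -mulr_sumr IH//; ring.
Qed.

Lemma nu_prodU G : disjoint_graph G ->
  nu (pi / 2) (prodU G) = nuTS Sc N beta h D p q (nedges G) (nloops G).
Proof.
by move=> dG; rewrite nu_pihalf; congr gaussE; apply/funext => g; rewrite rav_prodU.
Qed.

End Disorder.

(** * High temperature *)

(** [384 = 2 * 4 * 48]: the factor 4 of the conclusion, the 48 of [kappa], and 2 to reach [1/2]. *)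
Lemma kappa_alg (R : realType) (b bt L1 kp : R) : kp <= bt * b * 48 * L1 ->
  bt * (1 + 384 * b * L1 + 16 * b) <= 1 -> 0 <= bt * b -> 0 <= bt -> 4 * kp <= 1 / 2.
Proof.
have -> : bt * b * 48 * L1 = 48 * (bt * b * L1) by ring.
have -> : bt * (1 + 384 * b * L1 + 16 * b) = bt + 384 * (bt * b * L1) + 16 * (bt * b) by ring.
by set u := bt * b * L1; set w := bt * b; lra.
Qed.

Lemma small_product (R : realType) (b bt L1 : R) :
  bt * (1 + 384 * b * L1 + 16 * b) <= 1 -> 0 <= bt * (384 * b * L1) -> 0 <= bt -> bt * b <= 1 / 16.
Proof.
have -> : bt * (1 + 384 * b * L1 + 16 * b) = bt + bt * (384 * b * L1) + 16 * (bt * b) by ring.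
by set u := bt * (384 * b * L1); set w := bt * b; lra.
Qed.

(** The bound [1/16] gives [M_1 >= 1 - (1 + 4 + 3) / 16 = 1/2], and [M_2] and [M_3] are positive by
    the same count. The argument [e] stands for [beta^4 E^2]. *)
Lemma dets_pos (R : realType) (bt a b c d e : R) : 0 <= e -> `|bt * a| <= 1 / 16 ->
  `|bt * b| <= 1 / 16 -> `|bt * c| <= 1 / 16 -> `|bt * d| <= 1 / 16 ->
  0 < (1 - bt * (c - b - 3 * (b - a))) * (1 - bt / 2 * (d - c)) + e /\
  0 < 1 - bt * (c - b - (b - a)).
Proof.
have -> : 1 - bt * (c - b - 3 * (b - a)) = 1 - bt * c + 4 * (bt * b) - 3 * (bt * a) by ring.
have -> : 1 - bt / 2 * (d - c) = 1 - (bt * d) / 2 + (bt * c) / 2 by field.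
have -> : 1 - bt * (c - b - (b - a)) = 1 - bt * c + 2 * (bt * b) - bt * a by ring.
move: (bt * a) (bt * b) (bt * c) (bt * d) => {}a {}b {}c {}d e0.
rewrite !ler_norml => /andP[a1 a2] /andP[b1 b2] /andP[c1 c2] /andP[d1 d2].
have p1 : 0 < 1 - c + 4 * b - 3 * a by lra.
have p2 : 0 < 1 - d / 2 + c / 2 by lra.
by split; [rewrite ltr_pwDl// mulr_gt0|lra].
Qed.

Section Smallness.
Variables (R : realType) (Sc : nat) (beta h D p q : R).
Notation mom := (mom Sc beta h D p q).
Notation B := (Sc%:R ^+ 2 : R).
Notation eok f := (polylip 1 (fun g : nat -> R => f (g 0%N))).

Lemma etaE_bound (f : R -> R) (K : R) : eok f -> (forall z, `|f z| <= K) -> `|etaE f| <= K.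
Proof.
move=> pf fK; rewrite etaE_gint.
have p1 : polylip1 f.
  have := polylip_upd (fun=> 0) 0%N pf.
  by congr polylip1; apply/funext => x; rewrite upd_same.
apply: (le_trans (gint_norm_le p1)).
have pc : polylip1 (fun _ : R => 1 : R).
  by exists 0 => //; exists 0%N => x y; rewrite subrr normr0 !mul0r.
have -> : K = gint (fun _ : R => K * 1) by rewrite gintZ ?gint1 ?mulr1//; exact: polylip1_gintegrable.
apply: gint_le => [||x]; last by rewrite mulr1.
  exact/polylip1_gintegrable/polylip1_norm.
exact/polylip1_gintegrable/polylip1Z.
Qed.

Lemma mom_bound j z : `|mom j z| <= Sc%:R ^+ j.
Proof.
apply: (@avg_bound R _ (Ordinal (spin_dim_gt0 Sc)) (fun k => beta * Num.sqrt q * z * spin R k + h * spin R k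
        + (D + beta ^+ 2 / 2 * (p - q)) * spin R k ^+ 2) (fun k => spin R k ^+ j)) => k.
by rewrite normrX lerX// spin_bound.
Qed.

Let K4 : R := Sc%:R ^+ 4.

Lemma moment_consts_bound : [/\ `|m1111 Sc beta h D p q| <= K4, `|m112 Sc beta h D p q| <= K4,
  `|m22 Sc beta h D p q| <= K4 & `|m4 Sc beta h D p q| <= K4].
Proof.
split; apply: etaE_bound.
- exact/polylipX/eok_mom.
- by move=> z; rewrite normrX lerX// -[leRHS]expr1 mom_bound.
- by apply: polylipM; [exact/polylipX/eok_mom|exact: eok_mom].
- move=> z; rewrite normrM normrX /K4 (exprD _ 2 2); apply: ler_pM; rewrite ?exprn_ge0 ?mom_bound//.
  by rewrite lerX// -[leRHS]expr1 mom_bound.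
- exact/polylipX/eok_mom.
- by move=> z; rewrite normrX /K4 (exprM _ 2 2) lerX// mom_bound.
- exact: eok_mom.
- by move=> z; exact: mom_bound.
Qed.

Hypothesis b0 : 0 < beta.
Hypothesis b1 : beta < (1 + 384 * (B * B) * expR (Lcst Sc 1 2) + 16 * (B * B))^-1.
Hypothesis fix_pt : fixed_point Sc beta h D p q.

Lemma fixed_point_bounds : q <= B /\ `|p| <= B.
Proof.
have [q0 [qE pE]] := fix_pt; split.
  apply: le_trans (ler_norm _) _; rewrite qE; apply: etaE_bound; first exact/polylipX/eok_mom.
  by move=> z; rewrite normrX lerX// -[leRHS]expr1 mom_bound.
by rewrite pE; apply: etaE_bound; [exact: eok_mom|move=> z; exact: mom_bound].
Qed.

Let L1 : R := expR (Lcst Sc 1 2).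
Let BB0 : 0 <= B * B. Proof. by apply: mulr_ge0; exact: sqr_ge0. Qed.
Let L10 : 0 <= L1. Proof. exact: expR_ge0. Qed.

(** The summand 1 in the threshold makes [beta <= 1], so that [beta^2 <= beta]. *)
Lemma beta_sq_small : beta <= 1 /\ beta ^+ 2 * (1 + 384 * (B * B) * L1 + 16 * (B * B)) <= 1.
Proof.
have := b1; rewrite -/L1; set Q := 1 + _ + _ => bQ.
have Q1 : 1 <= Q.
  rewrite /Q -addrA lerDl; apply: addr_ge0; last exact: mulr_ge0 (ler0n _ _) BB0.
  exact: mulr_ge0 (mulr_ge0 (ler0n _ _) BB0) L10.
have Q0 : 0 < Q by apply: lt_le_trans Q1.
have bQ1 : beta * Q < 1 by rewrite -ltr_pdivlMr// div1r.
have bb : beta <= 1.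
  by apply: le_trans (ltW bQ1); rewrite ler_peMr// ltW.
split=> //; rewrite expr2 -mulrA; apply: le_trans (ltW bQ1).
by rewrite ler_piMl// mulr_ge0// ltW.
Qed.

(** [kappa] contains beta in its Gronwall exponent. As [beta <= 1], that exponent is at most its
    value at 1, which is the one in the threshold. *)
Lemma kappa_small : 4 * kappa Sc beta <= 1 / 2.
Proof.
have [bb bQ] := beta_sq_small.
have LL : expR (Lcst Sc beta 2) <= L1.
  rewrite ler_expR /Lcst; apply: ler_wpM2r => //.
  by apply: ler_wpM2r; [rewrite !mulr_ge0|rewrite lerX// ltW].
have b2 : 0 <= beta ^+ 2 by exact: sqr_ge0.
have k1 : kappa Sc beta <= beta ^+ 2 * (B * B) * 48 * L1.
  by rewrite /kappa ler_wpM2l// mulr_ge0// mulr_ge0.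
apply: (kappa_alg k1 bQ _ b2); exact: mulr_ge0.
Qed.

Lemma dets_neq0 : cM Sc beta h D p q != 0 /\ cM3 Sc beta h D p q != 0.
Proof.
have [bb bQ] := beta_sq_small.
have [n1 n2 n3 n4] := moment_consts_bound.
have KB : K4 = B * B by rewrite /K4 (exprD _ 2 2).
have b2 : 0 <= beta ^+ 2 by exact: sqr_ge0.
have bK : beta ^+ 2 * K4 <= 1 / 16.
  rewrite KB; apply: (small_product bQ _ b2); apply: mulr_ge0; first exact: b2.
  exact: mulr_ge0 (mulr_ge0 (ler0n _ _) BB0) L10.
have bd (c : R) : `|c| <= K4 -> `|beta ^+ 2 * c| <= 1 / 16.
  move=> cK; rewrite normrM ger0_norm//; apply: le_trans bK; exact: ler_wpM2l.
rewrite /cM /cM3 /cM1 /cM2 cFE cGE cDE.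
have e4 : 0 <= beta ^+ 4 * (m13 Sc beta h D p q - m112 Sc beta h D p q) ^+ 2.
  by rewrite (exprM _ 2 2); apply: mulr_ge0; exact: sqr_ge0.
have [d1 d2] := dets_pos e4 (bd _ n1) (bd _ n2) (bd _ n3) (bd _ n4).
by rewrite cEE; split; rewrite gt_eqF.
Qed.

End Smallness.

Lemma sum_const_seq (R : realType) (I : Type) (r : seq I) (P : pred I) (c : R) :
  \sum_(i <- r | P i) c = (count P r)%:R * c.
Proof. by rewrite big_const_seq iter_addr_0 mulr_natl. Qed.

(** The alternative covers the truncated predecessor: when [k = 0] the exponents need not match, but
    the term is absent. *)
Lemma term_bound (R : realType) (k : nat) (A d KA K r : R) e m : 0 <= r -> 0 <= KA -> 0 <= K ->
  `|A| <= KA * r ^+ 2 -> `|d| <= K * r ^+ e -> k = 0%N \/ m = (e + 2)%N ->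
  `|k%:R * A * d| <= k%:R * KA * K * r ^+ m.
Proof.
move=> r0 KA0 K0 HA Hd [->|->]; first by rewrite !mul0r normr0.
rewrite -!mulrA normrM normr_nat; apply: ler_wpM2l => //; rewrite normrM.
have -> : KA * (K * r ^+ (e + 2)) = KA * r ^+ 2 * (K * r ^+ e) by rewrite exprD; ring.
by apply: ler_pM.
Qed.

Lemma telescope_alg (R : realType) (T A x C y z u : R) :
  T - (A * x + C * y) = (T - (A * z + C * u)) + (A * (z - x) + C * (u - y)).
Proof. by ring. Qed.

(** * Comparison with Gaussian moments *)

Section TSRecursion.
Variables (R : realType) (Sc : nat) (beta h D p q : R).
Notation B := (Sc%:R ^+ 2 : R).
Notation nuTS N' := (@nuTS R Sc N'.+1 beta h D p q).
Notation A0 N' := (cA0sq Sc beta h D p q N'.+1).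
Notation B0 N' := (cB0sq Sc beta h D p q N'.+1).
Notation C0 N' := (cC0sq Sc beta h D p q N'.+1).

Hypothesis fix_pt : fixed_point Sc beta h D p q.
Hypothesis qB : q <= B.
Hypothesis pB : `|p| <= B.
Hypothesis small : 4 * kappa Sc beta <= 1 / 2.
Hypothesis M0 : cM Sc beta h D p q != 0.
Hypothesis M30 : cM3 Sc beta h D p q != 0.

(** Deleting any proper edge leaves a disjoint graph with the same counts, so all terms are equal;
    their number is the factor [k] of the recursion. *)
Lemma WE_nuTS n0 (G : seq ('I_n0 * 'I_n0)) N' : disjoint_graph G ->
  WE G (@nuW R Sc beta h D p q n0 G N') = (nedges G)%:R * nuTS N' (nedges G).-1 (nloops G).
Proof.
move=> dG; rewrite -[RHS](sum_const_seq G (fun e => e.1 != e.2)) /WE big_seq_cond [RHS]big_seq_cond.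
apply: eq_bigr => e /andP[eG ne].
rewrite /nuW nu_prodU ?disjoint_rem// /nedges /nloops !count_rem_mem// ne (negbTE ne).
by rewrite subn0 subn1.
Qed.

Lemma WL_nuTS n0 (G : seq ('I_n0 * 'I_n0)) N' : disjoint_graph G ->
  WL G (@nuW R Sc beta h D p q n0 G N') = (nloops G)%:R * nuTS N' (nedges G) (nloops G).-1.
Proof.
move=> dG; rewrite -[RHS](sum_const_seq G (fun e => e.1 == e.2)) /WL big_seq_cond [RHS]big_seq_cond.
apply: eq_bigr => e /andP[eG ne].
rewrite /nuW nu_prodU ?disjoint_rem// /nedges /nloops !count_rem_mem// ne.
by rewrite subn0 subn1.
Qed.

Lemma nuV_nuTS n0 (G : seq ('I_n0 * 'I_n0)) (a b : 'I_n0) N' :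
  disjoint_graph G -> avoids a G -> avoids b G ->
  @nuV R Sc beta h D p q n0 G N' a b = nuTS N' ((a != b) + nedges G) ((a == b) + nloops G).
Proof.
move=> dG aG bG; transitivity (nu beta h D p q (pi / 2) (@prodU R Sc p q n0 N' ((a, b) :: G))).
  by apply: eq_nu => s; rewrite prodU_cons.
by rewrite nu_prodU//= aG bG.
Qed.

Lemma nuTS_edge_rec k k' : rhoO (k + k').+2 (fun N' => nuTS N' k.+1 k' -
  (k%:R * A0 N' * nuTS N' k.-1 k' + k'%:R * C0 N' * nuTS N' k k'.-1)).
Proof.
(* Besides the [v] replicas of the graph there are two fresh ones in the edge equations, two more
   for each of two generators, and two for the derivative in the Gronwall bound: eight in all. *)
set v := (k.*2 + k')%N; pose n0 := v.+4.+4.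
have vn : (k.*2 + k' <= n0)%N by rewrite /n0 -/v; do 8!apply: leqW.
have [G [dG Gv ek lk]] := exists_disjoint_graph vn; rewrite -/v in Gv.
have v0 : (v < n0)%N by do 7!apply: leqW.
have v1 : (v.+1 < n0)%N by do 6!apply: leqW.
pose x : 'I_n0 := Ordinal v0; pose y : 'I_n0 := Ordinal v1.
have xy : x != y by rewrite -(inj_eq val_inj) /= neq_ltn ltnSn.
have H := edge_recursion fix_pt qB pB small (ltnSn _ : (v.+4.+3 < n0)%N) M0 M30
  (erefl : x = v :> nat) (erefl : y = v.+1 :> nat) (disjoint_uniq dG) Gv.
rewrite size_nedges ek lk in H; apply: (rhoO_eq _ H) => N'.
rewrite WE_nuTS// WL_nuTS// nuV_nuTS//.
- by rewrite xy (negbTE xy) ek lk add1n add0n; congr (_ - (_ + _)); rewrite mulrCA mulrA.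
- exact: avoids_first Gv _.
- by apply: avoids_first Gv _; exact: leqW.
Qed.

Lemma nuTS_loop_rec k' : rhoO k'.+2 (fun N' => nuTS N' 0 k'.+1 -
  k'%:R * B0 N' * nuTS N' 0 k'.-1).
Proof.
pose n0 := k'.+4.+4.
have vn : (0.*2 + k' <= n0)%N by rewrite add0n /n0; do 8!apply: leqW.
have [G [dG Gv ek lk]] := exists_disjoint_graph vn; rewrite add0n in Gv.
have v0 : (k' < n0)%N by do 7!apply: leqW.
have v1 : (k'.+1 < n0)%N by do 6!apply: leqW.
pose x : 'I_n0 := Ordinal v0; pose y : 'I_n0 := Ordinal v1.
have E0 N' : WE G (@nuW R Sc beta h D p q n0 G N') = 0 by rewrite WE_nuTS// ek mul0r.
have H := loop_recursion fix_pt qB pB small (ltnSn _ : (k'.+4.+3 < n0)%N) M0 M30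
  (erefl : x = k' :> nat) (erefl : y = k'.+1 :> nat) (disjoint_uniq dG) Gv E0.
rewrite size_nedges ek lk add0n in H; apply: (rhoO_eq _ H) => N'.
rewrite WL_nuTS// nuV_nuTS//.
- by rewrite eqxx ek lk add1n add0n; congr (_ - _); rewrite mulrCA mulrA.
- exact: avoids_first Gv _.
- exact: avoids_first Gv _.
Qed.

Lemma nuTS00 N' : nuTS N' 0 0 = 1.
Proof.
have := @nu_prodU R Sc N' beta h D p q 1 [::] isT; rewrite /nedges /nloops /= => <-.
rewrite -[RHS](@nu_cst R Sc N' beta h D p q 1 (pi / 2)); apply: eq_nu => s.
by rewrite /prodU big_nil.
Qed.

Lemma rhoO_over_N (c m : R) : rhoO 2 (fun N' => c / (N'.+1%:R * m)).
Proof.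
apply: (rhoO_eq _ (rhoO_scale (c / m) (rhoO_invN R))) => N'.
by rewrite invfM mulrA mulrAC.
Qed.

Lemma cov_consts_O : [/\ rhoO 2 (fun N' => A0 N'), rhoO 2 (fun N' => B0 N') &
  rhoO 2 (fun N' => C0 N')].
Proof.
have a2 : rhoO 2 (fun N' => cA2sq Sc beta h D p q N'.+1) by exact: rhoO_over_N.
have a1 : rhoO 2 (fun N' => cA1sq Sc beta h D p q N'.+1).
  apply: (rhoO_eq _ (rhoO_over_N (cG Sc beta h D p q * cM2 Sc beta h D p q + beta ^+ 2 / 2 *
    cE Sc beta h D p q ^+ 2) (cM Sc beta h D p q * cM3 Sc beta h D p q))) => N'.
  by rewrite /cA1sq /NR -[N'.+1%:R * _ * _]mulrA.
have b1 : rhoO 2 (fun N' => cB1sq Sc beta h D p q N'.+1) by exact: rhoO_over_N.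
have c1 : rhoO 2 (fun N' => cC1sq Sc beta h D p q N'.+1) by exact: rhoO_over_N.
have i m c : rhoO 2 (fun N' => (m * NR R N'.+1)^-1 * c).
  by apply: (rhoO_eq _ (rhoO_over_N c m)) => N'; rewrite mulrC /NR [m * _]mulrC.
rewrite /cA0sq /cB0sq /cC0sq; split.
- apply: rhoO_add; last exact: i.
  by apply: rhoO_add; [apply: rhoO_add|]; apply: rhoO_scale.
- by apply: rhoO_add; [apply: rhoO_add; apply: rhoO_scale|exact: i].
- by apply: rhoO_add; [apply: rhoO_add; apply: rhoO_scale|exact: i].
Qed.

(** The constant precedes [N'] and [a], [b], [c], [d]: it serves every square root of the covariance
    matrix. *)
Definition TS_close k k' := exists2 K, 0 <= K & forall N' a b c d,
  a ^+ 2 + b ^+ 2 = A0 N' -> c ^+ 2 + d ^+ 2 = B0 N' -> a * c + b * d = C0 N' ->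
  `|nuTS N' k k' - gauss2_moment a b c d k k'| <= K * rho R N' ^+ (k + k').+1.

Lemma TS_close00 : TS_close 0 0.
Proof.
exists 0 => // N' a b c d _ _ _.
by rewrite nuTS00 gauss2_moment00 subrr normr0 mul0r.
Qed.

(** The coefficients are of order [rho^2], exactly what the errors of the two shorter moments lack
    to reach the order [k + k' + 2] of the recursion error. *)
Lemma TS_close_edge k k' : TS_close k.-1 k' -> TS_close k k'.-1 -> TS_close k.+1 k'.
Proof.
move=> [K1 K10 H1] [K2 K20 H2].
have [[KA KA0 HA] _ [KC KC0 HC]] := cov_consts_O.
have [K3 K30 H3] := nuTS_edge_rec k k'.
exists (K3 + (k%:R * KA * K1 + k'%:R * KC * K2)) => [|N' a b c d eA eB eC].
  by rewrite addr_ge0// addr_ge0// !mulr_ge0.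
have h1 := H1 N' a b c d eA eB eC; have h2 := H2 N' a b c d eA eB eC.
rewrite gauss2_momentSl eA eC.
have r0 := rho_ge0 R N'.
have -> : nuTS N' k.+1 k' - (k%:R * A0 N' * gauss2_moment a b c d k.-1 k' +
    k'%:R * C0 N' * gauss2_moment a b c d k k'.-1) =
  (nuTS N' k.+1 k' - (k%:R * A0 N' * nuTS N' k.-1 k' + k'%:R * C0 N' * nuTS N' k k'.-1)) +
  (k%:R * A0 N' * (nuTS N' k.-1 k' - gauss2_moment a b c d k.-1 k') +
   k'%:R * C0 N' * (nuTS N' k k'.-1 - gauss2_moment a b c d k k'.-1)).
  exact: telescope_alg.
apply: (le_trans (ler_normD _ _)); rewrite addSn [leRHS]mulrDl; apply: lerD; first exact: H3.
apply: (le_trans (ler_normD _ _)); rewrite [leRHS]mulrDl; apply: lerD.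
  by apply: term_bound (HA N') h1 _ => //; case: (k) => [|j]; [left|right; rewrite !addSn addn2].
by apply: term_bound (HC N') h2 _ => //; case: (k') => [|j]; [left|right; rewrite /= addnS addn2].
Qed.

Lemma TS_close_loop k' : TS_close 0 k'.-1 -> TS_close 0 k'.+1.
Proof.
move=> [K1 K10 H1].
have [_ [KB KB0 HB] _] := cov_consts_O.
have [K3 K30 H3] := nuTS_loop_rec k'.
exists (K3 + k'%:R * KB * K1) => [|N' a b c d eA eB eC].
  by rewrite addr_ge0// !mulr_ge0.
have h1 := H1 N' a b c d eA eB eC.
rewrite gauss2_momentSr eB.
have r0 := rho_ge0 R N'.
have -> : nuTS N' 0 k'.+1 - k'%:R * B0 N' * gauss2_moment a b c d 0 k'.-1 =
  (nuTS N' 0 k'.+1 - k'%:R * B0 N' * nuTS N' 0 k'.-1) +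
  k'%:R * B0 N' * (nuTS N' 0 k'.-1 - gauss2_moment a b c d 0 k'.-1).
  by rewrite mulrBr addrA subrK.
apply: (le_trans (ler_normD _ _)); rewrite add0n [leRHS]mulrDl; apply: lerD; first exact: H3.
by apply: term_bound (HB N') h1 _ => //; case: (k') => [|j]; [left|right; rewrite /= add0n addn2].
Qed.

Lemma TS_close_all k k' : TS_close k k'.
Proof.
(* Strong induction on [k + k']; factors [T] are removed first, since the loop recursion starts from
   graphs without proper edges. *)
have [n] := ubnP (k + k')%N; elim: n k k' => // n IH [|k] k' kn; last first.
  apply: TS_close_edge; apply: IH; rewrite ltnS addSn in kn; apply: leq_trans kn.
    by rewrite ltnS leq_add2r leq_pred.
  by rewrite ltnS leq_add2l leq_pred.
case: k' kn => [|k'] kn; first exact: TS_close00.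
apply: TS_close_loop; apply: IH; rewrite add0n ltnS in kn *; apply: leq_trans kn.
by rewrite ltnS leq_pred.
Qed.

End TSRecursion.

Lemma powR_rho (R : realType) N' k : (N'.+1%:R : R) `^ (- ((k + 1)%:R / 2)) = rho R N' ^+ k.+1.
Proof.
by rewrite powRN mulrC powRrM powR12_sqrt// powR_mulrn ?sqrtr_ge0// exprVn addn1.
Qed.

Theorem theorem4p11 (R : realType) (Sc : nat) (h D : R) :
  (1 <= Sc)%N -> 0 <= h ->
  exists beta' : R, 0 < beta' /\
  forall beta : R, 0 < beta -> beta < beta' ->
  forall p q : R, fixed_point Sc beta h D p q ->
  forall k k' : nat,
  exists C : R, forall N : nat, (2 <= N)%N ->
  forall a b c d : R,
    a ^+ 2 + b ^+ 2 = cA0sq Sc beta h D p q N ->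
    c ^+ 2 + d ^+ 2 = cB0sq Sc beta h D p q N ->
    a * c + b * d = cC0sq Sc beta h D p q N ->
    `| nuTS Sc N beta h D p q k k' - gauss2_moment a b c d k k' |
      <= C * (N%:R : R) `^ (- ((k + k' + 1)%:R / 2)).
Proof.
move=> _ _; set B : R := Sc%:R ^+ 2.
(* The 1 forces [beta < 1], the 384 makes [kappa] small enough for absorption, and the 16 keeps [M]
   and [M_3] positive. *)
exists (1 + 384 * (B * B) * expR (Lcst Sc 1 2) + 16 * (B * B))^-1; split.
  have BB0 : 0 <= B * B by apply: mulr_ge0; exact: sqr_ge0.
  rewrite invr_gt0 -addrA; apply: ltr_pwDl; first exact: ltr01.
  apply: addr_ge0; last exact: mulr_ge0 (ler0n _ _) BB0.
  exact: mulr_ge0 (mulr_ge0 (ler0n _ _) BB0) (expR_ge0 _).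
move=> beta b0 b1 p q fix_pt k k'.
have [qB pB] := fixed_point_bounds fix_pt.
have small := kappa_small b0 b1.
have [M0 M30] := dets_neq0 h D p q b0 b1.
have [K K0 H] := TS_close_all fix_pt qB pB small M0 M30 k k'.
exists K => -[//|N'] _ a b c d eA eB eC.
by rewrite powR_rho; exact: H.
Qed.
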